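(* Let $(Y_{i\,j})_{i,j\in\mathbb N}$ be independent identically distributed real random variables with $\mathbb E[Y_{1\,1}]=0$ and $\mathbb E[Y_{1\,1}^2]=1$. Fix $l_1,l_2\in\mathbb N$ and assume $\mathbb E[Y_{1\,1}^{2l_1+2l_2}]<\infty$. For $p\le n$ let $\mathbf X_{p,n}=(Y_{i\,j})_{i\le p,\,j\le n}$ and $\mathbf S_{p,n}=\frac1n\mathbf X_{p,n}\mathbf X_{p,n}^T$. Then for $p\le n$ $$\operatorname{Cov}[\operatorname{tr}(\mathbf S_{p,n}^{l_1}),\operatorname{tr}(\mathbf S_{p,n}^{l_2})]=\sum_{b=1}^{(l_1+l_2)\wedge p}\Bigg[\frac{\binom{p}{b}\binom{n-b}{l_1+l_2-b}}{n^{l_1+l_2}}\Big\{C(l_1,l_2,b)+\big(\mathbb E[Y_{1\,1}^4]-3\big)D(l_1,l_2,b)\Big\}+\mathcal O\Big(\frac{p^b}{n^{b+1}}\Big)\Bigg],$$ where $$C(l_1,l_2,b):=2\,b!\,(l_1+l_2-b)!\sum_{k=0}^{b}\binom{l_1}{k}\binom{l_2}{b-k}\sum_{m=0}^{b-k}m\binom{l_1}{k+m}\binom{l_2}{b-m-k}$$ and $$D(l_1,l_2,b):=b!\,(l_1+l_2-b)!\sum_{k=0}^{b-1}\binom{l_1}{k}\binom{l_1}{k+1}\binom{l_2}{b-1-k}\binom{l_2}{b-k}.$$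
   Context: $a\wedge b=\min(a,b)$; binomial coefficients $\binom{n}{k}$ are zero when $k>n$ or $k<0$. For each $b$, the term $\mathcal O(p^b/n^{b+1})$ denotes a quantity whose absolute value is bounded by $C\,p^b/n^{b+1}$ for a constant $C$ not depending on $p,n$ (uniformly over $p\le n$). *)

(* Defs.v *)
From HB Require Import structures.
From mathcomp Require Import all_boot all_order all_algebra.
From mathcomp Require Import all_classical all_reals all_analysis.
Set Implicit Arguments. Unset Strict Implicit. Unset Printing Implicit Defensive.
Import Order.TTheory GRing.Theory Num.Theory.
Local Open Scope classical_set_scope.
Local Open Scope ring_scope.

Section defs.
Context {d : measure_display} {T : measurableType d} {R : realType}
  (P : probability T R).

Definition mutually_independent (Y : nat -> nat -> {RV P >-> R}) : Prop :=
  forall (s : seq (nat * nat)) (B : nat * nat -> set R),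
    uniq s -> (forall k, measurable (B k)) ->
    P (\bigcap_(k in [set` s]) (Y k.1 k.2 @^-1` B k))
    = (\prod_(k <- s) P (Y k.1 k.2 @^-1` B k))%E.

Definition identically_distributed (Y : nat -> nat -> {RV P >-> R}) : Prop :=
  forall i j (A : set R), measurable A ->
    P (Y i j @^-1` A) = P (Y 0%N 0%N @^-1` A).

(* X_{p,n}(w) = (Y i j w)_{i < p, j < n}   (indices shifted to start at 0) *)
Definition Xmat (Y : nat -> nat -> {RV P >-> R}) (p n : nat) (w : T)
  : 'M[R]_(p, n) := \matrix_(i < p, j < n) Y i j w.

Definition Smat (Y : nat -> nat -> {RV P >-> R}) (p n : nat) (w : T)
  : 'M[R]_p := (n%:R)^-1 *: (Xmat Y p n w *m (Xmat Y p n w)^T).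

Definition trSpow (Y : nat -> nat -> {RV P >-> R}) (p n l : nat) : T -> R :=
  fun w => \tr (Smat Y p n w ^+ l).

End defs.

Definition Ccoef (l1 l2 b : nat) : nat :=
  (2 * b`! * (l1 + l2 - b)`! *
   \sum_(0 <= k < b.+1) 'C(l1, k) * 'C(l2, b - k) *
      \sum_(0 <= m < (b - k).+1) m * 'C(l1, k + m) * 'C(l2, b - m - k))%N.

Definition Dcoef (l1 l2 b : nat) : nat :=
  (b`! * (l1 + l2 - b)`! *
   \sum_(0 <= k < b) 'C(l1, k) * 'C(l1, k.+1) * 'C(l2, b.-1 - k) * 'C(l2, b - k))%N.

(* main term of the b-th summand, with kappa = E[Y^4] - 3 *)
Definition main_term {R : realType} (l1 l2 p n b : nat) (kappa : R) : R :=
  ('C(p, b)%:R * 'C(n - b, l1 + l2 - b)%:R / (n%:R ^+ (l1 + l2))) *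
  ((Ccoef l1 l2 b)%:R + kappa * (Dcoef l1 l2 b)%:R).

(* Main.v *)
Require Import Defs.
From HB Require Import structures.
From mathcomp Require Import all_boot all_order all_algebra.
From mathcomp Require Import zify ring.
Set Implicit Arguments. Unset Strict Implicit. Unset Printing Implicit Defensive.
Import Order.TTheory GRing.Theory Num.Theory.

(** Expanding the traces, [n ^ (l1 + l2)] times the covariance is a sum, over
    pairs of closed walks on the complete bipartite graph on [p] rows and [n]
    columns, of a weight that depends only on the multiplicities of the edges.

    Universality: if a pair of walks with non-zero weight visits at least
    [l1 + l2] vertices (fewer vertices contribute [O(p n ^ (l1 + l2 - 2))]), then
    its weight is the one for random signs, plus [E[Y^4] - 1] times the number of
    edges shared by two walks that cross each of their edges exactly twice.

    Random signs: with [T_m(a)] the coefficient of [z ^ m] in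
    [((n + z) (1 + p / z)) ^ a], and [T'_m(a)] the same coefficient for [n - 1]
    and [p - 1], [tr (X X^T) ^ a] is a constant plus the sum over [m >= 1] of
    [T'_m(a) C_m], where [C_m] is the sum over the cyclically non-backtracking
    closed walks of length [2 m]. The [C_m] are asymptotically uncorrelated: up
    to lower order only two copies of the same cycle contribute, in [2 m] ways,
    so that [Var C_m ~ 2 m (p n) ^ m] for [m >= 2].

    Counting the walks that cross each edge twice through the mean trace, the sum
    is that over [m >= 1] of [(2 m + kappa [m = 1]) (p n) ^ m T_m(l1) T_m(l2)] up
    to [O(p n ^ (l1 + l2 - 2))], where [kappa = E[Y^4] - 3]; collecting powers of
    [p] gives [C] and [D]. The whole error is bounded by a multiple of [p / n ^ 2],
    hence fits into the term [b = 1]. *)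

(** * Connectivity of edge sets of the bipartite graph *)

(** The threshold of [l1 + l2] vertices is where Euler's inequality decides. Two walks sharing an
    edge span a connected graph, so [V <= E + 1]; a non-zero weight needs every edge crossed at
    least twice in total, so [E <= l1 + l2]. Hence [E] is [l1 + l2] or [l1 + l2 - 1], and in the
    second case the graph is a tree with a single edge crossed four times.

    Random signs serve as the reference law because their squares equal 1: the passage from traces
    to non-backtracking walks is then an exact identity of Ihara-Bass type, and this identity is the
    origin of the shifted parameters [n - 1] and [p - 1].

    The constant 3 splits as 1 + 2. Signs give nothing at [m = 1], as no cyclically non-backtracking
    closed walk has length 2, while universality adds [E[Y^4] - 1 = 2 + (E[Y^4] - 3)] there; the 2
    is what the pattern [2 m] would otherwise miss.

    Bounding all vertices by [n] would be too weak: one row is always counted by [p], and this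
    single factor [p] has to survive every estimate for the error to fit the term [b = 1]. *)

Section Grid.
Variables (E I J : finType) (r : E -> I) (c : E -> J).
Implicit Types (F : {set E}) (e : E) (x y : E * bool).

Definition rows F : {set I} := [set r e | e in F].
Definition cols F : {set J} := [set c e | e in F].
Definition nvert F := (#|rows F| + #|cols F|)%N.

Lemma rowsU F G : rows (F :|: G) = rows F :|: rows G. Proof. exact: imsetU. Qed.
Lemma colsU F G : cols (F :|: G) = cols F :|: cols G. Proof. exact: imsetU. Qed.
Lemma rows1 e : rows [set e] = [set r e]. Proof. exact: imset_set1. Qed.
Lemma cols1 e : cols [set e] = [set c e]. Proof. exact: imset_set1. Qed.

Lemma in_rows e F : e \in F -> r e \in rows F.
Proof. by move=> eF; apply/imsetP; exists e. Qed.
Lemma in_cols e F : e \in F -> c e \in cols F.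
Proof. by move=> eF; apply/imsetP; exists e. Qed.

(** An edge touching [F] brings at most one new vertex, so the excess of vertices over edges does
    not grow along a connected exploration. *)
Lemma nvertU1 e F : (r e \in rows F) || (c e \in cols F) ->
  (nvert (e |: F) + #|F| <= nvert F + #|e |: F|)%N.
Proof.
rewrite /nvert rowsU colsU rows1 cols1 !cardsU1.
case: (boolP (e \in F)) => [eF|_]; first by rewrite in_rows ?in_cols.
by case: (r e \in _); case: (c e \in _) => //= _; lia.
Qed.

Lemma nvertU1_in e F : r e \in rows F -> c e \in cols F -> nvert (e |: F) = nvert F.
Proof. by move=> rF cF; rewrite /nvert rowsU colsU rows1 cols1 !cardsU1 rF cF. Qed.

(* The boolean tells which coordinate is kept when passing to the next edge. *)
Definition adj : rel (E * bool) := fun x y =>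
  (y.2 == ~~ x.2) && (if x.2 then r x.1 == r y.1 else c x.1 == c y.1).

Definition eset (w : seq E) : {set E} := [set e in w].

Lemma eset_cons e w : eset (e :: w) = e |: eset w.
Proof. by apply/setP => z; rewrite !inE. Qed.
Lemma eset_cat w1 w2 : eset (w1 ++ w2) = eset w1 :|: eset w2.
Proof. by apply/setP => z; rewrite !inE mem_cat. Qed.

(** Each edge of a path keeps the row or the column of its predecessor, so [nvertU1] applies at
    every step. The slack [k] is 1 for a general connected graph and 0 once a cycle is present. *)
Lemma path_nvert k x s F : path adj x s -> x.1 \in F ->
  (nvert F <= #|F| + k -> nvert (F :|: eset (unzip1 s)) <= #|F :|: eset (unzip1 s)| + k)%N.
Proof.
elim: s x F => [|y s IH] x F /=.
  by move=> _ _; rewrite (_ : eset _ = set0) ?setU0 //; apply/setP=> z; rewrite !inE.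
move=> /andP[/andP[_ xy] ps] xF le; rewrite eset_cons setUCA setUA.
apply: (IH y) => //; first by rewrite setU11.
have := @nvertU1 y.1 F; move: xy; case: ifP => _ /eqP <-.
  by rewrite (in_rows xF) => /(_ isT) h; lia.
by rewrite (in_cols xF) orbT => /(_ isT) h; lia.
Qed.

Definition closed_walk (w : seq E) := exists2 d, cycle adj d & unzip1 d = w.

Lemma closed_walk_rot e w : closed_walk w -> e \in w ->
  exists b s, cycle adj ((e, b) :: s) /\ perm_eq (e :: unzip1 s) w.
Proof.
case=> d cd <- /mapP[[e' b] xd /= ->]; have [i s rs] := rot_to xd.
exists b, s; split; first by have := rot_cycle i adj d; rewrite rs cd.
have /permPl : perm_eql (rot i (unzip1 d)) (unzip1 d) by apply/permPl; rewrite perm_rot.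
by rewrite -map_rot rs.
Qed.

Lemma eset_perm w w' : perm_eq w w' -> eset w = eset w'.
Proof. by move/perm_mem => ww; apply/setP => z; rewrite !inE ww. Qed.

Lemma cycle_path_head x s : cycle adj (x :: s) -> path adj x s.
Proof. by rewrite /= rcons_path => /andP[]. Qed.

Lemma nvert_walk w : closed_walk w -> (nvert (eset w) <= #|eset w| + 1)%N.
Proof.
case: w => [_|e w cw].
  by rewrite (_ : eset _ = set0) /nvert /rows /cols ?imset0 ?cards0 //; apply/setP=> z; rewrite !inE.
have [|b [s [cs ps]]] := @closed_walk_rot e _ cw; first by rewrite mem_head.
have pp := cycle_path_head cs.
have := @path_nvert 1 _ _ [set e] pp; rewrite inE eqxx => /(_ isT).
rewrite /nvert rows1 cols1 !cards1 => /(_ isT).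
by rewrite -(eset_perm ps) eset_cons.
Qed.

(** The second walk is explored on top of the graph of the first, after rotating it to begin at the
    common edge. *)
Lemma nvert_share w1 w2 e : closed_walk w1 -> closed_walk w2 -> e \in w1 -> e \in w2 ->
  (nvert (eset (w1 ++ w2)) <= #|eset (w1 ++ w2)| + 1)%N.
Proof.
move=> c1 c2 e1 e2.
have [b [s [cs ps]]] := closed_walk_rot c1 e1.
have [b' [s' [cs' ps']]] := closed_walk_rot c2 e2.
have := @path_nvert 1 _ _ [set e] (cycle_path_head cs); rewrite inE eqxx => /(_ isT).
rewrite /nvert rows1 cols1 !cards1 => /(_ isT) le.
have := @path_nvert 1 _ _ ([set e] :|: eset (unzip1 s)) (cycle_path_head cs').
rewrite setU11 => /(_ isT le).
rewrite eset_cat -(eset_perm ps) -(eset_perm ps') !eset_cons.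
by rewrite [_ :|: (_ |: eset (unzip1 s'))]setUCA !setUA setUid.
Qed.

(* An edge crossed once by a closed walk lies on a cycle, hence is not needed for
   connectedness. *)
Lemma nvert_share_once w1 w2 e : closed_walk w1 -> closed_walk w2 ->
  count_mem e w1 = 1 -> e \in w2 ->
  (nvert (eset (w1 ++ w2)) <= #|eset (w1 ++ w2)|)%N.
Proof.
move=> c1 c2 e1 e2.
have ew1 : e \in w1 by rewrite -has_pred1 has_count e1.
have [b [s [cs ps]]] := closed_walk_rot c1 ew1.
have [b' [s' [cs' ps']]] := closed_walk_rot c2 e2.
have es : e \notin unzip1 s.
  apply/count_memPn; move: e1; rewrite -(permP ps) /= eqxx; lia.
case: s cs ps es => [|y s] cs ps es.
  by move: cs; rewrite /= /adj /=; case: (b).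
move: cs; rewrite /= rcons_path => /and3P[/andP[/eqP yb ye] py /andP[/eqP bl le]].
move: ye le => /= ye le.
have := @path_nvert 1 _ _ [set y.1] py; rewrite inE eqxx => /(_ isT).
rewrite {1}/nvert rows1 cols1 !cards1 -eset_cons => /(_ isT) leF.
set F := eset _ in leF.
have lF : (last y s).1 \in F.
  by rewrite inE; exact: (map_f fst (mem_last y s)).
have yF : y.1 \in F by rewrite inE mem_head.
have [rF cF] : r e \in rows F /\ c e \in cols F.
  move: ye le; rewrite /= in bl; rewrite bl.
  case: ((last y s).2) => /= /eqP h1 /eqP h2.
    by split; [rewrite -h2; exact: in_rows | rewrite h1; exact: in_cols].
  by split; [rewrite h1; exact: in_rows | rewrite -h2; exact: in_cols].
have eF : e \notin F by rewrite inE.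
(* Both ends of [e] were reached without crossing [e]; adding it brings an edge but no vertex, which
   lowers the slack from 1 to 0. *)
have := @path_nvert 0 _ _ (e |: F) (cycle_path_head cs').
rewrite setU11 => /(_ isT).
rewrite nvertU1_in // cardsU1 eF addn0 addnC => /(_ leF); rewrite addn0.
rewrite eset_cat -(eset_perm ps) -(eset_perm ps') !eset_cons -/F.
rewrite -/(unzip1 s) -eset_cons -[y.1 :: unzip1 s]/([seq i.1 | i <- y :: s]) -/F.
by rewrite [_ :|: (_ |: eset (unzip1 s'))]setUCA !setUA setUid.
Qed.

Lemma sum_count_mem (w : seq E) : (\sum_e count_mem e w = size w)%N.
Proof.
elim: w => [|a w IH]; first by rewrite big1.
under eq_bigr do rewrite /=.
rewrite big_split /= IH (bigD1 a) //= eqxx big1 // => e.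
by rewrite eq_sym => /negbTE->.
Qed.

Lemma sum_count_eset (w : seq E) : (\sum_(e in eset w) count_mem e w = size w)%N.
Proof.
rewrite -sum_count_mem [RHS](bigID (mem (eset w))) /= [X in (_ + X)%N]big1 ?addn0 //.
by move=> e; rewrite inE => /count_memPn.
Qed.

End Grid.

(** * Word moments and their universality *)

Section Moments.
Local Open Scope ring_scope.
Variables (E : finType) (R : comNzRingType).
Implicit Types (nu : nat -> R) (w : seq E).

(** By independence this is the expectation of the product of the entries along [w], when [nu k] is
    the [k]-th moment of one entry. *)
Definition wmom nu w : R := \prod_(e : E) nu (count_mem e w).
Definition wcov nu w1 w2 : R := wmom nu (w1 ++ w2) - wmom nu w1 * wmom nu w2.
(** Moments of a symmetric random sign (Rademacher variable). *)
Definition rad (k : nat) : R := (~~ odd k)%:R.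
Definition allpairs2 w := [forall e, (count_mem e w == 0%N) || (count_mem e w == 2%N)].
Definition shared w1 w2 := #|[set e | (e \in w1) && (e \in w2)]|.
Definition common2 w1 w2 : nat :=
  if allpairs2 w1 && allpairs2 w2 then shared w1 w2 else 0.

Lemma wmom0 nu w e : nu 1%N = 0 -> count_mem e w = 1%N -> wmom nu w = 0.
Proof. by move=> nu1 ew; rewrite /wmom (bigD1 e) //= ew nu1 mul0r. Qed.

Lemma wmom_all2 nu w : nu 0%N = 1 -> nu 2 = 1 -> allpairs2 w -> wmom nu w = 1.
Proof.
move=> nu0 nu2 /forallP h; rewrite /wmom big1 // => e _.
by have /orP[/eqP->|/eqP->] := h e.
Qed.

Lemma wcov_disjoint nu w1 w2 : nu 0%N = 1 ->
  (forall e, ~~ ((e \in w1) && (e \in w2))) -> wcov nu w1 w2 = 0.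
Proof.
move=> nu0 h; rewrite /wcov /wmom -big_split /=; apply/eqP; rewrite subr_eq0; apply/eqP.
apply: eq_bigr => e _; rewrite count_cat; have := h e; rewrite negb_and.
by case/orP => /count_memPn->; rewrite nu0 ?addn0 ?mulr1 ?mul1r.
Qed.

End Moments.

Section Universality.
Local Open Scope ring_scope.
Variables (E I J : finType) (r : E -> I) (c : E -> J) (R : comNzRingType).

(** Edges outside [A] use at least two letters each; what remains of the [l.*2] letters bounds the
    multiplicities in [A]. Applied to one or two edges, this fixes multiplicities when [#|eset w|]
    is close to [l]. *)
Lemma count_excess (w : seq E) l : size w = l.*2 ->
    (forall e, e \in w -> 2 <= count_mem e w)%N ->
  (#|eset w| <= l)%N /\
  forall (A : {set E}), A \subset eset w ->
    (\sum_(e in A) count_mem e w + (#|eset w| - #|A|).*2 <= l.*2)%N.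
Proof.
move=> sw h.
have key (A : {set E}) : A \subset eset w ->
    (\sum_(e in A) count_mem e w + (#|eset w| - #|A|).*2 <= l.*2)%N.
  move=> sA; rewrite -sw -sum_count_eset [leqRHS](big_setID A) /= (setIidPr sA) leq_add2l.
  have -> : (#|eset w| - #|A|)%N = #|eset w :\: A| by rewrite cardsDS.
  rewrite -muln2 -sum_nat_const; apply: leq_sum => e; rewrite !inE => /andP[_ ew].
  exact: h.
by split => //; have := key set0 (sub0set _); rewrite big_set0 cards0; lia.
Qed.

Lemma wcov_universal (nu : nat -> R) w1 w2 l :
    nu 0%N = 1 -> nu 1%N = 0 -> nu 2 = 1 ->
    closed_walk r c w1 -> closed_walk r c w2 -> size (w1 ++ w2) = l.*2 ->
    (l <= nvert r c (eset (w1 ++ w2)))%N ->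
  wcov nu w1 w2 = wcov (rad R) w1 w2 + (nu 4 - 1) * (common2 w1 w2)%:R.
Proof.
move=> nu0 nu1 nu2 c1 c2 sw lV.
have [r0 r1 r2] : [/\ rad R 0 = 1, rad R 1 = 0 & rad R 2 = 1] by [].
have [/existsP[e0 /andP[e01 e02]]|noe] := boolP [exists e, (e \in w1) && (e \in w2)]; last first.
  have h e : ~~ ((e \in w1) && (e \in w2)) by move: e; apply/forallP; rewrite -negb_exists.
  rewrite !wcov_disjoint // /common2 /shared (_ : [set e | _] = set0).
    by rewrite cards0 if_same mulr0 addr0.
  by apply/setP => e; rewrite !inE; apply/negbTE.
have [/existsP[e /eqP]|ge2] := boolP [exists e, count_mem e (w1 ++ w2) == 1%N].
  move=> ce; have /orP ce12 : (count_mem e w1 == 1%N) || (count_mem e w2 == 1%N).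
    by move: ce; rewrite count_cat; lia.
  have wc0 nu' : nu' 1%N = 0 -> wcov nu' w1 w2 = 0.
    move=> nu1'; rewrite /wcov (wmom0 nu1' ce) sub0r.
    by case: ce12 => /eqP ce'; rewrite (wmom0 nu1' ce') ?mulr0 ?mul0r oppr0.
  rewrite !wc0 // /common2 ifN ?mulr0 ?addr0 // negb_and.
  by case: ce12 => /eqP ce'; apply/orP; [left|right]; apply/forallPn; exists e; rewrite ce'.
have {}ge2 e : e \in w1 ++ w2 -> (2 <= count_mem e (w1 ++ w2))%N.
  rewrite -has_pred1 has_count => h; move/existsPn: ge2 => /(_ e); lia.
have [leF exc] := count_excess sw ge2.
have le1 := nvert_share c1 c2 e01 e02.
have e0w : e0 \in w1 ++ w2 by rewrite mem_cat e01.
(* If [E = l], all letters are used up: every edge has total multiplicity 2, so [e0] is crossed once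
   by each walk. The separate moments vanish and the joint one is 1, whatever [nu]. *)
have [eqF|neF] := eqVneq #|eset (w1 ++ w2)| l.
  have cnt2 e : e \in w1 ++ w2 -> count_mem e (w1 ++ w2) = 2%N.
    move=> ew; have := exc [set e]; rewrite sub1set inE ew big_set1 cards1 eqF => /(_ isT).
    have := ge2 _ ew; have : (0 < l)%N by rewrite -eqF card_gt0; apply/set0Pn; exists e; rewrite inE.
    lia.
  have a2 : allpairs2 (w1 ++ w2).
    apply/forallP => e; have [/cnt2->//|/count_memPn->//] := boolP (e \in w1 ++ w2).
  have ce1 : count_mem e0 w1 = 1%N.
    have := cnt2 _ e0w; rewrite count_cat.
    by move: e01 e02; rewrite -!has_pred1 !has_count; lia.
  rewrite /wcov !(wmom_all2 _ _ a2) // !(wmom0 _ ce1) // /common2 ifN ?mul0r ?mulr0 ?addr0 //.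
  by rewrite negb_and; apply/orP; left; apply/forallPn; exists e0; rewrite ce1.
(* Now [V = E + 1]: the union is a tree, and [nvert_share_once] forbids a common edge that either
   walk crosses once. *)
have Fl : #|eset (w1 ++ w2)|.+1 = l by lia.
have ne1 e : e \in w1 -> e \in w2 -> count_mem e w1 <> 1%N.
  by move=> h1 h2 h3; have := nvert_share_once c1 c2 h3 h2; lia.
have ne2 e : e \in w1 -> e \in w2 -> count_mem e w2 <> 1%N.
  move=> h1 h2 h3; have := nvert_share_once c2 c1 h3 h1.
  by rewrite !eset_cat setUC -eset_cat; lia.
have pos w (e : E) : e \in w -> (0 < count_mem e w)%N by rewrite -has_pred1 has_count.
have [c01 c02] : count_mem e0 w1 = 2%N /\ count_mem e0 w2 = 2%N.
  have := exc [set e0]; rewrite sub1set inE e0w big_set1 cards1 count_cat => /(_ isT).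
  have : (0 < #|eset (w1 ++ w2)|)%N by rewrite card_gt0; apply/set0Pn; exists e0; rewrite inE.
  have := ne1 _ e01 e02; have := ne2 _ e01 e02; have := pos _ _ e01; have := pos _ _ e02.
  lia.
(* The two letters in excess are both spent on [e0], so any other edge has total multiplicity 2 and
   cannot be common. *)
have other e : e != e0 -> e \in w1 ++ w2 -> count_mem e (w1 ++ w2) = 2%N.
  move=> ee0 ew; have := exc [set e; e0].
  rewrite subUset !sub1set !inE ew e0w => /(_ isT).
  rewrite big_setU1 ?inE //= big_set1 cards2 ee0 [X in (_ + X + _)%N]count_cat c01 c02 /=.
  have : (1 < #|eset (w1 ++ w2)|)%N.
    have : [set e; e0] \subset eset (w1 ++ w2) by rewrite subUset !sub1set !inE ew e0w.
    by move/subset_leq_card; rewrite cards2 ee0.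
  have := ge2 _ ew; move: Fl; move: (count_mem e _) #|_|; lia.
have disj e : e != e0 -> ~~ ((e \in w1) && (e \in w2)).
  move=> ee0; apply/negP => /andP[h1 h2]; have := other _ ee0.
  rewrite mem_cat h1 count_cat => /(_ isT).
  by have := ne1 _ h1 h2; have := pos _ _ h1; have := pos _ _ h2; lia.
have cnt12 e : e != e0 -> ((count_mem e w1 == 0%N) || (count_mem e w1 == 2%N)) &&
    ((count_mem e w2 == 0%N) || (count_mem e w2 == 2%N)).
  move=> ee0; have [ew|] := boolP (e \in w1 ++ w2).
    have := other _ ee0 ew; rewrite count_cat; have := disj _ ee0; rewrite negb_and.
    by case/orP => /count_memPn->; rewrite ?add0n ?addn0 => ->.
  by rewrite mem_cat negb_or => /andP[/count_memPn-> /count_memPn->].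
have a1 : allpairs2 w1.
  by apply/forallP => e; have [->|/cnt12/andP[]//] := eqVneq e e0; rewrite c01.
have a2 : allpairs2 w2.
  by apply/forallP => e; have [->|/cnt12/andP[]//] := eqVneq e e0; rewrite c02.
have wm nu' : nu' 0%N = 1 -> nu' 2 = 1 -> wmom nu' (w1 ++ w2) = nu' 4.
  move=> nu0' nu2'; rewrite /wmom (bigD1 e0) //= count_cat c01 c02 big1 ?mulr1 // => e ee0.
  by have [/(other _ ee0)->//|/count_memPn->//] := boolP (e \in w1 ++ w2).
rewrite /wcov !wm // !wmom_all2 // /common2 a1 a2 /= (_ : shared _ _ = 1%N).
  by rewrite /rad /= !mulr1 subrr add0r.
rewrite /shared (_ : [set e | _] = [set e0]) ?cards1 //; apply/setP => e; rewrite !inE.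
by have [->|/disj/negbTE->//] := eqVneq e e0; rewrite e01 e02.
Qed.

(** From [l < V <= E + 1] and [E <= l] one gets [E = l], so an even word has no room for a
    multiplicity above 2. *)
Lemma rad_all2 (w : seq E) l : closed_walk r c w -> size w = l.*2 ->
  (l < nvert r c (eset w))%N -> wmom (rad R) w = (allpairs2 w)%:R.
Proof.
move=> cw sw lV.
have [/existsP[e oe]|/existsPn ev] := boolP [exists e, odd (count_mem e w)].
  rewrite /wmom (bigD1 e) //= /rad oe mul0r /allpairs2.
  case: forallP => //= /(_ e) /orP[] /eqP h; by rewrite h in oe.
have ge2 e : e \in w -> (2 <= count_mem e w)%N.
  rewrite -has_pred1 has_count; have := ev e; lia.
have [leF exc] := count_excess sw ge2.
have := nvert_walk cw => le1; have Fl : #|eset w| = l by lia.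
have a2 : allpairs2 w.
  apply/forallP => e; have [ew|/count_memPn->//] := boolP (e \in w).
  have := exc [set e]; rewrite sub1set inE ew big_set1 cards1 Fl => /(_ isT).
  have := ge2 _ ew; have : (0 < l)%N by rewrite -Fl card_gt0; apply/set0Pn; exists e; rewrite inE.
  lia.
by rewrite a2 wmom_all2.
Qed.

End Universality.

(** * Counting maps by the number of rows and columns they visit *)

Section CountMaps.
Variables (E I J : finType) (r : E -> I) (c : E -> J) (mk : I -> J -> E).
Hypothesis mkK : forall e, mk (r e) (c e) = e.
Variable D : finType.

Definition nimg (h : D -> E) := (#|[set r (h d) | d : D]| + #|[set c (h d) | d : D]|)%N.

Lemma leq_card_bigcup (T K : finType) (P : pred K) (F : K -> {set T}) :
  #|\bigcup_(i | P i) F i| <= \sum_(i | P i) #|F i|.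
Proof.
elim/big_rec2: _ => [|i m A _ le]; first by rewrite cards0.
by rewrite (leq_trans (leq_card_setU _ _)) // leq_add2l.
Qed.

(** A map is recovered from numberings of the rows and columns it visits, together with the two
    numbers used at each point of [D]. *)
Let glue b b' (x : {ffun 'I_b -> I} * {ffun 'I_b' -> J} * {ffun D -> 'I_b * 'I_b'}) :
  {ffun D -> E} := [ffun d => mk (x.1.1 (x.2 d).1) (x.1.2 (x.2 d).2)].

Lemma glue_surj (h : {ffun D -> E}) : (0 < #|D|) ->
  h \in @glue #|[set r (h d) | d : D]| #|[set c (h d) | d : D]| @: setT.
Proof.
case/card_gt0P => d0 _.
have r0 d : r (h d) \in [set r (h d) | d : D] by apply/imsetP; exists d.
have c0 d : c (h d) \in [set c (h d) | d : D] by apply/imsetP; exists d.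
apply/imsetP; exists ([ffun i => enum_val i], [ffun i => enum_val i],
  [ffun d => (enum_rank_in (r0 d0) (r (h d)), enum_rank_in (c0 d0) (c (h d)))]) => //.
by apply/ffunP => d; rewrite !ffunE /= !enum_rankK_in // mkK.
Qed.

Lemma card_nimg_le K : 0 < #|D| ->
  #|[set h : {ffun D -> E} | nimg h <= K]| <=
  \sum_(b : 'I_#|D|.+1 * 'I_#|D|.+1 | [&& 0 < b.1, 0 < b.2 & b.1 + b.2 <= K])
     (#|I| ^ b.1 * #|J| ^ b.2 * (b.1 * b.2) ^ #|D|).
Proof.
move=> D0; have /card_gt0P[d0 _] := D0.
have cardg b b' : #|@glue b b' @: setT| <= #|I| ^ b * #|J| ^ b' * (b * b') ^ #|D|.
  apply: leq_trans (leq_imset_card _ _) _.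
  by rewrite cardsT !card_prod !card_ffun !card_ord card_prod !card_ord.
apply: (@leq_trans #|\bigcup_(b : 'I_#|D|.+1 * 'I_#|D|.+1 | [&& 0 < b.1, 0 < b.2 & b.1 + b.2 <= K])
   (@glue b.1 b.2 @: setT)|); last first.
  apply: leq_trans (leq_card_bigcup _ _) _; apply: leq_sum => b _; exact: cardg.
apply: subset_leq_card; apply/subsetP => h; rewrite inE /nimg => hK.
have lr : #|[set r (h d) | d : D]| < #|D|.+1 by rewrite ltnS leq_imset_card.
have lc : #|[set c (h d) | d : D]| < #|D|.+1 by rewrite ltnS leq_imset_card.
apply/bigcupP; exists (Ordinal lr, Ordinal lc); last exact: glue_surj.
rewrite /= hK andbT !card_gt0; apply/andP; split; apply/set0Pn.
  by exists (r (h d0)); apply/imsetP; exists d0.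
by exists (c (h d0)); apply/imsetP; exists d0.
Qed.

(** Choices of the two vertex numbers, times a bound for the labellings of [D]. It depends on [D]
    only, hence not on [p] or [n]. *)
Definition cmaps := (#|D|.+1 * #|D|.+1 * (#|D| * #|D|) ^ #|D|)%N.

(** As [D] is non-empty, at least one row occurs: it is counted by [#|I|], and the remaining
    vertices, at most [K], by [#|J|]. The single factor [#|I|] becomes the [p] of the final
    error. *)
Lemma card_nimg K : 0 < #|D| -> 0 < #|I| <= #|J| ->
  #|[set h : {ffun D -> E} | nimg h <= K.+1]| <= cmaps * (#|I| * #|J| ^ K).
Proof.
move=> D0 /andP[I0 IJ]; apply: leq_trans (card_nimg_le _ D0) _.
have -> : (cmaps = #|{: 'I_#|D|.+1 * 'I_#|D|.+1}| * (#|D| * #|D|) ^ #|D|)%N.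
  by rewrite card_prod !card_ord.
rewrite -mulnA -sum_nat_const.
rewrite [leqRHS](bigID (fun b : 'I_#|D|.+1 * 'I_#|D|.+1 => [&& 0 < b.1, 0 < b.2 & b.1 + b.2 <= K.+1])) /=.
rewrite -[leqLHS]addn0 leq_add //; apply: leq_sum => -[[b hb] [b' hb']] /= /and3P[b0 b0' le].
rewrite mulnC leq_mul //; first by rewrite leq_exp2r // leq_mul.
case: b b0 le {hb} => // b _ le; rewrite expnS -mulnA leq_mul //.
apply: leq_trans (_ : #|J| ^ (b + b') <= _); last by rewrite leq_pexp2l //; lia.
by rewrite expnD leq_mul //; case: (b) => [|k]; rewrite ?expn0 ?leq_exp2r.
Qed.

End CountMaps.

(** * Closed walks as words in the matrix entries *)

Definition nxt m (t : 'I_m.+1) : 'I_m.+1 := inZp t.+1.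

Lemma nxt_inZp m s : nxt (inZp s : 'I_m.+1) = inZp s.+1.
Proof. by apply: val_inj; rewrite /= -addn1 modnDml addn1. Qed.

Lemma nxtE m (t : 'I_m.+1) : (nxt t = t + Zp1)%R.
Proof. by apply: val_inj; rewrite /= modnDmr addn1. Qed.

Section Walks.
Variables (E I J : finType) (r : E -> I) (c : E -> J) (mk : I -> J -> E).
Hypotheses (rK : forall i j, r (mk i j) = i) (cK : forall i j, c (mk i j) = j).
Hypothesis mkK : forall e, mk (r e) (c e) = e.

Section OneWalk.
Variable m : nat.
Implicit Types f : 'I_m.+1 -> E.

(* Only the forward edges of a closed walk are recorded: [f t] joins row [r (f t)] to
   column [c (f t)], and [ret f t] joins that column to the row of [f (nxt t)]. *)
Definition ret f t := mk (r (f (nxt t))) (c (f t)).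

(** Even times carry forward edges, odd times return edges. Indices go through [inZp], so [wd f] is
    periodic on [nat] with period [m.+1.*2], which closes the cycle. *)
Definition wd f (s : nat) : E * bool :=
  if odd s then (ret f (inZp s./2), true) else (f (inZp s./2), false).

Definition ew f : seq E := unzip1 (mkseq (wd f) m.+1.*2).

Lemma size_ew f : size (ew f) = m.+1.*2.
Proof. by rewrite size_map size_mkseq. Qed.

Lemma adj_wd f s : adj r c (wd f s) (wd f s.+1).
Proof.
rewrite /wd /adj /= uphalf_half /ret; case: (odd s) => /=.
  by rewrite rK add1n nxt_inZp.
by rewrite cK add0n eqxx.
Qed.

Lemma path_map_iota (T : Type) (e : rel T) (g : nat -> T) : (forall s, e (g s) (g s.+1)) ->
  forall k a, path e (g a) [seq g s | s <- iota a.+1 k].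
Proof. by move=> h; elim=> [|k IH] a //=; rewrite h IH. Qed.

Lemma closed_ew f : closed_walk r c (ew f).
Proof.
exists (mkseq (wd f) m.+1.*2) => //; rewrite /mkseq doubleS /=.
have {2}-> : wd f 0 = wd f m.+1.*2.
  by rewrite /wd /= odd_double doubleK; congr (f _, _); apply: val_inj; rewrite /= modnn mod0n.
rewrite doubleS -map_rcons adj_wd /=.
have -> : rcons (iota 2 m.*2) m.*2.+2 = iota 2 m.*2.+1 by rewrite -cats1; have := iotaD 2 m.*2 1; rewrite addn1 => ->.
by apply: path_map_iota => s; exact: adj_wd.
Qed.

Lemma big_pairs (R : Type) (idx : R) (op : Monoid.law idx) (G : nat -> R) k :
  \big[op/idx]_(s <- iota 0 k.*2) G s = \big[op/idx]_(t < k) op (G t.*2) (G t.*2.+1).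
Proof.
elim: k => [|k IH]; first by rewrite big_nil big_ord0.
rewrite big_ord_recr -IH; have -> : k.+1.*2 = (k.*2 + 2)%N by rewrite addn2.
rewrite iotaD add0n big_cat /=; by rewrite !big_cons big_nil Monoid.mulm1.
Qed.

Lemma big_ew (R : Type) (idx : R) (op : Monoid.law idx) f (X : E -> R) :
  \big[op/idx]_(e <- ew f) X e = \big[op/idx]_(t < m.+1) op (X (f t)) (X (ret f t)).
Proof.
rewrite /ew /unzip1 /mkseq !big_map big_pairs; apply: eq_bigr => t _.
by rewrite /wd /= odd_double doubleK uphalf_double valZpK.
Qed.

Lemma mem_ew f e : (e \in ew f) = [exists t, (e == f t) || (e == ret f t)].
Proof.
have -> : (e \in ew f) = has (pred1 e) (ew f) by rewrite has_pred1.
rewrite -big_has big_ew big_orE; apply: eq_existsb => t /=; by rewrite !(eq_sym e).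
Qed.

Lemma mem_ew_f f t : f t \in ew f.
Proof. by rewrite mem_ew; apply/existsP; exists t; rewrite eqxx. Qed.
Lemma mem_ew_ret f t : ret f t \in ew f.
Proof. by rewrite mem_ew; apply/existsP; exists t; rewrite eqxx orbT. Qed.

Lemma rows_ew f : rows r (eset (ew f)) = [set r (f t) | t : 'I_m.+1].
Proof.
apply/setP => i; apply/imsetP/imsetP => [[e]|[t _ ->]]; last first.
  by exists (f t); first by rewrite inE mem_ew_f.
rewrite inE mem_ew => /existsP[t /orP[]/eqP-> ->]; first by exists t.
by exists (nxt t); rewrite // /ret rK.
Qed.

Lemma cols_ew f : cols c (eset (ew f)) = [set c (f t) | t : 'I_m.+1].
Proof.
apply/setP => i; apply/imsetP/imsetP => [[e]|[t _ ->]]; last first.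
  by exists (f t); first by rewrite inE mem_ew_f.
by rewrite inE mem_ew => /existsP[t /orP[]/eqP-> ->]; exists t; rewrite // /ret cK.
Qed.

Lemma nvert_ew f : nvert r c (eset (ew f)) = nimg r c f.
Proof. by rewrite /nvert rows_ew cols_ew. Qed.

End OneWalk.

Definition cat_walk m m' (f : 'I_m.+1 -> E) (g : 'I_m'.+1 -> E) (d : 'I_m.+1 + 'I_m'.+1) : E :=
  match d with inl t => f t | inr t => g t end.

Lemma nvert_ew_cat m m' (f : 'I_m.+1 -> E) (g : 'I_m'.+1 -> E) :
  nvert r c (eset (ew f ++ ew g)) = nimg r c (cat_walk f g).
Proof.
rewrite /nvert eset_cat rowsU colsU !rows_ew !cols_ew /nimg; congr (_ + _)%N.
  apply: eq_card => i; rewrite inE; apply/orP/imsetP => [[]/imsetP[t _ ->]|[[t|t] _ ->]].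
  - by exists (inl t).
  - by exists (inr t).
  - by left; apply/imsetP; exists t.
  - by right; apply/imsetP; exists t.
apply: eq_card => i; rewrite inE; apply/orP/imsetP => [[]/imsetP[t _ ->]|[[t|t] _ ->]].
- by exists (inl t).
- by exists (inr t).
- by left; apply/imsetP; exists t.
- by right; apply/imsetP; exists t.
Qed.

(** A pair of walks is treated as one map on the disjoint union of the index sets, so that vertices
    visited by both are counted once. *)
Lemma card_nimg_pair m m' K : (0 < #|I| <= #|J|)%N ->
  (#|[set h : {ffun 'I_m.+1 -> E} * {ffun 'I_m'.+1 -> E} |
      nvert r c (eset (ew h.1 ++ ew h.2)) <= K.+1]| <=
  cmaps ('I_m.+1 + 'I_m'.+1)%type * (#|I| * #|J| ^ K))%N.
Proof.
move=> IJ; have := @card_nimg _ _ _ r c mk mkK ('I_m.+1 + 'I_m'.+1)%type K.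
rewrite card_sum !card_ord => /(_ isT IJ); apply: leq_trans.
pose glue (h : {ffun 'I_m.+1 -> E} * {ffun 'I_m'.+1 -> E}) : {ffun 'I_m.+1 + 'I_m'.+1 -> E} :=
  [ffun d => cat_walk h.1 h.2 d].
rewrite -(card_imset _ (_ : injective glue)).
  apply/subset_leq_card/subsetP => _ /imsetP[h + ->]; rewrite !inE nvert_ew_cat.
  by congr (_ + _ <= _)%N; apply: eq_card => i; apply/imsetP/imsetP => -[d _ ->];
    exists d; rewrite // !ffunE.
move=> [f g] [f' g'] /ffunP eq; congr (_, _); apply/ffunP => t.
  by have := eq (inl t); rewrite !ffunE.
by have := eq (inr t); rewrite !ffunE.
Qed.

Lemma card_nimg_one m K : (0 < #|I| <= #|J|)%N ->
  (#|[set h : {ffun 'I_m.+1 -> E} | nvert r c (eset (ew h)) <= K.+1]| <=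
  cmaps 'I_m.+1 * (#|I| * #|J| ^ K))%N.
Proof.
move=> IJ; have := @card_nimg _ _ _ r c mk mkK 'I_m.+1 K.
rewrite card_ord => /(_ isT IJ); apply: leq_trans; apply/subset_leq_card/subsetP => h.
by rewrite !inE nvert_ew.
Qed.

End Walks.

Arguments ew : simpl never.

(** * Non-backtracking walks *)

Section Fibers.
Variables (E I : finType) (r : E -> I).
Implicit Type F : {set E}.

(** Required for rows and for columns, this says that the graph has no leaf. *)
Definition mated F := forall e, e \in F -> exists2 e', e' \in F & e' != e /\ r e' = r e.

Lemma matedU F G : mated F -> mated G -> mated (F :|: G).
Proof.
move=> hF hG e; rewrite inE => /orP[/hF|/hG] [e' e'F h]; exists e' => //; by rewrite inE e'F ?orbT.
Qed.

Lemma card_fibers F : #|F| = \sum_(i in rows r F) #|[set e in F | r e == i]|.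
Proof.
rewrite -sum1_card (partition_big r (mem (rows r F))) /=; last by move=> e eF; exact: imset_f.
by apply: eq_bigr => i _; rewrite -sum1_card; apply: eq_bigl => e; rewrite !inE.
Qed.

Lemma mated_fiber F i : mated F -> i \in rows r F -> 2 <= #|[set e in F | r e == i]|.
Proof.
move=> hF /imsetP[e eF ->]; have [e' e'F [ne re]] := hF _ eF.
apply: leq_trans (_ : #|[set e'; e]| <= _); first by rewrite cards2 ne.
by apply/subset_leq_card/subsetP => z; rewrite !inE => /orP[]/eqP->; rewrite ?e'F ?eF ?re eqxx.
Qed.

Lemma mated_card F : mated F -> #|rows r F|.*2 <= #|F|.
Proof.
move=> hF; rewrite (card_fibers F) -muln2 -sum_nat_const.
by apply: leq_sum => i; exact: mated_fiber.
Qed.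

(** In the equality case of [mated_card] every fibre has exactly two edges; a third one would break
    the count. *)
Lemma mated_unique F e e1 e2 : mated F -> #|rows r F|.*2 = #|F| ->
  e \in F -> e1 \in F -> e2 \in F -> e1 != e -> e2 != e -> r e1 = r e -> r e2 = r e -> e1 = e2.
Proof.
move=> hF eqF eF e1F e2F n1 n2 r1 r2; apply/eqP/negPn/negP => n12.
have ge3 : 3 <= #|[set e' in F | r e' == r e]|.
  apply: leq_trans (_ : #|e1 |: [set e2; e]| <= _).
    by rewrite cardsU1 cards2 n2 !inE negb_or n12 n1.
  by apply/subset_leq_card/subsetP => z; rewrite !inE => /or3P[]/eqP->;
    rewrite ?e1F ?e2F ?eF ?r1 ?r2 eqxx.
have reF : r e \in rows r F by exact: imset_f.
have := card_fibers F; rewrite (bigD1 (r e)) //=.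
suff : #|rows r F|.-1.*2 <= \sum_(i in rows r F | i != r e) #|[set e0 in F | r e0 == i]|.
  have : 0 < #|rows r F| by rewrite card_gt0; apply/set0Pn; exists (r e).
  by move: ge3 eqF; move: #|rows r F| #|_| #|_| (\sum_(i in _ | _) _) => *; lia.
have -> : #|rows r F|.-1 = #|rows r F :\ r e| by rewrite (cardsD1 (r e) (rows r F)) reF.
rewrite -muln2 -sum_nat_const [leqRHS](eq_bigl (mem (rows r F :\ r e))).
  by apply: leq_sum => i; rewrite !inE => /andP[_]; exact: mated_fiber.
by move=> i; rewrite !inE andbC.
Qed.

End Fibers.

Lemma nxt_ind m (P : 'I_m.+1 -> Prop) t0 : P t0 -> (forall t, P t -> P (nxt t)) -> forall t, P t.
Proof.
move=> P0 PS t; have Pk k : P (inZp (t0 + k)).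
  by elim: k => [|k IH]; rewrite ?addn0 ?valZpK // addnS -nxt_inZp; exact: PS.
have := Pk (t + (m.+1 - t0))%N.
have -> : (t0 + (t + (m.+1 - t0)))%N = (m.+1 + t)%N by have := ltn_ord t0; lia.
by rewrite (_ : inZp _ = t) //; apply: val_inj; rewrite /= modnDl modn_small.
Qed.

Section Nonbacktracking.
Variables (E I J : finType) (r : E -> I) (c : E -> J) (mk : I -> J -> E).
Hypotheses (rK : forall i j, r (mk i j) = i) (cK : forall i j, c (mk i j) = j).
Hypothesis mkK : forall e, mk (r e) (c e) = e.
Local Notation ret := (ret r c mk).
Local Notation ew := (ew r c mk).

(** Distinct rows separate [f t] from [ret f t], and distinct columns separate [ret f t] from
    [f (nxt t)]. Since [nxt] wraps around, the condition is cyclic, and no [f] satisfies it when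
    [m = 0]. *)
Definition nb m (f : 'I_m.+1 -> E) :=
  [forall t, (r (f t) != r (f (nxt t))) && (c (f t) != c (f (nxt t)))].

Lemma nbP m (f : 'I_m.+1 -> E) : nb f -> forall t,
  r (f t) <> r (f (nxt t)) /\ c (f t) <> c (f (nxt t)).
Proof. by move=> /forallP h t; have /andP[/eqP h1 /eqP h2] := h t. Qed.

Definition prv m (t : 'I_m.+1) : 'I_m.+1 := (t - Zp1)%R.
Lemma prvK m (t : 'I_m.+1) : nxt (prv t) = t.
Proof. by rewrite nxtE /prv subrK. Qed.

Lemma nb_mated_row m (f : 'I_m.+1 -> E) : nb f -> mated r (eset (ew f)).
Proof.
move=> /nbP h e; rewrite inE mem_ew => /existsP[t /orP[]/eqP->].
  exists (ret f (prv t)); first by rewrite inE mem_ew_ret.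
  split; last by rewrite /ret rK prvK.
  apply/eqP => /(congr1 c); rewrite /ret cK => eqc.
  by have [_] := h (prv t); rewrite prvK.
exists (f (nxt t)); first by rewrite inE mem_ew_f.
split; last by rewrite /ret rK.
by apply/eqP => /(congr1 c); rewrite /ret cK => eqc; have [_] := h t; rewrite eqc.
Qed.

Lemma nb_mated_col m (f : 'I_m.+1 -> E) : nb f -> mated c (eset (ew f)).
Proof.
move=> /nbP h e; rewrite inE mem_ew => /existsP[t /orP[]/eqP->].
  exists (ret f t); first by rewrite inE mem_ew_ret.
  split; last by rewrite /ret cK.
  by apply/eqP => /(congr1 r); rewrite /ret rK => eqr; have [] := h t; rewrite eqr.
exists (f t); first by rewrite inE mem_ew_f.
split; last by rewrite /ret cK.
by apply/eqP => /(congr1 r); rewrite /ret rK => eqr; have [] := h t; rewrite eqr.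
Qed.

(** Handshake count: degree at least two on each side gives at least twice as many edges as rows,
    and as columns. *)
Lemma nb_nvert (F : {set E}) : mated r F -> mated c F -> nvert r c F <= #|F|.
Proof.
by move=> /mated_card h1 /mated_card h2; rewrite /nvert; move: h1 h2; rewrite /cols /rows; lia.
Qed.

(** The two equalities make [F] two-regular, so an edge of [ew g] forces its unique mate at each end
    into [ew g]. Followed from the common edge, [f] never leaves [ew g]. *)
Lemma nb_closed m m' (f : 'I_m.+1 -> E) (g : 'I_m'.+1 -> E) (F : {set E}) :
    nb f -> nb g -> mated r F -> mated c F ->
    #|rows r F|.*2 = #|F| -> #|cols c F|.*2 = #|F| ->
    eset (ew f) \subset F -> eset (ew g) \subset F ->
  forall e0, e0 \in ew f -> e0 \in ew g -> {subset ew f <= ew g}.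
Proof.
move=> nf ng mr mc er ec sf sg.
have inF e : e \in ew f -> e \in F by move=> h; apply: (subsetP sf); rewrite inE.
have inG e : e \in ew g -> e \in F by move=> h; apply: (subsetP sg); rewrite inE.
have rowmate e e' : e \in ew g -> e' \in F -> e' != e -> r e' = r e -> e' \in ew g.
  move=> eg e'F ne re; have := nb_mated_row ng; move=> /(_ e); rewrite inE => /(_ eg).
  case=> e'' ; rewrite inE => e''g [ne'' re''].
  by rewrite (mated_unique mr er (inG _ eg) e'F (inG _ e''g)).
have colmate e e' : e \in ew g -> e' \in F -> e' != e -> c e' = c e -> e' \in ew g.
  move=> eg e'F ne re; have := nb_mated_col ng; move=> /(_ e); rewrite inE => /(_ eg).
  case=> e'' ; rewrite inE => e''g [ne'' re''].
  by rewrite (mated_unique mc ec (inG _ eg) e'F (inG _ e''g)).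
have step1 t : f t \in ew g -> ret f t \in ew g.
  move=> h; apply: (colmate (f t)) => //; first exact/inF/mem_ew_ret; last by rewrite /ret cK.
  by apply/eqP => /(congr1 r); rewrite /ret rK => /esym; have [] := nbP nf t.
have step2 t : ret f t \in ew g -> f (nxt t) \in ew g.
  move=> h; apply: (rowmate (ret f t)) => //; first exact/inF/mem_ew_f; last by rewrite /ret rK.
  by apply/eqP => /(congr1 c); rewrite /ret cK => /esym; have [] := nbP nf t.
move=> e0; rewrite mem_ew => /existsP[t0 h0] h0g.
have [t1 h1] : exists t1, f t1 \in ew g.
  by case/orP: h0 => /eqP h0; [exists t0|exists (nxt t0); apply: step2]; rewrite -h0.
have allf t : f t \in ew g by move: t; apply: (@nxt_ind _ (fun t => f t \in ew g) t1 h1) => t /step1/step2.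
by move=> e; rewrite mem_ew => /existsP[t /orP[]/eqP->]; [|apply: step1].
Qed.

(** Equality is forced in [V <= E <= m.+1 + m'.+1], so the union is two-regular with all total
    multiplicities 2. By [nb_closed] both walks cover it, each crossing every edge once; hence equal
    lengths and no repeated vertex. *)
Lemma nb_top m m' (f : 'I_m.+1 -> E) (g : 'I_m'.+1 -> E) : nb f -> nb g ->
    (forall e, e \in ew f ++ ew g -> 2 <= count_mem e (ew f ++ ew g)) ->
    (exists e, (e \in ew f) && (e \in ew g)) ->
    m.+1 + m'.+1 <= nvert r c (eset (ew f ++ ew g)) ->
  [/\ m = m', injective (r \o f), injective (c \o f) & ew f =i ew g].
Proof.
move=> nf ng ge2 [e0 /andP[e0f e0g]] lV.
set F := eset (ew f ++ ew g) in lV.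
have sz : size (ew f ++ ew g) = (m.+1 + m'.+1).*2 by rewrite size_cat !size_ew doubleD.
have [leF exc] := count_excess sz ge2; rewrite -/F in leF exc.
have mr : mated r F by rewrite /F eset_cat; apply: matedU; exact: nb_mated_row.
have mc : mated c F by rewrite /F eset_cat; apply: matedU; exact: nb_mated_col.
have h1 := mated_card mr; have h2 := mated_card mc.
have h3 : m.+1 + m'.+1 <= #|rows r F| + #|cols c F| by [].
have h2' : #|cols c F|.*2 <= #|F| by exact: h2.
have er : #|rows r F|.*2 = #|F| by lia.
have ec : #|cols c F|.*2 = #|F| by lia.
have eF : #|F| = m.+1 + m'.+1 by lia.
have sf : eset (ew f) \subset F by rewrite /F eset_cat subsetUl.
have sg : eset (ew g) \subset F by rewrite /F eset_cat subsetUr.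
have fg := nb_closed nf ng mr mc er ec sf sg e0f e0g.
have gf := nb_closed ng nf mr mc er ec sg sf e0g e0f.
have eqfg : ew f =i ew g by move=> e; apply/idP/idP => [/fg|/gf].
have Ff : F = eset (ew f).
  by apply/setP => e; rewrite /F eset_cat in_setU !in_set eqfg orbb.
have cnt2 e : e \in F -> count_mem e (ew f) = 1.
  move=> eF'; have := exc [set e]; rewrite sub1set eF' big_set1 cards1 eF count_cat => /(_ isT).
  have : 0 < count_mem e (ew f) by rewrite -has_count has_pred1; rewrite Ff inE in eF'.
  have : 0 < count_mem e (ew g) by rewrite -has_count has_pred1 -eqfg; rewrite Ff inE in eF'.
  lia.
have := sum_count_eset (ew f); rewrite -Ff (eq_bigr (fun => 1)) //.
rewrite sum1_card size_ew eF => mm; have em : m = m' by lia.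
have Er : #|rows r F| = m.+1 by lia.
have Ec : #|cols c F| = m.+1 by lia.
split => //.
  move: Er; rewrite Ff rows_ew //.
  rewrite -[RHS](card_ord m.+1).
  by move/eqP/imset_injP => h t t' /=; apply: h.
move: Ec; rewrite Ff cols_ew //.
rewrite -[RHS](card_ord m.+1).
by move/eqP/imset_injP => h t t' /=; apply: h.
Qed.

End Nonbacktracking.

(** * Readings of a cycle and the leading term of the sign covariance *)

Section Dihedral.
Variables (E I J : finType) (r : E -> I) (c : E -> J) (mk : I -> J -> E).
Hypotheses (rK : forall i j, r (mk i j) = i) (cK : forall i j, c (mk i j) = j).
Hypothesis mkK : forall e, mk (r e) (c e) = e.
Local Notation ret := (ret r c mk).
Local Notation ew := (ew r c mk).

Lemma count_ew m (f : 'I_m.+1 -> E) e :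
  count_mem e (ew f) = (\sum_t (f t == e) + \sum_t (ret f t == e))%N.
Proof.
rewrite -sum1_count big_mkcond (big_ew _ _ _ _ _ (fun z => if z == e then 1 else 0)%N).
by rewrite big_split /=; congr addn; apply: eq_bigr => t _; case: eqP.
Qed.

(* The [2 m.+1] ways of reading a cycle: rotations, and reflections, which swap the
   forward and the return edges. *)
Definition dih m (f : 'I_m.+1 -> E) (x : bool * 'I_m.+1) (t : 'I_m.+1) : E :=
  if x.1 then ret f (x.2 - t)%R else f (t + x.2)%R.

Lemma ret_dih m (f : 'I_m.+1 -> E) x t :
  ret (dih f x) t = if x.1 then f (x.2 - t)%R else ret f (t + x.2)%R.
Proof.
rewrite {1}/ret /dih; case: x => [[] s] /=.
  by rewrite /ret rK cK !nxtE opprD addrA subrK mkK.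
by rewrite /ret !nxtE addrAC.
Qed.

Lemma count_dih m (f : 'I_m.+1 -> E) x e : count_mem e (ew (dih f x)) = count_mem e (ew f).
Proof.
rewrite !count_ew; under [X in (_ + X)%N]eq_bigr do rewrite ret_dih; rewrite /dih.
case: x => [[] s] /=.
  have inj : injective (fun t : 'I_m.+1 => s - t)%R by move=> t t' /addrI/oppr_inj.
  by rewrite [RHS]addnC [in RHS](reindex_inj inj) [X in (_ = _ + X)%N](reindex_inj inj).
have inj : injective (fun t : 'I_m.+1 => t + s)%R by move=> t t' /addIr.
by rewrite [in RHS](reindex_inj inj) [X in (_ = _ + X)%N](reindex_inj inj).
Qed.

Lemma mem_dih m (f : 'I_m.+1 -> E) x : ew (dih f x) =i ew f.
Proof. by move=> e; rewrite -!has_pred1 !has_count count_dih. Qed.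

Definition cyc m (f : 'I_m.+1 -> E) := injectiveb (r \o f) && injectiveb (c \o f).

Lemma cycP m (f : 'I_m.+1 -> E) : reflect (injective (r \o f) /\ injective (c \o f)) (cyc f).
Proof. by apply: (iffP andP) => -[]/injectiveP h /injectiveP h'; split => //; apply/injectiveP. Qed.

Lemma cyc_dih m (f : 'I_m.+1 -> E) x : cyc f -> cyc (dih f x).
Proof.
move=> /cycP[ir ic]; apply/cycP; rewrite /dih; case: x => [[] s]; split => t t' /=.
- rewrite /ret !rK => h; have := ir (nxt (s - t)%R) (nxt (s - t')%R) h.
  by rewrite !nxtE => /addIr/addrI/oppr_inj.
- by rewrite /ret !cK => h; have := ic _ _ h; move=> /addrI/oppr_inj.
- by move=> h; have := ir _ _ h; move/addIr.
- by move=> h; have := ic _ _ h; move/addIr.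
Qed.

Lemma nxt_neq m (t : 'I_m.+2) : nxt t <> t.
Proof.
by rewrite nxtE -[RHS]addr0 => /addrI/(congr1 val); rewrite /= modn_small.
Qed.

Lemma nb_cyc m (f : 'I_m.+2 -> E) : cyc f -> nb r c f.
Proof.
move=> /cycP[ir ic]; apply/forallP => t; apply/andP; split; apply/eqP => h.
  by have := ir _ _ h; move/esym; exact: nxt_neq.
by have := ic _ _ h; move/esym; exact: nxt_neq.
Qed.

(** The edge [f ord0] is read from row to column, which fixes the direction. At each later vertex
    the cycle offers two edges, and one of them would backtrack. *)
Lemma cyc_unique m (f g : 'I_m.+1 -> E) : cyc f -> nb r c g -> ew g =i ew f -> f ord0 = g ord0 ->
  g =1 f.
Proof.
move=> /cycP[ir ic] ng gf e0.
apply: (@nxt_ind _ (fun t => g t = f t) ord0) => // t gt.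
have [nr nc] := nbP ng t.
have retE : ret g t = ret f t.
  have := mem_ew_ret r c mk g t; rewrite gf mem_ew => /existsP[u].
  have cu : ret g t = f u \/ ret g t = ret f u -> u = t.
    by case=> /(congr1 c); rewrite /ret !cK gt => /esym h; apply: ic.
  case/orP=> /eqP h; last by rewrite h cu //; right.
  have ut : u = t by apply: cu; left.
  by case: nr; move: h; rewrite ut => /(congr1 r); rewrite /ret rK gt.
have rE : r (g (nxt t)) = r (f (nxt t)).
  by move/(congr1 r): retE; rewrite /ret !rK.
have := mem_ew_f r c mk g (nxt t); rewrite gf mem_ew => /existsP[u /orP[]/eqP h].
  rewrite h; congr f; apply: ir => /=; by rewrite -h rE.
have ut : u = t.
  have : nxt u = nxt t by apply: ir => /=; move/(congr1 r): h; rewrite rE /ret rK.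
  by rewrite !nxtE => /addIr.
by case: nc; rewrite h ut /ret cK gt.
Qed.

(** A rotation and a reflection could agree only if two consecutive rows coincided, which the length
    [m.+2] excludes. *)
Lemma dih_inj m (f : 'I_m.+2 -> E) : cyc f -> injective (fun x => [ffun t => dih f x t]).
Proof.
move=> fc x y /ffunP/(_ ord0); rewrite !ffunE /dih.
have /cycP[ir ic] := fc.
have irE t t' : r (f t) = r (f t') -> t = t' by exact: ir.
have icE t t' : c (f t) = c (f t') -> t = t' by exact: ic.
case: x y => [[] s] [[] s'] /= h.
- by move/(congr1 c): h; rewrite /ret !cK => /icE; rewrite !subr0 => ->.
- have := congr1 c h; rewrite /ret cK => /icE e1.
  have := congr1 r h; rewrite /ret rK => /irE; rewrite -e1 => e2.
  by have := nxt_neq e2.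
- have := congr1 c h; rewrite /ret cK => /icE e1.
  have := congr1 r h; rewrite /ret rK => /irE; rewrite -e1 => /esym e2.
  by have := nxt_neq e2.
- by have := congr1 c h => /icE; rewrite !add0r => ->.
Qed.

Section Top.
Variable R : comNzRingType.
Local Notation wcovR := (wcov (rad R)).

Lemma wmom_rad (w : seq E) : (wmom (rad R) w = [forall e, ~~ odd (count_mem e w)]%:R)%R.
Proof.
case: (boolP [forall e, ~~ odd (count_mem e w)]) => [/forallP h|/forallPn[e]].
  by rewrite /wmom big1 // => e _; rewrite /rad h.
by rewrite negbK => oe; rewrite /wmom (bigD1 e) //= /rad oe mul0r.
Qed.

(** If some multiplicity in the joint word is odd, it is odd in one of the two words, so both terms
    of the covariance vanish. *)
Lemma wcov_rad_neq0 (w1 w2 : seq E) : wcovR w1 w2 != 0%R ->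
  (forall e, e \in w1 ++ w2 -> 2 <= count_mem e (w1 ++ w2)) /\
  (exists e, (e \in w1) && (e \in w2)).
Proof.
have [/existsP h|/existsPn h] := boolP [exists e, (e \in w1) && (e \in w2)]; last first.
  by rewrite wcov_disjoint ?eqxx.
have [h'|] := boolP [forall e, ~~ odd (count_mem e (w1 ++ w2))].
  move=> _; split => // e; rewrite -has_pred1 has_count; have := forallP h' e; lia.
case/forallPn => e; rewrite negbK => oe.
have e0 : [forall e, ~~ odd (count_mem e (w1 ++ w2))] = false.
  by apply/negbTE/forallPn; exists e; rewrite oe.
rewrite /wcov !wmom_rad e0.
case: forallP => h1; case: forallP => h2; rewrite ?mulr0 ?mul0r ?subrr ?eqxx //.
by move: oe; rewrite count_cat oddD (negbTE (h1 e)) (negbTE (h2 e)).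
Qed.

Lemma wcov_nb_neq m m' (f : 'I_m.+1 -> E) (g : 'I_m'.+1 -> E) : m <> m' -> nb r c f -> nb r c g ->
  m.+1 + m'.+1 <= nvert r c (eset (ew f ++ ew g)) -> wcovR (ew f) (ew g) = 0%R.
Proof.
move=> mm nf ng lV; apply/eqP; apply/negPn/negP => /wcov_rad_neq0[h1 h2].
by have [] := nb_top rK cK nf ng h1 h2 lV.
Qed.

Lemma nvert_cyc m m' (f : 'I_m.+1 -> E) (g : 'I_m'.+1 -> E) : cyc f -> 
  m.+1 + m.+1 <= nvert r c (eset (ew f ++ ew g)).
Proof.
move=> /cycP[ir ic]; rewrite /nvert eset_cat rowsU colsU rows_ew // cols_ew //.
apply: leq_add.
  rewrite -[leqLHS](card_ord m.+1) -(card_imset _ ir); apply: subset_leq_card; exact: subsetUl.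
rewrite -[leqLHS](card_ord m.+1) -(card_imset _ ic); apply: subset_leq_card; exact: subsetUl.
Qed.

Lemma wcov_top m (f g : {ffun 'I_m.+2 -> E}) : nb r c f -> nb r c g ->
  m.+2 + m.+2 <= nvert r c (eset (ew f ++ ew g)) ->
  wcovR (ew f) (ew g) = ((cyc f && [exists x, g == [ffun t => dih f x t]])%:R)%R.
Proof.
move=> nf ng lV; have [/andP[fc /existsP[x /eqP gx]]|] := boolP (cyc f && _).
  have cg e : count_mem e (ew g) = count_mem e (ew f).
    rewrite -(count_dih f x); congr (count _ _); rewrite gx /ew.
    congr (unzip1 _); apply: eq_map => s; rewrite /wd /ret !ffunE //.
  rewrite /wcov !wmom_rad.
  have -> : [forall e, ~~ odd (count_mem e (ew f ++ ew g))].
    by apply/forallP => e; rewrite count_cat cg addnn odd_double.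
  have -> : [forall e, ~~ odd (count_mem e (ew f))] = false.
    apply/negbTE/forallPn; exists (f ord0); rewrite negbK count_ew.
    have /cycP[ir ic] := fc.
    rewrite (bigD1 ord0) //= eqxx big1 ?big1 // => t.
      move=> _; case: eqP => // h.
      have t0 : t = ord0 by apply: ic => /=; move/(congr1 c): h; rewrite /ret cK.
      have : nxt t = ord0 by apply: ir => /=; move/(congr1 r): h; rewrite /ret rK.
      by rewrite t0 => /nxt_neq.
    by move=> tn; case: eqP => // /(congr1 r) /= /ir th; rewrite th eqxx in tn.
  by rewrite mul0r subr0.
apply: contraNeq => /wcov_rad_neq0[h1 h2].
have [_ ir ic eqfg] := nb_top rK cK nf ng h1 h2 lV.
have fc : cyc f by apply/cycP.
rewrite fc /=; apply/existsP.
have : g ord0 \in ew f by rewrite eqfg mem_ew_f.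
rewrite mem_ew => /existsP[s].
have fin x : dih f x ord0 = g ord0 -> exists x, g == [ffun t => dih f x t].
  move=> e0; exists x; apply/eqP/ffunP => t; rewrite ffunE.
  apply: (cyc_unique (cyc_dih x fc) ng) => // e.
  by rewrite mem_dih eqfg.
case/orP => /eqP h.
  by apply: (fin (false, s)); rewrite /dih /= add0r.
by apply: (fin (true, s)); rewrite /dih /= subr0.
Qed.

(** The readings of a cycle are pairwise distinct, so each cycle [f] has exactly [2 * m.+2]
    partners; these meet the vertex condition by [nvert_cyc]. *)
Lemma sum_wcov_top m :
  (\sum_(h : {ffun 'I_m.+2 -> E} * {ffun 'I_m.+2 -> E} | [&& nb r c h.1, nb r c h.2 &
      (m.+2 + m.+2 <= nvert r c (eset (ew h.1 ++ ew h.2)))%N]) wcovR (ew h.1) (ew h.2)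
  = (#|[set f : {ffun 'I_m.+2 -> E} | cyc f]| * (2 * m.+2))%:R :> R)%R.
Proof.
pose Q (h : {ffun 'I_m.+2 -> E} * {ffun 'I_m.+2 -> E}) :=
  cyc h.1 && [exists x, h.2 == [ffun t => dih h.1 x t]].
rewrite (eq_bigr (fun h => (Q h)%:R))%R; last first.
  by move=> [f g] /= /and3P[nf ng lV]; rewrite wcov_top.
rewrite -natr_sum; congr (_%:R)%R.
transitivity (\sum_(h | Q h) 1)%N.
  rewrite [RHS]big_mkcond [LHS]big_mkcond; apply: eq_bigr => -[f g] _ /=.
  rewrite /Q /=; case: (boolP (cyc f && _)) => [|_]; last by rewrite if_same.
  case/andP=> fc /existsP[x /eqP->]; rewrite nb_cyc //.
  have cd : cyc [ffun t => dih f x t].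
    have /cycP[ir ic] := cyc_dih x fc; apply/cycP; split => t t' /=; rewrite !ffunE => h.
      exact: ir. exact: ic.
  by rewrite nb_cyc //= nvert_cyc.
rewrite sum1dep_card.
pose G (y : {ffun 'I_m.+2 -> E} * (bool * 'I_m.+2)) := (y.1, [ffun t => dih y.1 y.2 t]).
have -> : [set h | Q h] = G @: (setX [set f : {ffun 'I_m.+2 -> E} | cyc f] setT).
  apply/setP => -[f g]; rewrite !inE /Q /=; apply/andP/imsetP.
    case=> fc /existsP[x /eqP->]; exists (f, x) => //; by rewrite !inE /= fc.
  by case=> -[f' x] /=; rewrite !inE /= andbT => fc [-> ->]; split => //; apply/existsP; exists x.
rewrite card_in_imset ?cardsX ?cardsT ?card_prod ?card_bool ?card_ord //.
move=> [f x] [f' x']; rewrite !inE /= !andbT => fc _ [ff'].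
by rewrite -ff' => h; congr (_, _); apply: (dih_inj fc).
Qed.

End Top.
End Dihedral.

Local Open Scope ring_scope.

(** * Averages over random signs *)

Lemma prod_count (R : comPzRingType) (E : finType) (w : seq E) (F : E -> R) :
  \prod_(e <- w) F e = \prod_e F e ^+ count_mem e w.
Proof.
elim: w => [|a w IH]; first by rewrite big_nil big1 // => e _; rewrite expr0.
rewrite big_cons IH [RHS](bigD1 a) //= eqxx exprS -mulrA; congr (_ * _).
rewrite [LHS](bigD1 a) //=; congr (_ * _); apply: eq_bigr => e /negbTE.
by rewrite eq_sym => ->.
Qed.

Section CardCyc.
Variables (E I J : finType) (r : E -> I) (c : E -> J) (mk : I -> J -> E).
Hypotheses (rK : forall i j, r (mk i j) = i) (cK : forall i j, c (mk i j) = j).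
Hypothesis mkK : forall e, mk (r e) (c e) = e.

Lemma card_cyc m : #|[set f : {ffun 'I_m.+1 -> E} | cyc r c f]| =
  (#|I| ^_ m.+1 * #|J| ^_ m.+1)%N.
Proof.
have inj_ffuns (T : finType) :
    #|[set f : {ffun 'I_m.+1 -> T} | injectiveb f]| = (#|T| ^_ m.+1)%N.
  by rewrite card_inj_ffuns card_ord.
rewrite -!inj_ffuns -cardsX.
pose G (f : {ffun 'I_m.+1 -> E}) := ([ffun t => r (f t)], [ffun t => c (f t)]).
have injG : injective G.
  move=> f f' [/ffunP h1 /ffunP h2]; apply/ffunP => t.
  by rewrite -[f t]mkK -[f' t]mkK; have := h1 t; have := h2 t; rewrite !ffunE => -> ->.
rewrite -(card_imset _ injG); apply: eq_card => -[a b]; rewrite !inE; apply/imsetP/andP.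
  case=> f; rewrite inE => /cycP[ir ic] [-> ->].
  by split; apply/injectiveP => t t'; rewrite !ffunE; [apply: ir|apply: ic].
case=> /injectiveP ia /injectiveP ib; exists [ffun t => mk (a t) (b t)].
  by rewrite inE; apply/cycP; split => t t' /=; rewrite !ffunE ?rK ?cK; [apply: ia|apply: ib].
by congr (_, _); apply/ffunP => t; rewrite !ffunE ?rK ?cK.
Qed.

End CardCyc.

Section SignAverage.
Variables (E : finType) (R : numFieldType).

Definition sgn (s : {ffun E -> bool}) (e : E) : R := (-1) ^+ s e.
(** Expectation over independent uniform signs, kept as a finite sum so that identities valid for
    each sign matrix can be averaged directly. *)
Definition avg (F : {ffun E -> bool} -> R) : R := (2 ^+ #|E|)^-1 * \sum_s F s.

Lemma sgn_sq s e : sgn s e * sgn s e = 1.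
Proof. by rewrite /sgn -expr2 sqrr_sign. Qed.

Lemma avg_word (w : seq E) : avg (fun s => \prod_(e <- w) sgn s e) = wmom (rad R) w.
Proof.
rewrite /avg (eq_bigr _ (fun s _ => prod_count w (sgn s))) /sgn.
rewrite -(bigA_distr_bigA (fun e (b : bool) => ((-1 : R) ^+ b) ^+ count_mem e w)) /=.
under eq_bigr do rewrite big_bool /= expr1 expr0 expr1n.
rewrite (_ : 2 ^+ #|E| = \prod_(e : E) (2 : R)); last by rewrite prodr_const.
rewrite -prodfV -big_split /=; apply: eq_bigr => e _.
rewrite -signr_odd /rad; case: (odd _) => /=; rewrite ?expr1 ?expr0; last by rewrite mulVf ?pnatr_eq0.
by rewrite addrC subrr mulr0.
Qed.

Lemma avg_sum (K : finType) (P : pred K) (F : K -> {ffun E -> bool} -> R) :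
  avg (fun s => \sum_(k | P k) F k s) = \sum_(k | P k) avg (F k).
Proof. by rewrite /avg exchange_big /= mulr_sumr. Qed.

Lemma eq_avg (F G : {ffun E -> bool} -> R) : F =1 G -> avg F = avg G.
Proof. by move=> FG; rewrite /avg (eq_bigr _ (fun s _ => FG s)). Qed.

Lemma avgM (a : R) F : avg (fun s => a * F s) = a * avg F.
Proof. by rewrite /avg -mulr_sumr mulrCA. Qed.

Lemma avgD F G : avg (fun s => F s + G s) = avg F + avg G.
Proof. by rewrite /avg big_split /= mulrDr. Qed.

Lemma avg_const a : avg (fun => a) = a.
Proof.
rewrite /avg sumr_const card_ffun card_bool -[a *+ _]mulr_natl natrX mulrA mulVf ?mul1r //.
by rewrite expf_neq0 // pnatr_eq0.
Qed.

End SignAverage.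

(** * Traces of matrix powers as sums over cyclic index sequences *)

Section TracePower.
Variable R : comNzRingType.

Lemma sum_tuple_cons (T : finType) m (F : m.+1.-tuple T -> R) :
  \sum_s F s = \sum_x \sum_(s : m.-tuple T) F [tuple of x :: s].
Proof.
rewrite pair_big /= (reindex (fun p : T * m.-tuple T => [tuple of p.1 :: p.2])) //=.
exists (fun s => (thead s, [tuple of behead s])) => [[x s]|s] _ /=.
  by congr (_, _); apply: val_inj.
by rewrite [RHS]tuple_eta; apply: val_inj.
Qed.

Variables (N : nat) (A : 'M[R]_N).

Fixpoint pweight (x : 'I_N) (s : seq 'I_N) (y : 'I_N) : R :=
  if s is z :: s' then A x z * pweight z s' y else A x y.

Lemma mxpow_pweight m x y : (A ^+ m.+1) x y = \sum_(s : m.-tuple 'I_N) pweight x s y.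
Proof.
elim: m x y => [|m IH] x y.
  rewrite expr1 (bigD1 [tuple]) //= big1 ?addr0 // => s /eqP[]; exact: tuple0.
rewrite exprS mxE sum_tuple_cons; apply: eq_bigr => z _ /=.
by rewrite IH mulr_sumr.
Qed.

Lemma pweightE x0 x s y : pweight x s y =
  \prod_(t < (size s).+1) A (nth x0 (x :: rcons s y) t) (nth x0 (x :: rcons s y) t.+1).
Proof.
elim: s x => [|z s IH] x /=; first by rewrite big_ord_recl big_ord0 mulr1.
by rewrite big_ord_recl /= IH.
Qed.

Lemma mxtrace_pow m : \tr (A ^+ m.+1) =
  \sum_(f : {ffun 'I_m.+1 -> 'I_N}) \prod_t A (f t) (f (nxt t)).
Proof.
rewrite /mxtrace; under eq_bigr do rewrite mxpow_pweight.
transitivity (\sum_(s : m.+1.-tuple 'I_N) pweight (thead s) (behead s) (thead s)).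
  rewrite [RHS]sum_tuple_cons. apply: eq_bigr => x _. by [].
rewrite (reindex (fun f : {ffun 'I_m.+1 -> 'I_N} => [tuple f t | t < m.+1])); last first.
  exists (fun s : m.+1.-tuple 'I_N => [ffun t => tnth s t]) => [f|s] _.
    by apply/ffunP => t; rewrite ffunE tnth_mktuple.
  by apply: eq_from_tnth => t; rewrite tnth_mktuple ffunE.
apply: eq_bigr => f _; move: (mktuple _) (tnth_mktuple f) => s sf.
rewrite (pweightE (thead s)) size_behead size_tuple /=; apply: eq_bigr => t _.
have nE k (kP : (k < m.+1)%N) : nth (thead s) s k = f (Ordinal kP).
  by rewrite -(tnth_nth _ s (Ordinal kP)) sf.
have sE : thead s :: behead s = s :> seq _ by case: (tupleP s) => ? ?.
have sE2 : thead s :: rcons (behead s) (thead s) = rcons s (thead s) by rewrite -[in RHS]sE.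
have sz : size s = m.+1 by rewrite size_tuple.
congr (A _ _).
  by rewrite sE2 nth_rcons sz ltn_ord nE; congr (f _); apply: val_inj.
rewrite -[LHS]/(nth _ (thead s :: rcons (behead s) (thead s)) t.+1) sE2 nth_rcons sz.
have [lt|ge] := ltnP t.+1 m.+1.
  by rewrite nE; congr (f _); apply: val_inj; rewrite /= modn_small.
have tm : t.+1 = m.+1 by have := ltn_ord t; lia.
rewrite tm eqxx -[thead s]/(tnth s ord0) sf; congr (f _).
by apply: val_inj; rewrite /= tm modnn.
Qed.

End TracePower.

Lemma mxtrace_pow_fin (R : comNzRingType) (T : finType) (A : T -> T -> R) m :
  \tr ((\matrix_(i < #|T|, j < #|T|) A (enum_val i) (enum_val j)) ^+ m.+1) =
  \sum_(f : {ffun 'I_m.+1 -> T}) \prod_t A (f t) (f (nxt t)).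
Proof.
rewrite mxtrace_pow.
rewrite (reindex (fun f : {ffun 'I_m.+1 -> T} => [ffun t => enum_rank (f t)])) /=; last first.
  exists (fun f : {ffun 'I_m.+1 -> 'I_#|T|} => [ffun t => enum_val (f t)]) => f _;
    apply/ffunP => t; by rewrite !ffunE ?enum_rankK ?enum_valK.
by apply: eq_bigr => f _; apply: eq_bigr => t _; rewrite mxE !ffunE !enum_rankK.
Qed.

(** * Generating coefficients of the trace *)

(* [tcoef a m] is the coefficient of [z ^ m] in [((N + z) (1 + P / z)) ^ a]; the factor [z ^ a]
   clears the denominator. *)
Section TCoef.
Variables (R : comNzRingType) (N P : R).

Definition tpoly a : {poly R} := (('X + N%:P) * ('X + P%:P)) ^+ a.
Definition tcoef a m : R := (tpoly a)`_(a + m).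

Lemma tpoly_rec a i : (tpoly a.+1)`_i.+2 =
  (tpoly a)`_i + (N + P) * (tpoly a)`_i.+1 + N * P * (tpoly a)`_i.+2.
Proof.
rewrite /tpoly exprS; set Q := _ ^+ a.
have -> : ('X + N%:P) * ('X + P%:P) * Q =
    Q * 'X * 'X + (N + P)%:P * (Q * 'X) + (N * P)%:P * Q.
  by rewrite polyCD polyCM; ring.
by rewrite !coefD !coefCM !coefMX.
Qed.

Lemma tpolyE a k : (tpoly a)`_k =
  \sum_(j < a.+1 | (j <= k)%N) ('C(a, j) * 'C(a, k - j))%:R * (P ^+ (a - j) * N ^+ (a - (k - j))).
Proof.
have XD (c : R) : ('X + c%:P) ^+ a = \sum_(i < a.+1) ((c ^+ (a - i) *+ 'C(a, i)) *: 'X^i).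
  rewrite addrC exprDn; apply: eq_bigr => i _.
  by rewrite -polyC_exp -mulrnAl -polyCMn mul_polyC.
rewrite /tpoly exprMn !XD mulr_sumr coef_sum [RHS]big_mkcond /=; apply: eq_bigr => j _.
rewrite mulr_suml coef_sum.
transitivity (\sum_(i < a.+1 | (i + j == k)%N)
     (N ^+ (a - i) *+ 'C(a, i)) * (P ^+ (a - j) *+ 'C(a, j))).
  rewrite [RHS]big_mkcond /=; apply: eq_bigr => i _.
  rewrite -scalerAl -scalerAr -exprD !coefZ coefXn eq_sym.
  by case: eqP => _; rewrite ?mulr1 ?mulr0.
case: leqP => [jk|jk]; last by rewrite big1 // => i /eqP h; lia.
have [lt|ge] := ltnP (k - j) a.+1.
  rewrite (big_pred1 (Ordinal lt)) => [|i] /=; last first.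
    apply/eqP/eqP => [h|->]; last by rewrite /=; lia.
    by apply: val_inj => /=; lia.
  by rewrite -mulr_natl -[P ^+ _ *+ _]mulr_natl natrM; ring.
rewrite (bin_small ge) muln0 mul0r big1 // => i /eqP h.
by have := ltn_ord i; lia.
Qed.

Lemma tcoefE a m : tcoef a m =
  \sum_(k < a.+1) ('C(a, k) * 'C(a, k + m))%:R * (P ^+ k * N ^+ (a - m - k)).
Proof.
rewrite /tcoef tpolyE big_mkcond (reindex_inj rev_ord_inj) /=.
apply: eq_bigr => k _; rewrite subSS.
have ka : (k <= a)%N by rewrite -ltnS.
have -> : (a - k <= a + m)%N by lia.
have -> : (a - (a - k))%N = k by lia.
rewrite bin_sub //.
have -> : (a + m - (a - k))%N = (k + m)%N by lia.
by rewrite addnC subnDA.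
Qed.

(** The expression [(N + z)(1 + P / z) = N + P + z + N P / z] is invariant under [z -> N P / z],
    which exchanges the coefficients of [z] and [1 / z] up to the factor [N * P]. *)
Lemma tpoly_sym a : (tpoly a.+1)`_a = N * P * tcoef a.+1 1.
Proof.
rewrite tcoefE tpolyE big_mkcond big_ord_recr /= ltnn addr0.
rewrite [in RHS]big_ord_recr /= addn1 (bin_small (ltnSn _)) muln0 mul0r addr0.
rewrite [LHS](reindex_inj rev_ord_inj) /= mulr_sumr; apply: eq_bigr => k _.
have ka : (k <= a)%N by rewrite -ltnS.
rewrite subSS leq_subr subKn //.
have -> : (a.+1 - (a - k) = k.+1)%N by lia.
have -> : (a.+1 - k = (a.+1 - 1 - k).+1)%N by lia.
have -> : 'C(a.+1, a - k) = 'C(a.+1, k.+1).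
  by rewrite -bin_sub; [congr binomial; lia|lia].
by rewrite addn1 !exprS mulnC; ring.
Qed.

Lemma tcoef_small a m : (a < m)%N -> tcoef a m = 0.
Proof.
by move=> am; rewrite tcoefE big1 // => k _; rewrite (@bin_small a (k + m)) ?muln0 ?mul0r //; lia.
Qed.

Lemma tcoef_recS a m : tcoef a.+1 m.+1 =
  tcoef a m + (N + P) * tcoef a m.+1 + N * P * tcoef a m.+2.
Proof. by rewrite /tcoef addSn addnS tpoly_rec !addnS. Qed.

(** The neighbours of index 0 are 1 and -1; [tpoly_sym] turns the second into the first, whence the
    factor 2. *)
Lemma tcoef_rec0 a : tcoef a.+1 0 = (N + P) * tcoef a 0 + 2 * (N * P) * tcoef a 1.
Proof.
case: a => [|a].
  rewrite !tcoefE !big_ord_recr !big_ord0 /= !subn0 subnn !bin0 bin1 !expr1 !expr0 add0n bin0n /= muln0 muln1; ring.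
rewrite {1}/tcoef addn0 tpoly_rec tpoly_sym /tcoef addn0 addn1; ring.
Qed.

End TCoef.

(** * Chebyshev-type recurrences and the matrix behind the Ihara-Bass identity *)

Section Recurrence.
Variables (R : comNzRingType) (c d : R).

(** Chebyshev polynomials of the second kind: with [S = c + z + w] and [z w = d], [umx S m] is
    [(z ^ m - w ^ m) / (z - w)]. Carrying two consecutive terms makes the recursion structural. *)
Fixpoint upair N (S : 'M[R]_N) (m : nat) : 'M[R]_N * 'M[R]_N :=
  if m is m'.+1 then
    let: (u, v) := upair S m' in (v, v *m S - c *: v - d *: u)
  else (0, 1%:M).
Definition umx N (S : 'M[R]_N) m := (upair S m).1.

Lemma umx0 N (S : 'M[R]_N) : umx S 0 = 0. Proof. by []. Qed.
Lemma umx1 N (S : 'M[R]_N) : umx S 1 = 1%:M. Proof. by []. Qed.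
Lemma umxSS N (S : 'M[R]_N) m :
  umx S m.+2 = umx S m.+1 *m S - c *: umx S m.+1 - d *: umx S m.
Proof. by rewrite /umx /=; case: (upair S m). Qed.

(** The same recursion at the scalar [S = 0], the value on the [n - p] zero eigenvalues by which
    [Z *m Z^T] and [Z^T *m Z] differ. *)
Fixpoint uscal (m : nat) : R * R :=
  if m is m'.+1 then let: (u, v) := uscal m' in (v, - c * v - d * u) else (0, 1).
Definition u0 m := (uscal m).1.
Lemma u0SS m : u0 m.+2 = - c * u0 m.+1 - d * u0 m.
Proof. by rewrite /u0 /=; case: (uscal m). Qed.

(* Chebyshev-type polynomials: with [S = c + z + d / z], the value is [z ^ m + (d / z) ^ m]. *)
Definition fmx N (S : 'M[R]_N) m : 'M[R]_N :=
  if m is m'.+1 then umx S m'.+1 *m S - c *: umx S m'.+1 - (2 * d) *: umx S m' else 2%:M.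

Lemma umx_comm N (S : 'M[R]_N) m : umx S m *m S = S *m umx S m.
Proof.
elim/ltn_ind: m => -[|[|m]] IH; rewrite ?umx0 ?umx1 ?mul0mx ?mulmx0 ?mul1mx ?mulmx1 //.
rewrite umxSS !mulmxBl !mulmxBr -!scalemxAl -!scalemxAr !IH //.
by rewrite -mulmxA IH.
Qed.

Lemma fmx_rec N (S : 'M[R]_N) m :
  fmx S m.+1 *m S = fmx S m.+2 + c *: fmx S m.+1 + d *: fmx S m.
Proof.
rewrite [fmx S m.+2]/fmx [fmx S m.+1]/fmx umxSS.
case: m => [|m].
  rewrite umx0 umx1 /fmx !scaler0 !subr0 mul1mx mulmxBl -!scalemxAl mul1mx.
  rewrite -scalemx1 !scalerBr !scalerA; apply/matrixP => i j; rewrite !mxE; ring.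
rewrite /fmx umxSS; move: (umx S m.+1) (umx S m) => A B.
rewrite !mulmxBl -!scalemxAl !scalerBr !scalerA.
move: (A *m S *m S) (A *m S) (B *m S) => AS2 AS BS.
by apply/matrixP => i j; rewrite !mxE; ring.
Qed.

(** With [S = c + z + d / z], the symmetry between [z] and [d / z] pairs the coefficients of
    [S ^ a], and each pair is a multiple of some [fmx]. The free bound [M] keeps the range fixed
    during the induction; the extra coefficients are zero. *)
Lemma mxpow_fmx N (S : 'M[R]_N) (u v : R) : c = u + v -> d = u * v -> forall a M, (a <= M)%N ->
  S ^+ a = (tcoef u v a 0)%:M + \sum_(m < M) tcoef u v a m.+1 *: fmx S m.+1.
Proof.
move=> cE dE; elim=> [|a IH] M aM.
  rewrite expr0 big1 ?addr0; last by move=> m _; rewrite tcoef_small ?scale0r.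
  by rewrite tcoefE big_ord_recr big_ord0 /= bin0 !expr0 !mulr1 add0r.
rewrite exprSr -[_ * S]/(_ *m S) (IH M (ltnW aM)) mulmxDl mul_scalar_mx mulmx_suml.
pose T m := tcoef u v a m; rewrite -[tcoef u v a 0]/(T 0%N).
have -> : \sum_(m < M) (tcoef u v a m.+1 *: fmx S m.+1) *m S =
    \sum_(m < M) T m.+1 *: fmx S m.+2 + \sum_(m < M) (c * T m.+1) *: fmx S m.+1
    + \sum_(m < M) (d * T m.+1) *: fmx S m.
  rewrite -!big_split /=; apply: eq_bigr => m _.
  by rewrite -scalemxAl fmx_rec !scalerDr !scalerA (mulrC (tcoef _ _ _ _) c) (mulrC (tcoef _ _ _ _) d).
have e1 : T 0%N *: fmx S 1 + \sum_(m < M) T m.+1 *: fmx S m.+2 = \sum_(m < M) T m *: fmx S m.+1.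
  transitivity (\sum_(m < M.+1) T m *: fmx S m.+1); first by rewrite big_ord_recl.
  by rewrite big_ord_recr /= {2}/T tcoef_small // scale0r addr0.
have e2 : \sum_(m < M) (d * T m.+1) *: fmx S m =
    (2 * d * T 1%N)%:M + \sum_(m < M) (d * T m.+2) *: fmx S m.+1.
  transitivity (\sum_(m < M.+1) (d * T m.+1) *: fmx S m).
    by rewrite big_ord_recr /= [T M.+1]tcoef_small ?mulr0 ?scale0r ?addr0 //; lia.
  rewrite big_ord_recl; congr (_ + _).
  by rewrite scale_scalar_mx; congr (_%:M); ring.
have SE : S = fmx S 1 + c%:M.
  by rewrite /fmx umx0 umx1 mul1mx scaler0 subr0 scalemx1 subrK.
rewrite e2 {1}SE scalerDr scale_scalar_mx.
have -> : tcoef u v a.+1 0 = T 0%N * c + 2 * d * T 1%N by rewrite tcoef_rec0 cE dE /T; ring.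
have -> : \sum_(m < M) tcoef u v a.+1 m.+1 *: fmx S m.+1 =
   \sum_(m < M) T m *: fmx S m.+1 + \sum_(m < M) (c * T m.+1) *: fmx S m.+1
    + \sum_(m < M) (d * T m.+2) *: fmx S m.+1.
  rewrite -!big_split /=; apply: eq_bigr => m _.
  by rewrite tcoef_recS cE dE -!scalerDl.
have sD (x y : R) : (x + y)%:M = x%:M + y%:M :> 'M[R]_N by exact: raddfD.
rewrite -e1 sD.
move: (\sum_(m < M) T m.+1 *: _) (\sum_(m < M) (c * _) *: _) (\sum_(m < M) (d * _) *: _).
move: (_ %:M) (_ %:M) (_ *: _) => A1 A2 A3 A4 A5 A6.
by apply/matrixP => i j; rewrite !mxE; ring.
Qed.

Section TwoSided.
Variables (n p : nat) (Z : 'M[R]_(n, p)).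
Local Notation H := (Z *m Z^T).
Local Notation W := (Z^T *m Z).

Lemma umx_swap m : umx H m *m Z = Z *m umx W m.
Proof.
elim/ltn_ind: m => -[|[|m]] IH; rewrite ?umx0 ?umx1 ?mul0mx ?mulmx0 ?mul1mx ?mulmx1 //.
rewrite !umxSS !mulmxBl !mulmxBr -!scalemxAl -!scalemxAr -!IH //.
by rewrite !mulmxA -(IH m.+1) // !mulmxA.
Qed.

Lemma tr_umx_mul m : \tr (umx H m *m H) = \tr (umx W m *m W).
Proof. by rewrite mulmxA umx_swap mxtrace_mulC [in LHS]mulmxA -umx_comm. Qed.

Lemma tr_umx m : \tr (umx H m) = \tr (umx W m) + (n%:R - p%:R) * u0 m.
Proof.
elim/ltn_ind: m => -[|[|m]] IH.
- by rewrite !umx0 !mxtrace0 mulr0 addr0.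
- by rewrite !umx1 !mxtrace1 mulr1 addrC subrK.
rewrite !umxSS u0SS !raddfB /= !mxtraceZ tr_umx_mul !IH //; ring.
Qed.

Variables (n' p' : R).
Hypotheses (cE : c = n' + p') (dE : d = n' * p').

(* [Mmx] has the spectrum of the non-backtracking operator up to the eigenvalue 1, and solves
   [M^2 = (Hmx - c) M - d] ([Mmx_sq]), so its powers are governed by [umx Hmx]. *)
Definition Mmx : 'M[R]_(n + p) := block_mx (H - p'%:M) (n' *: Z) (- Z^T) (- n'%:M).
Definition Hmx : 'M[R]_(n + p) := block_mx H 0 0 W.

Lemma umx_block m : umx Hmx m = block_mx (umx H m) 0 0 (umx W m).
Proof.
elim/ltn_ind: m => -[|[|m]] IH.
- by rewrite !umx0 block_mx0.
- by rewrite !umx1 -scalar_mx_block.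
rewrite !umxSS !IH // mulmx_block !scale_block_mx !opp_block_mx !add_block_mx.
by rewrite !mul0mx !mulmx0 !scaler0 !oppr0 !addr0 !add0r.
Qed.

Lemma Mmx_sq : Mmx *m Mmx = Hmx *m Mmx - c *: Mmx - d%:M.
Proof.
rewrite /Mmx /Hmx !mulmx_block scale_block_mx opp_block_mx add_block_mx.
rewrite [d%:M]scalar_mx_block opp_block_mx add_block_mx !mul0mx !addr0 !add0r.
rewrite !mulmxBl !mulmxBr !mulNmx !mulmxN !mul_scalar_mx !mul_mx_scalar !scalerN -!scalemxAl -!scalemxAr.
rewrite !opprK cE dE; congr block_mx.
- by apply/matrixP => i j; rewrite !mxE; case: (i == j); rewrite ?mulr1n ?mulr0n; ring.
- by move: (Z *m Z^T *m Z) => A; apply/matrixP => i j; rewrite !mxE; ring.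
- by rewrite !mulmxA; apply/matrixP => i j; rewrite !mxE; ring.
- by apply/matrixP => i j; rewrite !mxE; case: (i == j); rewrite ?mulr1n ?mulr0n; ring.
Qed.

Lemma Mmx_pow m : Mmx ^+ m.+1 = umx Hmx m.+1 *m Mmx - d *: umx Hmx m.
Proof.
elim: m => [|m IH]; first by rewrite expr1 umx1 mul1mx umx0 scaler0 subr0.
rewrite exprSr IH -[_ * Mmx]/(_ *m Mmx) mulmxBl -mulmxA Mmx_sq umxSS.
rewrite !mulmxBr !mulmxBl mul_mx_scalar -!scalemxAl -!scalemxAr !mulmxA.
by apply/matrixP => i j; rewrite !mxE; ring.
Qed.

(** At [S = 0] the roots of [z ^ 2 + c z + d] are [- n'] and [- p']; this combination retains the
    power of the second only. *)
Lemma u0_pow m : - p' * u0 m.+1 - d * u0 m = (- p') ^+ m.+1.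
Proof.
elim: m => [|m IH]; first by rewrite /u0 /= mulr1 mulr0 subr0 expr1.
by rewrite u0SS exprS -IH cE dE; ring.
Qed.

Lemma tr_Mmx_pow m :
  \tr (Mmx ^+ m.+1) = \tr (fmx W m.+1) + (n%:R - p%:R) * (- p') ^+ m.+1.
Proof.
rewrite Mmx_pow !umx_block mulmx_block scale_block_mx opp_block_mx add_block_mx mxtrace_block.
rewrite !mul0mx !addr0 !add0r mulmxBr mulmxN !mul_mx_scalar !raddfB /= !raddfN /= !mxtraceZ.
rewrite tr_umx_mul !tr_umx -u0_pow cE; ring.
Qed.

End TwoSided.
End Recurrence.

(** [K *m G] and [G *m K] have the same non-zero spectrum. Over a commutative ring the geometric sum
    [Q] replaces the spectral argument. *)
Lemma tr_pow_1B (R : comNzRingType) N k (K : 'M[R]_(N, k)) (G : 'M[R]_(k, N)) m :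
  \tr ((1%:M - K *m G) ^+ m) = N%:R - k%:R + \tr ((1%:M - G *m K) ^+ m).
Proof.
pose M := 1%:M - G *m K; rewrite -/M.
pose Q m := \sum_(j < m) M ^+ j.
have BE : (1%:M - K *m G) ^+ m = 1%:M - K *m Q m *m G.
  elim: m => [|m IH]; first by rewrite expr0 /Q big_ord0 mulmx0 mul0mx subr0.
  rewrite exprS IH -[_ * _]/(_ *m _) mulmxBr mulmx1 !mulmxA.
  have -> : (1%:M - K *m G) *m K = K *m M by rewrite mulmxBl mulmxBr mul1mx mulmx1 mulmxA.
  have -> : Q m.+1 = 1%:M + M *m Q m.
    rewrite /Q big_ord_recl expr0 mulmx_sumr; congr (_ + _); apply: eq_bigr => j _.
    by rewrite exprS.
  by rewrite [in RHS]mulmxDr [in RHS]mulmxDl [in RHS]mulmx1 opprD addrA !mulmxA.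
have ME : Q m *m (G *m K) = 1%:M - M ^+ m.
  elim: m {BE} => [|m IH]; first by rewrite /Q big_ord0 mul0mx expr0 subrr.
  rewrite /Q big_ord_recr /= mulmxDl -/(Q m) IH exprSr -[M ^+ m * M]/(M ^+ m *m M).
  have -> : M ^+ m *m M = M ^+ m - M ^+ m *m (G *m K) by rewrite mulmxBr mulmx1.
  by rewrite opprB addrC addrCA addrA.
rewrite BE raddfB /= mxtrace1 -mulmxA mxtrace_mulC -mulmxA ME raddfB /= mxtrace1.
by ring.
Qed.

(** * Non-backtracking expansion of the trace *)

Section NbTrace.
Variables (R : comNzRingType) (p n : nat) (X : 'M[R]_(p, n)).
Local Notation E := ('I_p * 'I_n)%type.
Local Notation ewE := (ew (@fst 'I_p 'I_n) (@snd 'I_p 'I_n) (@pair 'I_p 'I_n)).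
Local Notation nbE := (nb (@fst 'I_p 'I_n) (@snd 'I_p 'I_n)).

Definition wprod (w : seq E) : R := \prod_(e <- w) X e.1 e.2.

Definition nbsum m : R := \sum_(f : {ffun 'I_m.+1 -> E} | nbE f) wprod (ewE f).

Lemma trace_walks m :
  \tr ((X *m X^T) ^+ m.+1) = \sum_(f : {ffun 'I_m.+1 -> E}) wprod (ewE f).
Proof.
rewrite mxtrace_pow.
under eq_bigr => f _ do (under eq_bigr => t _ do rewrite mxE).
under eq_bigr => f _ do rewrite bigA_distr_bigA /=.
rewrite pair_big /= (reindex (fun f : {ffun 'I_m.+1 -> E} =>
  ([ffun t => (f t).1], [ffun t => (f t).2]))) /=; last first.
  exists (fun x : {ffun 'I_m.+1 -> 'I_p} * {ffun 'I_m.+1 -> 'I_n} => [ffun t => (x.1 t, x.2 t)]).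
    by move=> f _; apply/ffunP => t; rewrite !ffunE /=; case: (f t).
  by move=> [a b] _; congr (_, _); apply/ffunP => t; rewrite !ffunE.
apply: eq_bigr => f _; rewrite /wprod big_ew; apply: eq_bigr => t _.
by rewrite !ffunE mxE.
Qed.

Hypothesis Xsq : forall i j, X i j * X i j = 1.

(** A two-step Hashimoto matrix: from the forward edge [e] along the return edge [(f.1, e.2)] to the
    next forward edge [f], weighted by the entries of these last two. *)
Let B (e f : E) : R := ((e.1 != f.1) && (e.2 != f.2))%:R * (X f.1 e.2 * X f.1 f.2).

Lemma nbsum_trace m :
  nbsum m = \tr ((\matrix_(i < #|{: E}|, j < #|{: E}|) B (enum_val i) (enum_val j)) ^+ m.+1).
Proof.
rewrite mxtrace_pow_fin /nbsum big_mkcond; apply: eq_bigr => f _.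
rewrite big_split /=.
have -> : \prod_t (((f t).1 != (f (nxt t)).1) && ((f t).2 != (f (nxt t)).2))%:R = (nbE f)%:R :> R.
  have [/forallP h|/forallPn[t ht]] := boolP (nbE f); first by rewrite big1 // => t _; rewrite h.
  by rewrite (bigD1 t) //= (negbTE ht) mul0r.
case: (nbE f); rewrite ?mul0r ?mul1r // /wprod big_ew !big_split /= mulrC; congr (_ * _).
have inj : injective (@nxt m) by move=> t t'; rewrite !nxtE => /addIr.
by rewrite (reindex_inj inj).
Qed.

(** Edge-to-column incidence, followed by edge-to-row incidence twisted by the entries. Up to sign,
    [1 - V V^T] and [1 - U U^T] move to a different edge with the same column, respectively row;
    [Xsq] clears the diagonal of the second. *)
Let V : 'M[R]_(#|{: E}|, n) := \matrix_(i, j) ((enum_val i).2 == j)%:R.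
Let U : 'M[R]_(#|{: E}|, p) :=
  \matrix_(i, k) (((enum_val i).1 == k)%:R * X (enum_val i).1 (enum_val i).2).

Lemma sum_enum_val (F : E -> R) : \sum_(i < #|{: E}|) F (enum_val i) = \sum_i \sum_j F (i, j).
Proof.
rewrite pair_big /= (eq_bigr (fun x : E => F x)) => [|[]//].
by rewrite [RHS](reindex_onto enum_val enum_rank) /= => [|e _]; rewrite ?enum_rankK //;
  apply: eq_bigl => i; rewrite enum_valK eqxx.
Qed.

Lemma VtV : V^T *m V = (p%:R)%:M.
Proof.
apply/matrixP => j j'; rewrite !mxE.
under eq_bigr do rewrite !mxE.
rewrite (sum_enum_val (fun e => (e.2 == j)%:R * (e.2 == j')%:R)) /=.
rewrite sumr_const card_ord (bigD1 j) //= eqxx mul1r big1 ?addr0 => [|k /negbTE->]; last first.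
  by rewrite mul0r.
by case: (j == j'); rewrite ?mul0rn.
Qed.

Lemma UtU : U^T *m U = (n%:R)%:M.
Proof.
apply/matrixP => k k'; rewrite !mxE.
under eq_bigr do rewrite !mxE.
rewrite (sum_enum_val (fun e => ((e.1 == k)%:R * X e.1 e.2) * ((e.1 == k')%:R * X e.1 e.2))) /=.
rewrite (bigD1 k) //= [X in _ + X]big1 ?addr0 => [|i /negbTE ik]; last first.
  by rewrite big1 // => j _; rewrite ik !mul0r.
rewrite eqxx; under eq_bigr do rewrite mul1r mulrCA Xsq mulr1.
by rewrite sumr_const card_ord; case: (k == k'); rewrite ?mul0rn.
Qed.

Lemma VtU : V^T *m U = X^T.
Proof.
apply/matrixP => j k; rewrite !mxE.
under eq_bigr do rewrite !mxE.
rewrite (sum_enum_val (fun e => (e.2 == j)%:R * ((e.1 == k)%:R * X e.1 e.2))) /=.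
rewrite (bigD1 k) //= [X in _ + X]big1 ?addr0 => [|i /negbTE ik]; last first.
  by rewrite big1 // => j' _; rewrite ik mul0r mulr0.
rewrite (bigD1 j) //= [X in _ + X]big1 ?addr0 => [|i /negbTE ik]; last by rewrite ik mul0r.
by rewrite !eqxx !mul1r.
Qed.

Lemma BE : (\matrix_(i < #|{: E}|, j < #|{: E}|) B (enum_val i) (enum_val j)) =
  (1%:M - V *m V^T) *m (1%:M - U *m U^T).
Proof.
have VE : 1%:M - V *m V^T = \matrix_(i < #|{: E}|, j < #|{: E}|)
    (- (((enum_val i).2 == (enum_val j).2) && ((enum_val i).1 != (enum_val j).1))%:R).
  apply/matrixP => i j; rewrite !mxE.
  under eq_bigr do rewrite !mxE.
  rewrite (bigD1 (enum_val i).2) //= eqxx mul1r big1 ?addr0; last first.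
    by move=> k; rewrite eq_sym => /negbTE->; rewrite mul0r.
  rewrite -(inj_eq enum_val_inj) eq_sym.
  move: (enum_val i) (enum_val j) => [i1 i2] [j1 j2] /=.
  rewrite -pair_eqE /= (eq_sym j1) (eq_sym j2).
  by case: (i1 == j1); case: (i2 == j2); rewrite /= ?subrr ?oppr0 ?sub0r ?subr0.
have UE : 1%:M - U *m U^T = \matrix_(i < #|{: E}|, j < #|{: E}|)
    (- ((((enum_val i).1 == (enum_val j).1) && ((enum_val i).2 != (enum_val j).2))%:R *
     (X (enum_val i).1 (enum_val i).2 * X (enum_val j).1 (enum_val j).2))).
  apply/matrixP => i j; rewrite !mxE.
  under eq_bigr do rewrite !mxE.
  rewrite (bigD1 (enum_val i).1) //= eqxx mul1r big1 ?addr0; last first.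
    by move=> k; rewrite eq_sym => /negbTE->; rewrite !mul0r.
  rewrite -(inj_eq enum_val_inj) eq_sym.
  move: (enum_val i) (enum_val j) => [i1 i2] [j1 j2] /=.
  rewrite -pair_eqE /= (eq_sym j1) (eq_sym j2).
  have [->|] := eqVneq i1 j1; have [->|] := eqVneq i2 j2;
    rewrite /= ?mul0r ?mul1r ?mulr0 ?subrr ?oppr0 ?sub0r ?subr0 //.
  by rewrite Xsq subrr.
rewrite VE UE; apply/matrixP => i j; rewrite !mxE.
under eq_bigr do rewrite !mxE.
rewrite (sum_enum_val (fun e => (- (((enum_val i).2 == e.2) && ((enum_val i).1 != e.1))%:R) *
  (- (((e.1 == (enum_val j).1) && (e.2 != (enum_val j).2))%:R *
     (X e.1 e.2 * X (enum_val j).1 (enum_val j).2))))).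
move: (enum_val i) (enum_val j) => [i1 i2] [j1 j2] /=.
rewrite (bigD1 j1) //= [X in _ + X]big1 ?addr0 => [|k /negbTE kj]; last first.
  by rewrite big1 // => l _; rewrite kj /= mul0r oppr0 mulr0.
rewrite (bigD1 i2) //= [X in _ + X]big1 ?addr0 => [|k]; last first.
  by rewrite eq_sym => /negbTE->; rewrite /= oppr0 mul0r.
rewrite !eqxx /= mulrNN /B /= -mulnb natrM; ring.
Qed.

(** Ihara-Bass identity: the matrix indexed by edges is [1 - K *m G] with inner dimension [n + p],
    and [1 - G *m K] is [Mmx]. The corrections come from the eigenvalue 1 and from the [n - p]
    additional zero eigenvalues of [X^T *m X]. *)
Lemma nbsum_fmx m : nbsum m =
  \tr (fmx (n%:R - 1 + (p%:R - 1)) ((n%:R - 1) * (p%:R - 1)) (X *m X^T) m.+1)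
  + ((p * n)%:R - p%:R - n%:R) + (n%:R - p%:R) * (1 - p%:R) ^+ m.+1.
Proof.
rewrite nbsum_trace BE.
pose K : 'M[R]_(_, n + p) := row_mx V U.
(* Expanding the product leaves the cross term [V *m V^T *m U *m U^T], equal to [V *m X^T *m U^T] by
   [VtU]; it is absorbed into the upper block. *)
pose G : 'M[R]_(n + p, _) := col_mx (V^T - X^T *m U^T) U^T.
have KG : (1%:M - V *m V^T) *m (1%:M - U *m U^T) = 1%:M - K *m G.
  rewrite mul_row_col mulmxBl !mulmxBr mul1mx mulmx1 -VtU mul1mx !mulmxA.
  by apply/matrixP => i j; rewrite !mxE; ring.
have UtV : U^T *m V = X by rewrite -[LHS]trmxK trmx_mul trmxK VtU trmxK.
have MK : 1%:M - G *m K = Mmx X^T (n%:R - 1) (p%:R - 1).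
  rewrite mul_col_row !mulmxBl VtV VtU -!mulmxA UtV UtU /Mmx trmxK.
  rewrite [1%:M]scalar_mx_block opp_block_mx add_block_mx mul_mx_scalar; congr block_mx.
  - by apply/matrixP => i j; rewrite !mxE; case: (i == j); rewrite ?mulr1n ?mulr0n; ring.
  - by apply/matrixP => i j; rewrite !mxE; ring.
  - by rewrite add0r.
  - by apply/matrixP => i j; rewrite !mxE; case: (i == j); rewrite ?mulr1n ?mulr0n; ring.
rewrite KG tr_pow_1B MK (tr_Mmx_pow _ erefl erefl) trmxK opprB.
rewrite card_prod !card_ord natrD; ring.
Qed.

End NbTrace.

(** * Asymptotics of walk sums *)

Section BigO.
Variable R : realFieldType.
Implicit Types (u v F G : nat -> nat -> R).

(** Leaving out [p = 0] also makes [n] positive, as division by [n] requires. *)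
Definition bigO u F := exists2 C : R, 0 <= C &
  forall p n, (0 < p)%N -> (p <= n)%N -> `|F p n| <= C * u p n.

Lemma bigO_ext u F G : (forall p n, (0 < p)%N -> (p <= n)%N -> F p n = G p n) ->
  bigO u F -> bigO u G.
Proof. by move=> h [C C0 hC]; exists C => // p n p0 pn; rewrite -h // hC. Qed.

Lemma bigO_le u v F : (forall p n, (0 < p)%N -> (p <= n)%N -> u p n <= v p n) ->
  bigO u F -> bigO v F.
Proof.
move=> h [C C0 hC]; exists C => // p n p0 pn.
by apply: le_trans (hC _ _ p0 pn) _; rewrite ler_wpM2l // h.
Qed.

Lemma bigO_add u F G : bigO u F -> bigO u G -> bigO u (fun p n => F p n + G p n).
Proof.
move=> [C C0 hC] [D D0 hD]; exists (C + D); first by rewrite addr_ge0.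
move=> p n p0 pn; apply: le_trans (ler_normD _ _) _.
by rewrite mulrDl lerD ?hC ?hD.
Qed.

Lemma bigO_mul u v F G : bigO u F -> bigO v G ->
  bigO (fun p n => u p n * v p n) (fun p n => F p n * G p n).
Proof.
move=> [C C0 hC] [D D0 hD]; exists (C * D); first by rewrite mulr_ge0.
by move=> p n p0 pn; rewrite normrM mulrACA ler_pM ?hC ?hD.
Qed.

Lemma bigO_scale u F (a : R) : bigO u F -> bigO u (fun p n => a * F p n).
Proof.
move=> [C C0 hC]; exists (`|a| * C); first by rewrite mulr_ge0.
by move=> p n p0 pn; rewrite normrM -mulrA ler_wpM2l ?hC.
Qed.

Lemma bigO_opp u F : bigO u F -> bigO u (fun p n => - F p n).
Proof. by move=> [C C0 hC]; exists C => // p n p0 pn; rewrite normrN hC. Qed.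

Lemma bigO_sub u F G : bigO u F -> bigO u G -> bigO u (fun p n => F p n - G p n).
Proof. by move=> hF /bigO_opp; exact: bigO_add. Qed.

Lemma bigO0 u : (forall p n, 0 <= u p n) -> bigO u (fun _ _ => 0).
Proof. by move=> h; exists 0 => // p n _ _; rewrite normr0 mul0r. Qed.

Lemma bigO_sum (I : Type) (s : seq I) (P : pred I) u (F : I -> nat -> nat -> R) :
  (forall p n, 0 <= u p n) -> (forall i, P i -> bigO u (F i)) ->
  bigO u (fun p n => \sum_(i <- s | P i) F i p n).
Proof.
move=> u0 h; elim: s => [|i s IH].
  by apply: bigO_ext (bigO0 u0) => p n _ _; rewrite big_nil.
have [Pi|nPi] := boolP (P i).
  apply: bigO_ext (bigO_add (h _ Pi) IH) => p n _ _; by rewrite big_cons Pi.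
by apply: bigO_ext IH => p n _ _; rewrite big_cons (negbTE nPi).
Qed.

Definition wN k (p n : nat) : R := n%:R ^+ k.
Definition wP k (p n : nat) : R := p%:R * n%:R ^+ k.

Lemma bigO_refl u : (forall p n, 0 <= u p n) -> bigO u u.
Proof. by move=> u0; exists 1 => // p n _ _; rewrite mul1r ger0_norm. Qed.

End BigO.

Section SumBounds.
Variable R : realFieldType.

Lemma sum_le_card (T : finType) (A : {set T}) (F : T -> R) (C : R) : 
  (forall x, x \notin A -> F x = 0) -> (forall x, `|F x| <= C) ->
  `|\sum_x F x| <= C * #|A|%:R.
Proof.
move=> h0 hC; rewrite (bigID (mem A)) /= [X in _ + X]big1 ?addr0 //.
apply: le_trans (ler_norm_sum _ _ _) _.
apply: (@le_trans _ _ (\sum_(i in A) C)); first by apply: ler_sum => i _; exact: hC.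
by rewrite sumr_const mulr_natr.
Qed.

End SumBounds.

Section WalkAsymptotics.
Variable R : realFieldType.
Local Notation ewE p n := (ew (@fst 'I_p 'I_n) (@snd 'I_p 'I_n) (@pair 'I_p 'I_n)).
Local Notation nbE p n := (nb (@fst 'I_p 'I_n) (@snd 'I_p 'I_n)).
Local Notation nvE p n := (nvert (@fst 'I_p 'I_n) (@snd 'I_p 'I_n)).
Local Notation walks p n m := {ffun 'I_m.+1 -> 'I_p * 'I_n}.

Definition wcovsum (nu : nat -> R) a b p n : R :=
  \sum_(f : walks p n a) \sum_(g : walks p n b) wcov nu (ewE p n f) (ewE p n g).

Definition commonsum a b p n : nat :=
  \sum_(f : walks p n a) \sum_(g : walks p n b) common2 (ewE p n f) (ewE p n g).

Definition nbcov m m' p n : R :=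
  \sum_(f : walks p n m | nbE p n f) \sum_(g : walks p n m' | nbE p n g)
     wcov (rad R) (ewE p n f) (ewE p n g).

Definition ntree a p n : nat := #|[set f : walks p n a | allpairs2 (ewE p n f)]|.

Definition radmean m p n : R := \sum_(f : walks p n m) wmom (rad R) (ewE p n f).
Definition nbmean m p n : R := \sum_(f : walks p n m | nbE p n f) wmom (rad R) (ewE p n f).

Lemma rad_01 (E : finType) (w : seq E) : wmom (rad R) w = 0 \/ wmom (rad R) w = 1.
Proof. by rewrite wmom_rad; case: [forall _, _]; [right|left]. Qed.

Lemma norm_rad (E : finType) (w : seq E) : `|wmom (rad R) w| <= 1.
Proof. by case: (rad_01 w) => ->; rewrite ?normr0 ?normr1. Qed.

Lemma norm_wcov_rad (E : finType) (w w' : seq E) : `|wcov (rad R) w w'| <= 1.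
Proof.
rewrite /wcov; case: (rad_01 (w ++ w')) => ->; case: (rad_01 w) => ->; case: (rad_01 w') => ->;
 rewrite ?mulr0 ?mulr1 ?subr0 ?subrr ?sub0r ?normrN ?normr0 ?normr1 //.
Qed.

Lemma bigO_pair a b (F : forall p n, walks p n a -> walks p n b -> R) K C :
    (forall p n (f : walks p n a) (g : walks p n b), (K.+1 < nvE p n (eset (ewE p n f ++ ewE p n g)))%N -> F p n f g = 0) ->
    (forall p n f g, `|F p n f g| <= C) ->
  bigO (wP R K) (fun p n => \sum_f \sum_g F p n f g).
Proof.
move=> h0 hC; exists (`|C| * (cmaps ('I_a.+1 + 'I_b.+1)%type)%:R).
  by rewrite mulr_ge0.
move=> p n p0 pn; rewrite pair_big /=.
set A := [set h : walks p n a * walks p n b | (nvE p n (eset (ewE p n h.1 ++ ewE p n h.2)) <= K.+1)%N].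
apply: le_trans (sum_le_card (A := A) (C := `|C|) _ _) _.
- by move=> [f g]; rewrite inE -ltnNge => h; rewrite h0.
- by move=> h; apply: le_trans (hC _ _ _ _) _; exact: ler_norm.
rewrite -mulrA ler_wpM2l // /wP -natrX -!natrM ler_nat.
have := @card_nimg_pair _ _ _ (@fst 'I_p 'I_n) (@snd 'I_p 'I_n) (@pair 'I_p 'I_n) 
  (fun _ _ => erefl) (fun _ _ => erefl) _ a b K.
rewrite !card_ord; apply; [by case|by rewrite p0].
Qed.

Lemma bigO_one a (F : forall p n, walks p n a -> R) K C :
    (forall p n (f : walks p n a), (K.+1 < nvE p n (eset (ewE p n f)))%N -> F p n f = 0) ->
    (forall p n f, `|F p n f| <= C) ->
  bigO (wP R K) (fun p n => \sum_f F p n f).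
Proof.
move=> h0 hC; exists (`|C| * (cmaps 'I_a.+1)%:R).
  by rewrite mulr_ge0.
move=> p n p0 pn.
set A := [set h : walks p n a | (nvE p n (eset (ewE p n h)) <= K.+1)%N].
apply: le_trans (sum_le_card (A := A) (C := `|C|) _ _) _.
- by move=> f; rewrite inE -ltnNge => h; rewrite h0.
- by move=> h; apply: le_trans (hC _ _ _) _; exact: ler_norm.
rewrite -mulrA ler_wpM2l // /wP -natrX -!natrM ler_nat.
have := @card_nimg_one _ _ _ (@fst 'I_p 'I_n) (@snd 'I_p 'I_n) (@pair 'I_p 'I_n) 
  (fun _ _ => erefl) (fun _ _ => erefl) _ a K.
rewrite !card_ord; apply; [by case|by rewrite p0].
Qed.

Lemma closed_ewE p n m (f : 'I_m.+1 -> 'I_p * 'I_n) :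
  closed_walk (@fst 'I_p 'I_n) (@snd 'I_p 'I_n) (ewE p n f).
Proof. exact: closed_ew. Qed.

Lemma size_ew_cat p n a b (f : 'I_a.+1 -> 'I_p * 'I_n) (g : 'I_b.+1 -> 'I_p * 'I_n) :
  size (ewE p n f ++ ewE p n g) = (a.+1 + b.+1).*2.
Proof. by rewrite size_cat !size_ew doubleD. Qed.

(** The base dominates 1 and all moments up to order [k]; at most [k] entries occur in [w], and the
    others contribute [nu 0 = 1]. *)
Lemma norm_wmom (E : finType) (nu : nat -> R) (w : seq E) (k : nat) : nu 0%N = 1 ->
  (size w <= k)%N -> `|wmom nu w| <= (1 + \sum_(i < k.+1) `|nu i|) ^+ k.
Proof.
move=> nu0 wk; set D := 1 + _.
have D1 : 1 <= D by rewrite /D lerDl sumr_ge0.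
have nuD i : (i <= k)%N -> `|nu i| <= D.
  move=> ik; rewrite /D (bigD1 (Ordinal (ik : (i < k.+1)%N))) //= addrCA lerDl.
  by rewrite addr_ge0 // sumr_ge0.
rewrite /wmom (bigID (mem w)) /= [X in _ * X]big1 ?mulr1; last first.
  by move=> e /count_memPn->.
rewrite normr_prod; apply: (@le_trans _ _ (\prod_(e in w) D)).
  apply: ler_prod => e ew; rewrite normr_ge0 nuD //; exact: leq_trans (count_size _ _) wk.
rewrite prodr_const ler_weXn2l //.
exact: leq_trans (card_size _) wk.
Qed.

Lemma wcovsum_universal (nu : nat -> R) a b : nu 0%N = 1 -> nu 1%N = 0 -> nu 2%N = 1 ->
  bigO (wP R (a + b)) (fun p n =>
    wcovsum nu a b p n - wcovsum (rad R) a b p n - (nu 4%N - 1) * (commonsum a b p n)%:R).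
Proof.
move=> nu0 nu1 nu2.
pose D := (1 + \sum_(i < (a.+1 + b.+1).*2.+1) `|nu i|) ^+ (a.+1 + b.+1).*2.
apply: (@bigO_ext _ _ (fun p n => \sum_(f : walks p n a) \sum_(g : walks p n b)
  (wcov nu (ewE p n f) (ewE p n g) - wcov (rad R) (ewE p n f) (ewE p n g)
   - (nu 4%N - 1) * (common2 (ewE p n f) (ewE p n g))%:R))).
  move=> p n _ _; rewrite /wcovsum /commonsum natr_sum mulr_sumr -!sumrB.
  apply: eq_bigr => f _; rewrite natr_sum mulr_sumr -!sumrB; exact: eq_bigr.
apply: (@bigO_pair _ _ _ _ (D + D * D + 1 + `|nu 4%N - 1| * (a.+1 + b.+1).*2%:R)).
  move=> p n f g h; rewrite (wcov_universal nu0 nu1 nu2 (closed_ewE f) (closed_ewE g) (size_ew_cat f g)).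
    by ring.
  by move: h; rewrite addSn addnS.
move=> p n f g; apply: le_trans (ler_normB _ _) _; apply: lerD; last first.
  rewrite normrM ler_wpM2l // ger0_norm // ler_nat /common2; case: ifP => // _.
  rewrite -(size_ew_cat f g); apply: leq_trans (card_size _).
  by apply/subset_leq_card/subsetP => e; rewrite inE mem_cat => /andP[->].
apply: le_trans (ler_normB _ _) _; apply: lerD; last exact: norm_wcov_rad.
apply: le_trans (ler_normB _ _) _; apply: lerD.
  by apply: norm_wmom; rewrite ?size_ew_cat.
rewrite normrM ler_pM //; apply: norm_wmom => //; rewrite size_ew -!addnn; lia.
Qed.

Lemma ntree_radmean a : bigO (wP R a)
  (fun p n => (ntree a p n)%:R - radmean a p n).
Proof.
apply: (@bigO_ext _ _ (fun p n => \sum_(f : walks p n a)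
    ((allpairs2 (ewE p n f))%:R - wmom (rad R) (ewE p n f)))).
  move=> p n _ _; rewrite sumrB /radmean /ntree; congr (_ - _).
  rewrite -sum1_card natr_sum [RHS]big_mkcond.
  by apply: eq_bigr => f _; rewrite inE; case: allpairs2.
apply: (@bigO_one _ _ _ 2).
  by move=> p n f h; rewrite (rad_all2 _ (closed_ewE f) _ h) ?subrr ?size_ew.
move=> p n f; apply: le_trans (ler_normB _ _) _; rewrite -[2]/(1 + 1) lerD ?norm_rad //.
by case: allpairs2; rewrite ?normr0 ?normr1.
Qed.

Lemma even_gt1 k : ~~ odd k -> (0 < k)%N -> (1 < k)%N.
Proof. by case: k => [|[|k]]. Qed.

(** An even non-backtracking walk has at most [m.+1] distinct edges and no more vertices than edges,
    one vertex fewer than a tree-like walk of that length. *)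
Lemma nbmean_O m : bigO (wP R m) (nbmean m).
Proof.
apply: (@bigO_ext _ _ (fun p n => \sum_(f : walks p n m)
    (if nbE p n f then wmom (rad R) (ewE p n f) else 0))).
  by move=> p n _ _; rewrite /nbmean [RHS]big_mkcond.
apply: (@bigO_one _ _ _ 1); last first.
  by move=> p n f; case: ifP => _; rewrite ?norm_rad ?normr0.
move=> p n f h; case: ifP => // nf; rewrite wmom_rad.
case: forallP => // ev.
have ge2 e : e \in ewE p n f -> (2 <= count_mem e (ewE p n f))%N.
  by rewrite -has_pred1 has_count; apply: even_gt1; exact: ev.
have [leF _] := count_excess (size_ew _ _ _ f) ge2.
have := @nb_nvert _ _ _ (@fst 'I_p 'I_n) (@snd 'I_p 'I_n) (eset (ewE p n f)).
move=> /(_ (nb_mated_row _ _ nf) (nb_mated_col _ _ nf)).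
by move=> /(_ (fun _ _ => erefl) (fun _ _ => erefl) (fun _ _ => erefl) (fun _ _ => erefl)) le; have := leq_trans h (leq_trans le leF); rewrite ltnn.
Qed.

(** Beyond [m + m'.+1] vertices only two readings of one cycle contribute, counted exactly by
    falling factorials; all other pairs go into the error. The test [0 < m] reflects that [nb] fails
    at [m = 0]. *)
Lemma nbcov_O m m' : bigO (wP R (m + m'))
  (fun p n => nbcov m m' p n -
    ((m == m') && (0 < m)%N)%:R * (2 * m.+1)%:R * (p ^_ m.+1 * n ^_ m.+1)%:R).
Proof.
pose F p n (f : walks p n m) (g : walks p n m') : R :=
  if [&& nbE p n f, nbE p n g & (nvE p n (eset (ewE p n f ++ ewE p n g)) <= m + m'.+1)%N]
  then wcov (rad R) (ewE p n f) (ewE p n g) else 0.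
apply: (@bigO_ext _ _ (fun p n => \sum_f \sum_g F p n f g)); last first.
  apply: (@bigO_pair _ _ _ _ 1).
    by move=> p n f g h; rewrite /F [X in [&& _, _ & X]]leqNgt addnS h /= !andbF.
  by move=> p n f g; rewrite /F; case: ifP => _; rewrite ?norm_wcov_rad ?normr0.
move=> p n _ _; apply/eqP; rewrite eq_sym subr_eq eq_sym; apply/eqP.
rewrite /nbcov pair_big_dep /= pair_big /=.
rewrite [RHS](bigID (fun h : walks p n m * walks p n m' => nvE p n (eset (ewE p n h.1 ++ ewE p n h.2)) <= m + m'.+1)%N) /=.
congr (_ + _).
  rewrite [RHS]big_mkcond; apply: eq_bigr => -[f g] _ /=; by rewrite /F andbA.
have [mm|mm] := eqVneq m m'; last first.
  rewrite !mul0r big1 // => -[f g] /= /andP[/andP[nf ng]]; rewrite -ltnNge => h.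
  by apply: wcov_nb_neq => //; exact/eqP.
subst m'; case: m F => [|m] F /=.
  rewrite !mul0r big1 // => -[f g] /= /andP[/andP[nf ng] _].
  have [nr _] := nbP nf ord0; case: nr; congr (f _).1.
  by apply: val_inj; rewrite /= modn1.
rewrite mul1r -natrM mulnC -{1}(card_ord p) -{1}(card_ord n).
rewrite -(@card_cyc _ _ _ (@fst 'I_p 'I_n) (@snd 'I_p 'I_n) (@pair 'I_p 'I_n)) //; last by case.
rewrite -(@sum_wcov_top _ _ _ (@fst 'I_p 'I_n) (@snd 'I_p 'I_n) (@pair 'I_p 'I_n)) //; last by case.
by apply: eq_bigl => -[f g] /=; rewrite -ltnNge -andbA addSn.
Qed.

End WalkAsymptotics.

From mathcomp Require Import perm.

(** * Walks crossing each of their edges twice, counted edge by edge *)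

Section TreeCount.
Local Notation ewE p n := (ew (@fst 'I_p 'I_n) (@snd 'I_p 'I_n) (@pair 'I_p 'I_n)).
Local Notation walks p n m := {ffun 'I_m.+1 -> 'I_p * 'I_n}.

Lemma card_eset_all2 (E : finType) (w : seq E) k : size w = k.*2 -> allpairs2 w -> #|eset w| = k.
Proof.
move=> sw /forallP a2; have := sum_count_eset w; rewrite sw (eq_bigr (fun=> 2%N)); last first.
  move=> e; rewrite inE -has_pred1 has_count => h.
  by have /orP[/eqP h'|/eqP//] := a2 e; rewrite h' in h.
by rewrite sum_nat_const; lia.
Qed.

Variables (p n a : nat).

Definition ntree_at (e : 'I_p * 'I_n) : nat :=
  #|[set f : walks p n a | allpairs2 (ewE p n f) && (e \in ewE p n f)]|.

Lemma ew_map (f : 'I_a.+1 -> 'I_p * 'I_n) (s : {perm 'I_p}) (t : {perm 'I_n}) :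
  ewE p n [ffun x => (s (f x).1, t (f x).2)] = [seq (s e.1, t e.2) | e <- ewE p n f].
Proof.
rewrite /ew /unzip1 /mkseq -!map_comp; apply: eq_map => k /=.
by rewrite /wd; case: (odd k); rewrite /= ?/ret ?ffunE.
Qed.

(** Transposing two rows and two columns maps walks through [e] injectively to walks through [e'],
    so all edges carry equally many. *)
Lemma ntree_at_le e e' : (ntree_at e <= ntree_at e')%N.
Proof.
pose s := tperm e.1 e'.1; pose t := tperm e.2 e'.2.
pose phi (x : 'I_p * 'I_n) := (s x.1, t x.2).
have phi_inj : injective phi by move=> [x1 x2] [y1 y2] [/perm_inj-> /perm_inj->].
pose G (f : walks p n a) : walks p n a := [ffun x => (s (f x).1, t (f x).2)].
have injG : injective G.
  move=> f f' /ffunP h; apply/ffunP => x; have := h x; rewrite !ffunE => -[/perm_inj h1 /perm_inj h2].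
  by case: (f x) (f' x) h1 h2 => ? ? [? ?] /= -> ->.
rewrite /ntree_at -(card_imset _ injG); apply/subset_leq_card/subsetP => _ /imsetP[f + ->].
rewrite !in_set => /andP[/forallP a2 ef]; rewrite !ew_map; apply/andP; split.
  apply/forallP => x.
  pose y := (s x.1, t x.2).
  have xE : x = phi y by rewrite /phi /y /= /s /t !tpermK; case: (x).
  have -> : count_mem x [seq (s e0.1, t e0.2) | e0 <- ewE p n f] = count_mem y (ewE p n f).
    by rewrite xE count_map; apply: eq_count => z /=; rewrite (inj_eq phi_inj).
  exact: a2.
have -> : e' = phi e by rewrite /phi /s /t !tpermL; case: (e').
by apply/mapP; exists e.
Qed.

(** Double counting: a walk that crosses each of its edges twice has [a.+1] distinct edges. *)
Lemma sum_ntree_at : (\sum_e ntree_at e = a.+1 * ntree a p n)%N.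
Proof.
rewrite /ntree -sum1_card big_distrr /= muln1.
under eq_bigr do rewrite /ntree_at -sum1_card big_mkcond.
rewrite exchange_big /= [RHS]big_mkcond; apply: eq_bigr => f _.
rewrite inE; have [a2|na2] := boolP (allpairs2 _); last first.
  by rewrite big1 // => e _; rewrite inE (negbTE na2).
rewrite -[RHS](card_eset_all2 (size_ew _ _ _ f) a2) -sum1_card [RHS]big_mkcond /=.
by apply: eq_bigr => e _; rewrite !inE a2.
Qed.

Lemma ntree_atE e : (ntree_at e * (p * n) = a.+1 * ntree a p n)%N.
Proof.
rewrite -sum_ntree_at (eq_bigr (fun=> ntree_at e)).
  by rewrite sum_nat_const card_prod !card_ord mulnC.
by move=> e' _; apply/eqP; rewrite eqn_leq !ntree_at_le.
Qed.

End TreeCount.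

(** Summing over the common edge gives [ntree_at a e * ntree_at b e], which does not depend on [e];
    a count of pairs is thus reduced to counts of single walks. *)
Lemma commonsumE a b p n :
  (commonsum a b p n * (p * n) = a.+1 * ntree a p n * (b.+1 * ntree b p n))%N.
Proof.
have -> : commonsum a b p n = (\sum_(e : 'I_p * 'I_n) ntree_at a e * ntree_at b e)%N.
  have atS k (e : 'I_p * 'I_n) : ntree_at k e =
      (\sum_(f : {ffun 'I_k.+1 -> 'I_p * 'I_n})
        (allpairs2 (ew fst snd pair f) && (e \in ew fst snd pair f)))%N.
    rewrite /ntree_at -sum1_card big_mkcond /=; apply: eq_bigr => f _.
    by rewrite in_set; case: (_ && _).
  under [RHS]eq_bigr do rewrite !atS big_distrlr /=.
  rewrite exchange_big /=; apply: eq_bigr => f _; rewrite exchange_big /=; apply: eq_bigr => g _.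
  rewrite /common2; case: (allpairs2 (ew fst snd pair f)); last by rewrite big1.
  case: (allpairs2 (ew fst snd pair g)); last by rewrite big1 // => e _; rewrite muln0.
  rewrite /shared -sum1_card big_mkcond /=; apply: eq_bigr => e _.
  by rewrite in_set mulnb; case: (_ && _).
rewrite big_distrl /=; under eq_bigr do rewrite mulnAC ntree_atE.
by rewrite -big_distrr /= sum_ntree_at.
Qed.

(** * Exact expansion of sign averages in non-backtracking walks *)

Section RadIdentities.
Variable R : realFieldType.
Local Notation ewE p n := (ew (@fst 'I_p 'I_n) (@snd 'I_p 'I_n) (@pair 'I_p 'I_n)).
Local Notation nbE p n := (nb (@fst 'I_p 'I_n) (@snd 'I_p 'I_n)).
Local Notation walks p n m := {ffun 'I_m.+1 -> 'I_p * 'I_n}.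
Variables (p n : nat).
Local Notation E := ('I_p * 'I_n)%type.
Local Notation avgE := (@avg E R).

Definition smx (s : {ffun E -> bool}) : 'M[R]_(p, n) := \matrix_(i, j) sgn R s (i, j).

Lemma wprod_smx s (w : seq E) : wprod (smx s) w = \prod_(e <- w) sgn R s e.
Proof. by rewrite /wprod; apply: eq_bigr => -[i j] _; rewrite mxE. Qed.

Definition acov (F G : {ffun E -> bool} -> R) := avgE (fun s => F s * G s) - avgE F * avgE G.

Lemma eq_acov F F' G G' : F =1 F' -> G =1 G' -> acov F G = acov F' G'.
Proof.
move=> hF hG; rewrite /acov (eq_avg hF) (eq_avg hG); congr (_ - _).
by apply: eq_avg => s; rewrite hF hG.
Qed.

Lemma avg_walks m (P : pred (walks p n m)) :
  avgE (fun s => \sum_(f | P f) wprod (smx s) (ewE p n f)) =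
  \sum_(f | P f) wmom (rad R) (ewE p n f).
Proof.
rewrite avg_sum; apply: eq_bigr => f _; rewrite -avg_word; apply: eq_avg => s; exact: wprod_smx.
Qed.

Lemma acov_walks m m' (P : pred (walks p n m)) (Q : pred (walks p n m')) :
  acov (fun s => \sum_(f | P f) wprod (smx s) (ewE p n f))
       (fun s => \sum_(g | Q g) wprod (smx s) (ewE p n g)) =
  \sum_(f | P f) \sum_(g | Q g) wcov (rad R) (ewE p n f) (ewE p n g).
Proof.
rewrite /acov !avg_walks big_distrlr /=.
have -> : avgE (fun s => (\sum_(f | P f) wprod (smx s) (ewE p n f)) *
    (\sum_(g | Q g) wprod (smx s) (ewE p n g))) =
    \sum_(f | P f) \sum_(g | Q g) wmom (rad R) (ewE p n f ++ ewE p n g).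
  under eq_avg do rewrite big_distrlr /=.
  rewrite avg_sum; apply: eq_bigr => f _; rewrite avg_sum; apply: eq_bigr => g _.
  by rewrite -avg_word; apply: eq_avg => s; rewrite big_cat /= !wprod_smx.
by rewrite -sumrB; apply: eq_bigr => f _; rewrite -sumrB.
Qed.

Lemma acov_const_sum k k' (t : 'I_k -> R) (t' : 'I_k' -> R) F G c c' :
  acov (fun s => c + \sum_i t i * F i s) (fun s => c' + \sum_j t' j * G j s) =
  \sum_i \sum_j t i * t' j * acov (F i) (G j).
Proof.
rewrite /acov.
have av k0 (u : 'I_k0 -> R) H x : avgE (fun s => x + \sum_i u i * H i s) = x + \sum_i u i * avgE (H i).
  by rewrite avgD avg_const avg_sum; congr (_ + _); apply: eq_bigr => i _; rewrite avgM.
rewrite !av.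
have -> : avgE (fun s => (c + \sum_i t i * F i s) * (c' + \sum_j t' j * G j s)) =
   c * c' + c * (\sum_j t' j * avgE (G j)) + c' * (\sum_i t i * avgE (F i))
   + \sum_i \sum_j t i * t' j * avgE (fun s => F i s * G j s).
  under eq_avg do rewrite mulrDl !mulrDr.
  rewrite !avgD avg_const -!addrA; congr (_ + _); congr (_ + _).
    by rewrite avgM avg_sum; congr (_ * _); apply: eq_bigr => j _; rewrite avgM.
  congr (_ + _).
    under eq_avg do rewrite mulrC.
    by rewrite avgM avg_sum; congr (_ * _); apply: eq_bigr => j _; rewrite avgM.
  under eq_avg do rewrite big_distrlr /=.
  rewrite avg_sum; apply: eq_bigr => i _; rewrite avg_sum; apply: eq_bigr => j _.
  by rewrite -avgM; apply: eq_avg => s; ring.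
under [RHS]eq_bigr do under eq_bigr do rewrite mulrBr.
under [RHS]eq_bigr do rewrite sumrB.
rewrite sumrB.
have -> : \sum_i \sum_j t i * t' j * (avgE (F i) * avgE (G j)) =
    (\sum_i t i * avgE (F i)) * (\sum_j t' j * avgE (G j)).
  by rewrite big_distrlr /=; apply: eq_bigr => i _; apply: eq_bigr => j _; ring.
ring.
Qed.

(** The deterministic part of [nbsum_fmx]: it drops out of covariances but carries the mean. *)
Definition nbconst m : R := (p * n)%:R - p%:R - n%:R + (n%:R - p%:R) * (1 - p%:R) ^+ m.+1.
Definition tc a m : R := tcoef (n%:R - 1) (p%:R - 1) a m.

Lemma trace_nbsum a s : \tr ((smx s *m (smx s)^T) ^+ a.+1) =
  (p%:R * tc a.+1 0 - \sum_(m < a.+1) tc a.+1 m.+1 * nbconst m)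
  + \sum_(m < a.+1) tc a.+1 m.+1 * nbsum (smx s) m.
Proof.
have sq i j : smx s i j * smx s i j = 1 by rewrite mxE sgn_sq.
rewrite (@mxpow_fmx _ (n%:R - 1 + (p%:R - 1)) ((n%:R - 1) * (p%:R - 1)) _ _
  (n%:R - 1) (p%:R - 1) erefl erefl _ _ (leqnn a.+1)) mxtraceD mxtrace_scalar -[_ *+ p]mulr_natl.
rewrite (raddf_sum (@mxtrace R p)) -[RHS]addrA; congr (_ + _); rewrite [RHS]addrC -sumrB; apply: eq_bigr => m _.
by rewrite -[LHS]/(\tr _) mxtraceZ (nbsum_fmx sq) /nbconst /tc; ring.
Qed.

Lemma wcovsum_rad a b : wcovsum (rad R) a b p n =
  \sum_(m < a.+1) \sum_(m' < b.+1) tc a.+1 m.+1 * tc b.+1 m'.+1 * nbcov R m m' p n.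
Proof.
rewrite /wcovsum -acov_walks.
have tE k s : \sum_(f : walks p n k) wprod (smx s) (ewE p n f) =
    (p%:R * tc k.+1 0 - \sum_(m < k.+1) tc k.+1 m.+1 * nbconst m)
    + \sum_(m < k.+1) tc k.+1 m.+1 * nbsum (smx s) m by rewrite -trace_walks trace_nbsum.
rewrite (eq_acov (tE a) (tE b)) acov_const_sum; apply: eq_bigr => m _; apply: eq_bigr => m' _.
by rewrite /nbsum acov_walks.
Qed.

Lemma radmeanE a : radmean R a p n = p%:R * tc a.+1 0 +
  \sum_(m < a.+1) tc a.+1 m.+1 * (nbmean R m p n - nbconst m).
Proof.
rewrite /radmean -avg_walks; under eq_avg do rewrite -trace_walks trace_nbsum.
rewrite avgD avg_const avg_sum -addrA; congr (_ + _); rewrite [LHS]addrC -sumrB; apply: eq_bigr => m _.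
by rewrite avgM /nbsum avg_walks mulrBr.
Qed.

End RadIdentities.

(** * Asymptotic evaluation for random signs *)

Section TCoefIdentities.
Variables (R : comNzRingType) (N P : R).
Local Notation T := (tcoef N P).

Lemma tcoef_deriv a : a.+2%:R * T a.+1 1 = a.+1%:R * (2 * T a 0 + (N + P) * T a 1).
Proof.
have dE : (tpoly N P a.+1)^`() = (2%:P * 'X + (N + P)%:P) * tpoly N P a *+ a.+1.
  rewrite /tpoly deriv_exp; congr (_ * _ *+ _).
  rewrite derivM !derivD !derivX !derivC !addr0 mul1r mulr1 !polyCD polyC1.
  by ring.
have := coef_deriv (tpoly N P a.+1) a.+1.
rewrite dE coefMn mulrDl -mulrA coefD !coefCM coefXM /= => h.
by rewrite /tcoef addn1 addn0 addn1 [LHS]mulr_natl [RHS]mulr_natl h.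
Qed.

Lemma tcoef_lagrange a : T a.+1 1 = a.+1%:R * (T a 0 - N * P * T a 2).
Proof.
have := tcoef_deriv a; rewrite (_ : (N + P) * T a 1 = T a.+1 1 - T a 0 - N * P * T a 2); last first.
  by rewrite tcoef_recS; ring.
rewrite -natr1 mulrDl mul1r => /eqP; rewrite -subr_eq0 => /eqP h.
by apply/eqP; rewrite -subr_eq0; apply/eqP; rewrite -h; ring.
Qed.

(** At [z = - P] the factor [1 + P / z] vanishes: in the recurrence the weights of all [T a k] with
    [k >= 2] cancel, and only boundary terms stay. *)
Lemma tcoef_altsum a M : (a < M)%N ->
  \sum_(m < M) T a.+1 m.+1 * (- P) ^+ m.+1 = - P * (T a 0 + N * T a 1).
Proof.
move=> aM; pose x := - P.
pose A0 := \sum_(m < M) T a m.+1 * x ^+ m.+1.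
have e0 : \sum_(m < M) T a m * x ^+ m = T a 0 + A0.
  transitivity (\sum_(m < M.+1) T a m * x ^+ m); last by rewrite big_ord_recl expr0 mulr1.
  by rewrite big_ord_recr /= tcoef_small ?mul0r ?addr0.
have e2 : P * (\sum_(m < M) T a m.+2 * x ^+ m.+1) = - (A0 + P * T a 1).
  have -> : A0 = T a 1 * x + \sum_(m < M) T a m.+2 * x ^+ m.+2.
    rewrite /A0; transitivity (\sum_(m < M.+1) T a m.+1 * x ^+ m.+1).
      by rewrite big_ord_recr /= [X in _ + X * _]tcoef_small ?mul0r ?addr0 //; lia.
    by rewrite big_ord_recl expr1.
  have -> : \sum_(m < M) T a m.+2 * x ^+ m.+2 = x * \sum_(m < M) T a m.+2 * x ^+ m.+1.
    by rewrite mulr_sumr; apply: eq_bigr => m _; rewrite exprS; ring.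
  by rewrite /x; ring.
under eq_bigr do rewrite tcoef_recS.
have -> : \sum_(m < M) (T a m + (N + P) * T a m.+1 + N * P * T a m.+2) * x ^+ m.+1 =
  x * (\sum_(m < M) T a m * x ^+ m) + (N + P) * A0
  + N * (P * (\sum_(m < M) T a m.+2 * x ^+ m.+1)).
  rewrite /A0 !mulr_sumr -!big_split /=; apply: eq_bigr => m _; rewrite exprS; ring.
by rewrite e0 e2 /x; ring.
Qed.

(** [P * N * T a.+1 1 / a.+1] is the Narayana polynomial, the leading order of the mean trace; here
    it is recovered from the constants of the non-backtracking expansion. *)
Lemma tcoef_lead a :
  a.+1%:R * (P * T a.+1 0 - \sum_(m < a.+1) T a.+1 m.+1 *
     ((N - P) * (- P) ^+ m.+1 + (m == 0 :> nat)%:R * (P * N))) = P * N * T a.+1 1.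
Proof.
under eq_bigr do rewrite mulrDr mulrCA.
rewrite big_split /= -mulr_sumr tcoef_altsum // (bigD1 ord0) //= big1 => [|m m0]; last first.
  by rewrite (_ : (m == 0 :> nat) = false) ?mul0r ?mulr0 //; apply/negbTE.
rewrite mul1r addr0 tcoef_rec0.
transitivity (P * N * (a.+1%:R * (T a 0 - N * P * T a 2))); last by rewrite -tcoef_lagrange.
by rewrite tcoef_recS; ring.
Qed.

End TCoefIdentities.

(** * Replacing shifted and falling powers by plain powers *)

Section Asymptotics.
Variable R : realFieldType.
Local Notation N := (fun p n : nat => n%:R : R).

Local Notation wN := (wN R).
Local Notation wP := (wP R).

Lemma wN_ge0 k p n : 0 <= wN k p n. Proof. by rewrite exprn_ge0. Qed.
Lemma wP_ge0 k p n : 0 <= wP k p n. Proof. by rewrite mulr_ge0 ?exprn_ge0. Qed.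

Lemma bigO_wNN i j k F G : (i + j = k)%N -> bigO (wN i) F -> bigO (wN j) G ->
  bigO (wN k) (fun p n => F p n * G p n).
Proof.
move=> <- hF hG; apply: bigO_le (bigO_mul hF hG) => p n _ _.
by rewrite /wN exprD.
Qed.

Lemma bigO_wNP i j k F G : (i + j = k)%N -> bigO (wN i) F -> bigO (wP j) G ->
  bigO (wP k) (fun p n => F p n * G p n).
Proof.
move=> <- hF hG; apply: bigO_le (bigO_mul hF hG) => p n _ _.
by rewrite /wN /wP exprD mulrCA.
Qed.

Lemma bigO_wP_le i j F : (i <= j)%N -> bigO (wP i) F -> bigO (wP j) F.
Proof.
move=> ij; apply: bigO_le => p n p0 pn; rewrite /wP ler_wpM2l // ler_weXn2l //.
by rewrite ler1n (leq_trans p0).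
Qed.

(* Multiplying by [n] instead of dividing keeps all the weights polynomial. *)
Definition nO (u F : nat -> nat -> R) := bigO u (fun p n => n%:R * F p n).

Lemma nO_div u v F : (forall p n, (0 < p)%N -> (p <= n)%N -> u p n <= n%:R * v p n) ->
  nO u F -> bigO v F.
Proof.
move=> h [C C0 hC]; exists C => // p n p0 pn.
have n0 : 0 < n%:R :> R by rewrite ltr0n (leq_trans p0).
rewrite -(ler_pM2l n0) mulrCA; apply: le_trans (_ : C * u p n <= _).
  by have := hC _ _ p0 pn; rewrite normrM ger0_norm.
by rewrite ler_wpM2l // h.
Qed.

Lemma O_powN k : bigO (wN k) (fun p n => n%:R ^+ k).
Proof. by apply: bigO_refl; exact: wN_ge0. Qed.

Lemma O_powp k : bigO (wN k) (fun p n => p%:R ^+ k).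
Proof.
exists 1 => // p n p0 pn; rewrite mul1r ger0_norm ?exprn_ge0 //.
by rewrite lerXn2r ?nnegrE // ler_nat.
Qed.

Lemma O_powpS k : bigO (wP k) (fun p n => p%:R ^+ k.+1).
Proof.
exists 1 => // p n p0 pn; rewrite mul1r ger0_norm ?exprn_ge0 // exprS.
by rewrite ler_wpM2l // lerXn2r ?nnegrE // ler_nat.
Qed.

Lemma pow_pred_diff (x y : R) k : 1 <= x -> x <= y ->
  0 <= x ^+ k - (x - 1) ^+ k /\ y * (x ^+ k - (x - 1) ^+ k) <= k%:R * y ^+ k.
Proof.
move=> x1 xy; have x0 : 0 <= x by apply: le_trans x1.
have y0 : 0 <= y by apply: le_trans xy.
have x10 : 0 <= x - 1 by rewrite subr_ge0.
split.
  by rewrite subr_ge0 lerXn2r ?nnegrE // lerBlDr lerDl.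
elim: k => [|k IH]; first by rewrite !expr0 subrr mulr0 mul0r.
have -> : y * (x ^+ k.+1 - (x - 1) ^+ k.+1) =
  x * (y * (x ^+ k - (x - 1) ^+ k)) + y * (x - 1) ^+ k by rewrite !exprS; ring.
rewrite -natr1 mulrDl mul1r lerD //.
  apply: le_trans (_ : y * (k%:R * y ^+ k) <= _); last by rewrite exprS mulrCA.
  apply: le_trans (_ : x * (k%:R * y ^+ k) <= _); first by rewrite ler_wpM2l.
  by rewrite ler_wpM2r // mulr_ge0 // exprn_ge0.
rewrite exprS ler_wpM2l // lerXn2r ?nnegrE //.
by apply: le_trans xy; rewrite lerBlDr lerDl.
Qed.

Lemma nO_powp k : nO (wN k) (fun p n => (p%:R - 1) ^+ k - p%:R ^+ k).
Proof.
exists k%:R => // p n p0 pn.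
have p1 : 1 <= p%:R :> R by rewrite ler1n.
have pn' : p%:R <= n%:R :> R by rewrite ler_nat.
have [h1 h2] := pow_pred_diff k p1 pn'.
by rewrite normrM distrC (ger0_norm h1) ger0_norm.
Qed.

Lemma nO_powN k : nO (wN k) (fun p n => (n%:R - 1) ^+ k - n%:R ^+ k).
Proof.
exists k%:R => // p n p0 pn.
have n1 : 1 <= n%:R :> R by rewrite ler1n (leq_trans p0).
have [h1 h2] := pow_pred_diff k n1 (lexx _).
by rewrite normrM distrC (ger0_norm h1) ger0_norm.
Qed.

Lemma O_powp1 k : bigO (wN k) (fun p n => (p%:R - 1) ^+ k).
Proof.
exists 1 => // p n p0 pn; have p1 : 0 <= p%:R - 1 :> R by rewrite subr_ge0 ler1n.
rewrite mul1r ger0_norm ?exprn_ge0 // lerXn2r ?nnegrE //.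
by apply: le_trans (_ : p%:R <= _); rewrite ?ler_nat // lerBlDr lerDl.
Qed.

Lemma tcO a m : (m <= a)%N -> bigO (wN (a - m)) (fun p n => tcoef (n%:R : R) p%:R a m).
Proof.
move=> ma; apply: (@bigO_ext _ _ (fun p n => \sum_(k < a.+1)
   ('C(a, k) * 'C(a, k + m))%:R * (p%:R ^+ k * n%:R ^+ (a - m - k)))).
  by move=> p n _ _; rewrite tcoefE.
apply: bigO_sum => [p n|k _]; first exact: wN_ge0.
have [kma|kma] := leqP (k + m) a; last first.
  apply: (@bigO_ext _ _ (fun _ _ => 0)); last by apply: bigO0; exact: wN_ge0.
  by move=> p n _ _; rewrite (bin_small kma) muln0 mul0r.
apply: bigO_scale; apply: (bigO_wNN _ (O_powp k) (O_powN _)); lia.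
Qed.

(** Shifting [n] or [p] by 1 changes each monomial by one order of [n] less than its bound; the two
    variables are shifted one after the other. *)
Lemma tc_diff a m : (m <= a)%N ->
  nO (wN (a - m)) (fun p n => tc R p n a m - tcoef (n%:R : R) p%:R a m).
Proof.
move=> ma; apply: (@bigO_ext _ _ (fun p n => \sum_(k < a.+1)
   ('C(a, k) * 'C(a, k + m))%:R *
   (n%:R * ((p%:R - 1) ^+ k - p%:R ^+ k) * n%:R ^+ (a - m - k)
    + (p%:R - 1) ^+ k * (n%:R * ((n%:R - 1) ^+ (a - m - k) - n%:R ^+ (a - m - k)))))).
  move=> p n _ _; rewrite /tc !tcoefE -sumrB mulr_sumr; apply: eq_bigr => k _; ring.
apply: bigO_sum => [p n|k _]; first exact: wN_ge0.
have [kma|kma] := leqP (k + m) a; last first.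
  apply: (@bigO_ext _ _ (fun _ _ => 0)); last by apply: bigO0; exact: wN_ge0.
  by move=> p n _ _; rewrite (bin_small kma) muln0 mul0r.
apply: bigO_scale; apply: bigO_add.
  apply: (bigO_wNN _ (nO_powp k) (O_powN _)); lia.
by apply: (bigO_wNN _ (O_powp1 k) (nO_powN (a - m - k))); lia.
Qed.

Lemma nO_O u F : nO u F -> bigO u F.
Proof.
move=> [C C0 hC]; exists C => // p n p0 pn.
apply: le_trans (hC _ _ p0 pn); rewrite normrM ger0_norm // ler_peMl // ler1n.
exact: leq_trans pn.
Qed.

Lemma tc'O a m : (m <= a)%N -> bigO (wN (a - m)) (fun p n => tc R p n a m).
Proof.
move=> ma; apply: bigO_ext (bigO_add (nO_O (tc_diff ma)) (tcO ma)) => p n _ _.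
by rewrite subrK.
Qed.

Lemma ffact_lower n x b c : (x <= n)%N ->
  (n * x ^ c <= n * (x - b) ^_ c + c * (b + c) * n ^ c)%N.
Proof.
(* The induction needs the exact sum of the shifts [b + i]; [c * (b + c)] is only a coarser bound
   for it. *)
move=> xn; suff h : (n * x ^ c <= n * (x - b) ^_ c + (\sum_(i < c) (b + i)) * n ^ c)%N.
  apply: leq_trans h _; rewrite leq_add2l leq_mul2r; apply/orP; right.
  apply: leq_trans (_ : \sum_(i < c) (b + c) <= _)%N; last by rewrite sum_nat_const card_ord.
  by apply: leq_sum => i _; rewrite leq_add2l ltnW.
elim: c => [|c IH]; first by rewrite !expn0 ffactn0 leq_addr.
have A_le : ((x - b) ^_ c <= n ^ c)%N.
  apply: leq_trans (_ : x ^ c <= _)%N; last by case: (c) => // c'; rewrite leq_exp2r.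
  by elim: (c) => // k IHk; rewrite ffactnSr expnSr leq_mul //; lia.
rewrite ffactnSr big_ord_recr /= !expnSr; set A := ((x - b) ^_ c)%N in IH A_le *.
set K := (\sum_(i < c) _)%N in IH *; set M := (n ^ c)%N in IH A_le *; set X := (x ^ c)%N in IH *.
have : (n * X * x <= (n * A + K * M) * x)%N by rewrite leq_mul2r IH orbT.
have h1 : (K * M * x <= K * M * n)%N by rewrite leq_mul2l xn orbT.
have h2 : (n * A * x <= n * A * (x - b - c) + n * A * (b + c))%N.
  by rewrite -mulnDr leq_mul2l; apply/orP; right; lia.
have h3 : (n * A * (b + c) <= n * M * (b + c))%N by rewrite leq_mul2r leq_mul2l A_le !orbT.
nia.
Qed.

Lemma ffact_upper (x b c : nat) : ((x - b) ^_ c <= x ^ c)%N.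
Proof. by elim: c => // k IHk; rewrite ffactnSr expnSr leq_mul //; lia. Qed.

Lemma nO_ffact_gen (x : nat -> nat -> nat) b c : (forall p n, (p <= n)%N -> (x p n <= n)%N) ->
  nO (wN c) (fun p n => ((x p n - b) ^_ c)%:R - (x p n)%:R ^+ c).
Proof.
move=> hx; exists (c * (b + c))%:R => // p n p0 pn.
have := ffact_lower b c (hx _ _ pn); rewrite -(ler_nat R) natrD !natrM !natrX => h2.
have := ffact_upper (x p n) b c; rewrite -(ler_nat R) natrX => h1.
rewrite normrM distrC ger0_norm // ger0_norm ?subr_ge0 //.
by rewrite mulrBr lerBlDl.
Qed.

Lemma O_ffactN b c : bigO (wN c) (fun p n => ((n - b) ^_ c)%:R).
Proof.
exists 1 => // p n _ _; rewrite mul1r /wN ger0_norm // -natrX ler_nat; exact: ffact_upper.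
Qed.

(** One factor [p] is split off [p ^_ m.+1] before estimating, so that the error keeps it; the rest
    is [(p - 1) ^_ m]. *)
Lemma ffact_pn m j b : 
  bigO (wP (m + j).-1) (fun p n =>
    (p ^_ m.+1)%:R * ((n - b) ^_ j)%:R - p%:R ^+ m.+1 * n%:R ^+ j) .
Proof.
have hp := @nO_ffact_gen (fun p n => p) 1 m (fun p n h => h).
have hn := @nO_ffact_gen (fun p n => n) b j (fun p n h => leqnn n).
have h : nO (wN (m + j)) (fun p n => ((p - 1) ^_ m)%:R * ((n - b) ^_ j)%:R - p%:R ^+ m * n%:R ^+ j).
  apply: bigO_ext (bigO_add (bigO_wNN erefl hp (O_ffactN b j)) (bigO_wNN erefl (O_powp m) hn)).
  by move=> p n _ _ /=; ring.
apply: (@nO_div (wP (m + j))).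
  move=> p n p0 pn; rewrite /wP mulrCA ler_wpM2l // -exprS.
  rewrite ler_weXn2l ?leqSpred //; by rewrite ler1n (leq_trans p0).
apply: (@bigO_ext _ _ (fun p n => p%:R *
   (n%:R * (((p - 1) ^_ m)%:R * ((n - b) ^_ j)%:R - p%:R ^+ m * n%:R ^+ j)))).
  move=> p n p0 _; rewrite ffactnS subn1 natrM exprS; ring.
have hp1 : bigO (fun p _ : nat => p%:R : R) (fun p _ => p%:R) by apply: bigO_refl => p n.
exact: (bigO_mul hp1 h).
Qed.

End Asymptotics.

(** * Leading terms for signs and for general entries *)

Section Main.
Variable R : realFieldType.
Local Notation t a m := (fun p n : nat => tcoef (n%:R : R) p%:R a m).

Definition diagc m m' : R := ((m == m') && (0 < m)%N)%:R * (2 * m.+1)%:R.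

Lemma tpair_O a b m m' : (m <= a)%N -> (m' <= b)%N ->
  bigO (wN R (a - m + (b - m'))) (fun p n => tc R p n a.+1 m.+1 * tc R p n b.+1 m'.+1).
Proof.
move=> ma mb; have := @tc'O R a.+1 m.+1 ma; have := @tc'O R b.+1 m'.+1 mb; rewrite !subSS => h1 h2.
exact: bigO_wNN erefl h2 h1.
Qed.

Lemma tpair_diff a b m m' : (m <= a)%N -> (m' <= b)%N ->
  nO (wN R (a - m + (b - m'))) (fun p n => tc R p n a.+1 m.+1 * tc R p n b.+1 m'.+1
     - t a.+1 m.+1 p n * t b.+1 m'.+1 p n).
Proof.
move=> ma mb; have := @tc'O R b.+1 m'.+1 mb; have := @tc_diff R a.+1 m.+1 ma.
have := @tcO R a.+1 m.+1 ma; have := @tc_diff R b.+1 m'.+1 mb; rewrite !subSS => h1 h2 h3 h4.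
apply: bigO_ext (bigO_add (bigO_wNN erefl h3 h4) (bigO_wNN erefl h2 h1)) => p n _ _ /=; ring.
Qed.

Lemma diagc0 m m' : m != m' -> diagc m m' = 0.
Proof. by rewrite /diagc => /negbTE->; rewrite mul0r. Qed.

(** Three replacements, each within the error: [nbcov] by its diagonal leading term, falling
    factorials by powers, and [tc] by [tcoef]. *)
Lemma wcovsum_rad_O a b : bigO (wP R (a + b)) (fun p n => wcovsum (rad R) a b p n -
  \sum_(m < a.+1) \sum_(m' < b.+1) diagc m m' *
    (t a.+1 m.+1 p n * t b.+1 m'.+1 p n * (p%:R ^+ m.+1 * n%:R ^+ m.+1))).
Proof.
apply: (@bigO_ext _ _ (fun p n => \sum_(m < a.+1) \sum_(m' < b.+1)
  (tc R p n a.+1 m.+1 * tc R p n b.+1 m'.+1 *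
    (nbcov R m m' p n - diagc m m' * (p ^_ m.+1 * n ^_ m.+1)%:R)
  + diagc m m' * (tc R p n a.+1 m.+1 * tc R p n b.+1 m'.+1 *
      ((p ^_ m.+1)%:R * ((n - 0) ^_ m.+1)%:R - p%:R ^+ m.+1 * n%:R ^+ m.+1))
  + diagc m m' * ((tc R p n a.+1 m.+1 * tc R p n b.+1 m'.+1
     - t a.+1 m.+1 p n * t b.+1 m'.+1 p n) * (p%:R ^+ m.+1 * n%:R ^+ m.+1))))).
  move=> p n _ _; rewrite wcovsum_rad -sumrB; apply: eq_bigr => m _.
  by rewrite -sumrB; apply: eq_bigr => m' _; rewrite subn0 natrM; ring.
apply: bigO_sum => [p n|m _]; first exact: wP_ge0.
apply: bigO_sum => [p n|m' _]; first exact: wP_ge0.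
have mP : (m <= a)%N := ltn_ord m; have mP' : (m' <= b)%N := ltn_ord m'.
move: (nat_of_ord m) (nat_of_ord m') mP mP' => {}m {}m' mP mP'.
have zero : bigO (wP R (a + b)) (fun _ _ => 0) by apply: bigO0; exact: wP_ge0.
apply: bigO_add; first apply: bigO_add.
- have h : bigO (wP R (m + m')) (fun p n => nbcov R m m' p n - diagc m m' * (p ^_ m.+1 * n ^_ m.+1)%:R).
    exact: nbcov_O.
  by apply: (bigO_wNP _ (tpair_O mP mP') h); lia.
- have [mm|/diagc0 mm] := eqVneq m m'; last first.
    by apply: bigO_ext zero => p n _ _; rewrite mm mul0r.
  subst m'; apply: bigO_scale.
  by apply: (bigO_wNP _ (tpair_O mP mP') (ffact_pn R m m.+1 0)); rewrite addnS /=; lia.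
have [mm|/diagc0 mm] := eqVneq m m'; last first.
  by apply: bigO_ext zero => p n _ _; rewrite mm mul0r.
subst m'; apply: bigO_scale.
apply: (@nO_div _ (wP R (a + b).+1)).
  by move=> p n _ _; rewrite /wP exprS mulrCA.
have hD : bigO (wP R (m + m.+1)) (fun p n => p%:R ^+ m.+1 * n%:R ^+ m.+1).
  apply: bigO_le (bigO_mul (O_powpS R m) (O_powN R m.+1)) => p n _ _.
  by rewrite /wP /wN exprD mulrA.
apply: bigO_ext (bigO_wNP _ (tpair_diff mP mP') hD); last by lia.
by move=> p n _ _ /=; ring.
Qed.

Lemma sum_diagc a b (F : nat -> nat -> R) : (forall m, (b < m)%N -> F m m = 0) ->
  \sum_(m < a.+1) \sum_(m' < b.+1) diagc m m' * F m m' =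
  \sum_(m < a.+1) diagc m m * F m m.
Proof.
move=> F0; apply: eq_bigr => m _; have [mb|mb] := ltnP m b.+1; last first.
  rewrite F0 // mulr0 big1 // => m' _.
  by rewrite diagc0 ?mul0r //; have := ltn_ord m'; lia.
rewrite (bigD1 (Ordinal mb)) //= big1 ?addr0 // => m' mm.
by rewrite diagc0 ?mul0r //; apply: contraNneq mm => mm; apply/eqP/val_inj.
Qed.

(** Leading part of [nbconst]; the term [p * n] reaches the leading order [p * n ^ m.+1] only at
    [m = 0]. *)
Definition kconst m p n : R := (n%:R - p%:R) * (- p%:R) ^+ m.+1 + (m == 0%N)%:R * (p%:R * n%:R).

(** The bracket removes the extreme terms of [(1 - p) ^ m.+1]; the degrees left in [p] run from 1 to
    [m], which leaves room for the factor [n - p]. *)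
Lemma bracket_O m :
  bigO (wP R m) (fun p n => (n%:R - p%:R) * ((1 - p%:R) ^+ m.+1 - 1 - (- p%:R) ^+ m.+1)).
Proof.
have hp : nO (wP R m) (fun p n => (1 - p%:R) ^+ m.+1 - 1 - (- p%:R) ^+ m.+1).
  elim: m => [|m IH].
    apply: (@bigO_ext _ _ (fun _ _ => 0)); last by apply: bigO0; exact: wP_ge0.
    by move=> p n _ _; rewrite !expr1; ring.
  have h1 : bigO (wN R 1) (fun p n => 1 - p%:R).
    by apply: bigO_ext (bigO_opp (O_powp1 R 1)) => p n _ _; rewrite expr1 opprB.
  have hp : bigO (wP R m.+1) (fun p n => n%:R * p%:R).
    apply: bigO_wP_le (_ : 1 <= m.+1)%N _ => //.
    by apply: bigO_ext (bigO_refl (@wP_ge0 R 1)) => p n _ _; rewrite /wP expr1 mulrC.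
  have hq : bigO (wP R m.+1) (fun p n => n%:R * (- p%:R) ^+ m.+1).
    have hN := O_powN R 1; have hm := O_powpS R m.
    apply: bigO_ext (bigO_wNP (add1n m) hN (bigO_scale ((-1) ^+ m.+1) hm)) => p n _ _ /=.
    by rewrite expr1 (exprNn p%:R).
  apply: bigO_ext (bigO_add (bigO_sub (bigO_wNP (add1n m) h1 IH) hp) hq) => p n _ _ /=.
  by rewrite !exprS; ring.
have [C C0 hC] := hp; exists C => // p n p0 pn.
apply: le_trans (hC _ _ p0 pn); rewrite !normrM ler_wpM2r //.
rewrite ger0_norm ?subr_ge0 ?ler_nat // ger0_norm //.
by rewrite lerBlDr lerDl.
Qed.

Lemma nbconst_O m : bigO (wP R m) (fun p n => nbconst R p n m - kconst m p n).
Proof.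
have h1 : bigO (wP R m) (fun p n => (m != 0%N)%:R * (p%:R * n%:R) - 2 * p%:R).
  apply: bigO_sub; last first.
    apply: bigO_scale; apply: bigO_wP_le (leq0n m) _.
    by apply: bigO_ext (bigO_refl (@wP_ge0 R 0)) => p n _ _; rewrite /wP expr0 mulr1.
  case: m => [|m].
    by apply: bigO_ext (bigO0 (@wP_ge0 R 0)) => p n _ _; rewrite mul0r.
  apply: bigO_scale; apply: bigO_wP_le (ltn0Sn m) _.
  by apply: bigO_ext (bigO_refl (@wP_ge0 R 1)) => p n _ _; rewrite /wP expr1.
apply: bigO_ext (bigO_add h1 (bracket_O m)) => p n _ _ /=.
rewrite /nbconst /kconst natrM; case: (m == 0%N) => /=; ring.
Qed.

Lemma kconst_O m : bigO (wP R m.+1) (kconst m).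
Proof.
apply: bigO_add.
  have hN : bigO (wN R 1) (fun p n => n%:R - p%:R).
    by apply: bigO_ext (bigO_sub (O_powN R 1) (O_powp R 1)) => p n _ _; rewrite !expr1.
  have hm := bigO_scale ((-1) ^+ m.+1) (O_powpS R m).
  apply: bigO_ext (bigO_wNP (add1n m) hN hm) => p n _ _ /=.
  by rewrite (exprNn p%:R).
apply: bigO_scale; apply: bigO_wP_le (ltn0Sn m) _.
by apply: bigO_ext (bigO_refl (@wP_ge0 R 1)) => p n _ _; rewrite /wP expr1.
Qed.

Definition lead a p n : R := p%:R * t a.+1 0%N p n - \sum_(m < a.+1) t a.+1 m.+1 p n * kconst m p n.

Lemma radmean_O a : bigO (wP R a) (fun p n => radmean R a p n - lead a p n).
Proof.
apply: (@bigO_ext _ _ (fun p n => p%:R * (tc R p n a.+1 0 - t a.+1 0%N p n) +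
  \sum_(m < a.+1) (tc R p n a.+1 m.+1 * nbmean R m p n
    - tc R p n a.+1 m.+1 * (nbconst R p n m - kconst m p n)
    - (tc R p n a.+1 m.+1 - t a.+1 m.+1 p n) * kconst m p n))).
  move=> p n _ _; rewrite radmeanE /lead.
  set S1 := \sum_(m < _) _ * (_ - _); set S2 := \sum_(m < _) _ * kconst _ _ _.
  rewrite [X in _ + X = _](_ : _ = S1 + S2); first by ring.
  by rewrite /S1 /S2 -big_split /=; apply: eq_bigr => m _; ring.
apply: bigO_add.
  apply: (@nO_div _ (wP R a.+1)); first by move=> p n _ _; rewrite /wP exprS mulrCA.
  have := @tc_diff R a.+1 0 (leq0n _); rewrite subn0 => h.
  have hp : bigO (fun p _ : nat => p%:R : R) (fun p _ => p%:R) by apply: bigO_refl => p n.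
  by apply: bigO_ext (bigO_mul hp h) => p n _ _ /=; rewrite mulrCA.
apply: bigO_sum => [p n|m _]; first exact: wP_ge0.
have mP : (m <= a)%N := ltn_ord m; move: (nat_of_ord m) mP => {}m mP.
have h1 := @tc'O R a.+1 m.+1 mP; have h2 := @tc_diff R a.+1 m.+1 mP; rewrite !subSS in h1 h2.
apply: bigO_sub; first apply: bigO_sub.
- by apply: (bigO_wNP _ h1 (nbmean_O R m)); lia.
- by apply: (bigO_wNP _ h1 (nbconst_O m)); lia.
apply: (@nO_div _ (wP R a.+1)); first by move=> p n _ _; rewrite /wP exprS mulrCA.
apply: bigO_ext (bigO_wNP _ h2 (kconst_O m)); last by lia.
by move=> p n _ _ /=; ring.
Qed.

Lemma ntree_O a : bigO (wP R a) (fun p n =>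
  a.+1%:R * (ntree a p n)%:R - p%:R * n%:R * t a.+1 1%N p n).
Proof.
apply: bigO_ext (bigO_scale a.+1%:R (bigO_add (ntree_radmean R a) (radmean_O a))) => p n _ _ /=.
rewrite -tcoef_lead -/(lead a p n); ring.
Qed.

Lemma commonsum_O a b : bigO (wP R (a + b)) (fun p n =>
  (commonsum a b p n)%:R - p%:R * n%:R * (t a.+1 1%N p n * t b.+1 1%N p n)).
Proof.
have ha := ntree_O a; have hb := ntree_O b.
have ta := @tcO R a.+1 1 (ltn0Sn a); have tb := @tcO R b.+1 1 (ltn0Sn b).
rewrite subSS subn0 in ta; rewrite subSS subn0 in tb.
(* Dividing the product in [commonsumE] by [p * n] leaves two mixed terms and this product of both
   errors over [p * n]. *)
have hab : bigO (wP R (a + b)) (fun p n => (p%:R * n%:R)^-1 *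
   ((a.+1%:R * (ntree a p n)%:R - p%:R * n%:R * t a.+1 1%N p n) *
    (b.+1%:R * (ntree b p n)%:R - p%:R * n%:R * t b.+1 1%N p n))).
  have [C C0 hC] := bigO_mul ha hb; exists C => // p n p0 pn.
  have pn0 : 0 < p%:R * n%:R :> R by rewrite mulr_gt0 ?ltr0n // (leq_trans p0).
  rewrite normrM normfV (gtr0_norm pn0) ler_pdivrMl //.
  apply: le_trans (hC _ _ p0 pn) _; rewrite [leRHS]mulrCA ler_wpM2l // /wP.
  rewrite exprD [leRHS](_ : _ = (p%:R * n%:R ^+ a * (p%:R * n%:R ^+ b)) * n%:R); last by ring.
  rewrite ler_peMr ?mulr_ge0 ?exprn_ge0 // ler1n; exact: leq_trans pn.
apply: bigO_ext (bigO_add (bigO_add (bigO_wNP erefl ta hb) (bigO_wNP (addnC b a) tb ha)) hab).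
move=> p n p0 pn /=.
have pn0 : p%:R * n%:R != 0 :> R by rewrite mulf_neq0 ?pnatr_eq0 // -lt0n // (leq_trans p0).
have := congr1 (fun x : nat => x%:R : R) (commonsumE a b p n); rewrite !natrM => h.
apply: (mulfI pn0); rewrite [RHS]mulrBr [in RHS](mulrC (p%:R * n%:R) (commonsum a b p n)%:R) h.
by field; move: pn0; rewrite mulf_eq0 negb_or => /andP[-> ->].
Qed.

Definition wgt (kappa : R) m : R := (2 * m)%:R + (m == 1%N)%:R * kappa.

Lemma wcovsum_O (nu : nat -> R) a b : nu 0%N = 1 -> nu 1%N = 0 -> nu 2%N = 1 ->
  bigO (wP R (a + b)) (fun p n => wcovsum nu a b p n -
    \sum_(m < a.+1) wgt (nu 4%N - 3) m.+1 *
      (t a.+1 m.+1 p n * t b.+1 m.+1 p n * (p%:R ^+ m.+1 * n%:R ^+ m.+1))).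
Proof.
move=> nu0 nu1 nu2.
apply: bigO_ext (bigO_add (bigO_add (wcovsum_universal a b nu0 nu1 nu2) (wcovsum_rad_O a b))
  (bigO_scale (nu 4%N - 1) (commonsum_O a b))) => p n _ _ /=.
rewrite (@sum_diagc a b (fun m m' => t a.+1 m.+1 p n * t b.+1 m'.+1 p n * (p%:R ^+ m.+1 * n%:R ^+ m.+1))).
  (* The index 0 of the sums, that is [m = 1], is isolated: there [diagc] is 0, and the shared edges
     give [nu 4 - 1 = 2 + (nu 4 - 3)], as [wgt] prescribes. *)
  rewrite !big_ord_recl.
  set S1 := \sum_(i < a) diagc _ _ * _; set S2 := \sum_(i < a) wgt _ _ * _.
  have -> : S1 = S2.
    by apply: eq_bigr => i _; rewrite /wgt /diagc eqxx /= mul1r mul0r addr0.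
  rewrite /wgt /diagc /= !mul0r !expr1; move: S2 => S2; ring.
by move=> m bm; rewrite (@tcoef_small _ _ _ b.+1) ?mulr0 ?mul0r.
Qed.

End Main.

(** * Rearrangement into the stated sums *)

Section Rearrangement.
Variable R : realFieldType.
Variables (l1 l2 : nat) (kappa N P : R).
Local Notation l := (l1 + l2)%N.

(** [csum] and [dsum] are [Ccoef] and [Dcoef] up to constants: the factorials combine with the
    binomials of [main_term] into falling factorials. *)
Definition csum b : nat := (\sum_(0 <= k < b.+1) 'C(l1, k) * 'C(l2, b - k) *
      \sum_(0 <= m < (b - k).+1) m * 'C(l1, k + m) * 'C(l2, b - m - k))%N.
Definition dsum b : nat :=
  (\sum_(0 <= k < b) 'C(l1, k) * 'C(l1, k.+1) * 'C(l2, b.-1 - k) * 'C(l2, b - k))%N.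

(** One summand of the full expansion. The power [b] of [P] is [k1 + k2 + m], so [k2] is [b - k - m]
    in the stated sums. *)
Let G k1 k2 m : R := wgt kappa m *
  (('C(l1, k1) * 'C(l1, k1 + m))%:R * ('C(l2, k2) * 'C(l2, k2 + m))%:R)
  * (P ^+ (k1 + k2 + m) * N ^+ (l - (k1 + k2 + m))).

Lemma wgt0 : wgt kappa 0 = 0. Proof. by rewrite /wgt muln0 mul0r addr0. Qed.

(** [dsum] is the slice [m = 1] of the double sum in [csum], so [wgt] merges the two. *)
Lemma csum_wgt b : (2 * csum b)%:R + kappa * (dsum b)%:R =
  \sum_(0 <= k < b.+1) \sum_(0 <= m < (b - k).+1) wgt kappa m *
  (('C(l1, k) * 'C(l1, k + m))%:R * ('C(l2, b - k - m) * 'C(l2, b - k - m + m))%:R).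
Proof.
rewrite /csum /dsum big_distrr /= natr_sum natr_sum mulr_sumr.
have -> : \sum_(0 <= k < b) kappa * ('C(l1, k) * 'C(l1, k.+1) * 'C(l2, b.-1 - k) * 'C(l2, b - k))%:R =
  \sum_(0 <= k < b.+1) if (k < b)%N then
     kappa * ('C(l1, k) * 'C(l1, k.+1) * 'C(l2, b.-1 - k) * 'C(l2, b - k))%:R else 0.
  rewrite big_nat_recr //= ltnn addr0; apply: eq_big_nat => k /andP[_ ->] //.
rewrite -big_split /=; apply: eq_big_nat => k /andP[_ kb].
rewrite !big_distrr /= natr_sum.
have -> : (if (k < b)%N then
     kappa * ('C(l1, k) * 'C(l1, k.+1) * 'C(l2, b.-1 - k) * 'C(l2, b - k))%:R else 0) =
  \sum_(0 <= m < (b - k).+1) (m == 1%N)%:R * (kappa *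
    ('C(l1, k) * 'C(l1, k.+1) * 'C(l2, b.-1 - k) * 'C(l2, b - k))%:R).
  rewrite big_nat_recl // mul0r add0r; case: ltnP => kb'; last first.
    by rewrite (_ : b - k = 0)%N ?big_geq //; lia.
  rewrite (_ : b - k = (b - k.+1).+1)%N; last by lia.
  rewrite big_nat_recl // mul1r big1 ?addr0 // => i _; by rewrite mul0r.
rewrite -big_split /=; apply: eq_big_nat => m /andP[_ mb].
have e1 : (b - k - m + m = b - k)%N by lia.
rewrite e1 (_ : b - m - k = b - k - m)%N; last by lia.
rewrite /wgt; have [->|_] := eqVneq m 1%N.
  rewrite addn1 (_ : b.-1 - k = b - k - 1)%N; last by lia.
  by rewrite !natrM; ring.
by rewrite !natrM /= !mul0r; ring.
Qed.

Lemma shift_sum L s (H : nat -> R) :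
  \sum_(0 <= B < L | (s <= B)%N) H (B - s)%N = \sum_(0 <= i < L | (i < L - s)%N) H i.
Proof.
rewrite -(big_nat_widenl s 0 L predT) // -{1}(add0n s) big_addn.
under eq_bigr do rewrite addnK.
by rewrite (big_nat_widen _ _ L) ?leq_subr.
Qed.

Lemma G0 k1 k2 m : (l < k1 + k2 + m)%N -> G k1 k2 m = 0.
Proof.
move=> h; rewrite /G; have [h1|h1] := ltnP l1 (k1 + m).
  by rewrite (bin_small h1) muln0 mul0r mulr0 mul0r.
have h2 : (l2 < k2)%N by lia.
by rewrite (bin_small h2) mul0n mulr0 mulr0 mul0r.
Qed.

(** For fixed [k] and [m], the variable [b] is exchanged for [k2 = b - (k + m)]; the terms added to
    make the ranges rectangular vanish by [G0]. *)
Lemma sum_to_G : \sum_(1 <= b < l.+1) ((2 * csum b)%:R + kappa * (dsum b)%:R) * (P ^+ b * N ^+ (l - b)) =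
  \sum_(0 <= m < l.+1) \sum_(0 <= k1 < l.+1) \sum_(0 <= k2 < l.+1) G k1 k2 m.
Proof.
transitivity (\sum_(0 <= b < l.+1) \sum_(0 <= k < l.+1) \sum_(0 <= m < l.+1 | (k + m <= b)%N)
    G k (b - (k + m)) m).
  rewrite [RHS]big_ltn // [X in _ = X + _]big1_seq ?add0r; last first.
    move=> k _; rewrite big1_seq // => m /andP[]; rewrite leqn0 addn_eq0 => /andP[_ /eqP->] _.
    by rewrite /G wgt0 !mul0r.
  apply: eq_big_nat => b /andP[b1 bl]; rewrite csum_wgt mulr_suml.
  rewrite [LHS](big_nat_widen _ _ l.+1) // [LHS]big_mkcond /=; apply: eq_big_nat => k /andP[_ kl].
  case: ltnP => kb; last by rewrite big_pred0 // => m; lia.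
  rewrite mulr_suml [LHS](big_nat_widen _ _ l.+1) /=; last by lia.
  rewrite [LHS]big_mkcond [RHS]big_mkcond; apply: eq_big_nat => m _ /=.
  rewrite (_ : (m < (b - k).+1) = (k + m <= b))%N; last by lia.
  case: ifP => // mb; rewrite /G (_ : k + (b - (k + m)) + m = b)%N; last by lia.
  by rewrite subnDA.
rewrite exchange_big /=.
under eq_bigr => k _ do (rewrite (exchange_big_dep_nat predT) //=).
rewrite exchange_big /=; apply: eq_big_nat => m _; apply: eq_big_nat => k _.
rewrite (shift_sum _ (k + m) (fun i => G k i m)) [RHS](bigID (fun i => i < l.+1 - (k + m))%N) /=.
rewrite [X in _ = _ + X]big1 ?addr0 // => i h; apply: G0; lia.
Qed.

Lemma G_to_tcoef : \sum_(m < l1) wgt kappa m.+1 *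
    (tcoef N P l1 m.+1 * tcoef N P l2 m.+1 * (P ^+ m.+1 * N ^+ m.+1)) =
  \sum_(0 <= m < l.+1) \sum_(0 <= k1 < l.+1) \sum_(0 <= k2 < l.+1) G k1 k2 m.
Proof.
rewrite [RHS]big_ltn // [X in _ = X + _]big1 ?add0r; last first.
  by move=> k1 _; rewrite big1 // => k2 _; rewrite /G wgt0 !mul0r.
rewrite big_add1 /= (big_cat_nat _ (leq_addr l2 l1)) //= [X in _ = _ + X]big1_seq ?addr0; last first.
  move=> m /andP[_]; rewrite mem_index_iota => /andP[ml _].
  rewrite big1 // => k1 _; rewrite big1 // => k2 _; rewrite /G (@bin_small l1 (k1 + m.+1)); last by lia.
  by rewrite muln0 mul0r mulr0 mul0r.
rewrite big_mkord; apply: eq_bigr => m _.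
have trunc (L : nat) (F : nat -> R) : (L < l.+1)%N -> (forall k, (L < k)%N -> F k = 0) ->
    \sum_(0 <= k < l.+1) F k = \sum_(k < L.+1) F k.
  move=> Ll F0; rewrite (big_cat_nat _ (_ : L.+1 <= l.+1)%N) //= [X in _ + X]big1_seq ?addr0 ?big_mkord //.
  by move=> k /andP[_]; rewrite mem_index_iota => /andP[h _]; exact: F0.
rewrite (trunc l1); [|lia|]; last first.
  by move=> k h; rewrite big1 // => k2 _; rewrite /G (bin_small h) mul0n mul0r mulr0 mul0r.
rewrite !tcoefE mulr_suml mulr_suml mulr_sumr; apply: eq_bigr => k1 _.
rewrite (trunc l2); [|lia|]; last first.
  by move=> k h; rewrite /G (bin_small h) mul0n mulr0 mulr0 mul0r.
rewrite mulr_sumr mulr_suml mulr_sumr; apply: eq_bigr => k2 _; rewrite /G.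
have [h1|h1] := ltnP l1 (k1 + m.+1).
  by rewrite (bin_small h1) muln0 !mul0r !mulr0 !mul0r ?mulr0.
have [h2|h2] := ltnP l2 (k2 + m.+1).
  by rewrite (bin_small h2) muln0 !mul0r !mulr0 !mul0r ?mulr0.
rewrite !exprD (_ : l - (k1 + k2 + m.+1) = (l1 - m.+1 - k1) + (l2 - m.+1 - k2) + m.+1)%N; last by lia.
by rewrite !exprD; ring.
Qed.

End Rearrangement.

Section MainAsymptotic.
Variable R : realFieldType.

Lemma main_asymp (nu : nat -> R) a b : nu 0%N = 1 -> nu 1%N = 0 -> nu 2%N = 1 ->
  bigO (wP R (a + b)) (fun p n => wcovsum nu a b p n -
    \sum_(1 <= B < (minn (a.+1 + b.+1) p).+1)
      (p ^_ B * (n - B) ^_ (a.+1 + b.+1 - B))%:R *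
      ((2 * csum a.+1 b.+1 B)%:R + (nu 4%N - 3) * (dsum a.+1 b.+1 B)%:R)).
Proof.
move=> nu0 nu1 nu2; set l := (a.+1 + b.+1)%N; set kappa := nu 4%N - 3.
have h2 : bigO (wP R (a + b)) (fun p n => \sum_(1 <= B < l.+1)
  ((2 * csum a.+1 b.+1 B)%:R + kappa * (dsum a.+1 b.+1 B)%:R) *
   ((p ^_ B)%:R * ((n - B) ^_ (l - B))%:R - p%:R ^+ B * n%:R ^+ (l - B))).
  apply: (@bigO_ext _ _ (fun p n => \sum_(B < l)
    ((2 * csum a.+1 b.+1 B.+1)%:R + kappa * (dsum a.+1 b.+1 B.+1)%:R) *
    ((p ^_ B.+1)%:R * ((n - B.+1) ^_ (l - B.+1))%:R - p%:R ^+ B.+1 * n%:R ^+ (l - B.+1)))).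
    by move=> p n _ _; rewrite big_add1 big_mkord.
  apply: bigO_sum => [p n|B _]; first exact: wP_ge0.
  apply: bigO_scale.
  have := ffact_pn R B (l - B.+1) B.+1; rewrite (_ : (B + (l - B.+1)).-1 = a + b)%N //.
  by have := ltn_ord B; rewrite /l; lia.
apply: bigO_ext (bigO_sub (wcovsum_O a b nu0 nu1 nu2) h2) => p n p0 pn /=.
rewrite G_to_tcoef -sum_to_G -/l -/kappa -addrA -opprD -big_split /=; congr (_ - _).
transitivity (\sum_(1 <= B < l.+1) (p ^_ B * (n - B) ^_ (l - B))%:R *
      ((2 * csum a.+1 b.+1 B)%:R + kappa * (dsum a.+1 b.+1 B)%:R)).
  by apply: eq_bigr => B _; rewrite natrM; ring.
(* Stopping at [p] changes nothing, because [p ^_ B = 0] for [B > p]. *)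
rewrite [RHS](big_nat_widen _ _ l.+1) ?ltnS ?geq_minl // [RHS]big_mkcond; apply: eq_big_nat => B /andP[B1 Bl].
case: ifP => //; rewrite ltnS leq_min -ltnS Bl /= => /negbT; rewrite -ltnNge => pB.
by rewrite ffact_small // mul0n mul0r.
Qed.

End MainAsymptotic.

From mathcomp Require Import all_classical all_reals all_analysis measurable_realfun.
Import numFieldNormedType.Exports.
Local Open Scope classical_set_scope.
Local Open Scope ring_scope.

(** * Expectations of products of independent variables *)

Section ProductExpectation.
Context (d : measure_display) (T : measurableType d) (R : realType) (P : probability T R).
Local Open Scope ereal_scope.
Import HBNNSimple.

(** The factorisation passes from indicators to simple functions by additivity, then to [g] by
    monotone convergence. [Z] is arbitrary because it will be the product of the remaining
    factors. *)
Lemma ge0_integral_mul_of_indic (X Z : T -> R) (mX : measurable_fun setT X)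
    (mZ : measurable_fun setT Z) (Z0 : forall w, (0 <= Z w)%R) :
    \int[P]_w (Z w)%:E \is a fin_num ->
    (forall B : set R, measurable B ->
      \int[P]_w (\1_B (X w) * Z w)%:E = P (X @^-1` B) * \int[P]_w (Z w)%:E) ->
  forall g : R -> R, measurable_fun setT g -> (forall y, (0 <= g y)%R) ->
    \int[P]_w (g (X w) * Z w)%:E = \int[P]_w (g (X w))%:E * \int[P]_w (Z w)%:E.
Proof.
move=> Zfin hB g mg g0.
have mXB (B : set R) : measurable B -> measurable (X @^-1` B).
  by move=> mB; rewrite -[X @^-1` B]setTI; exact: mX.
have mgE : measurable_fun setT (EFin \o g) by exact/measurable_EFinP.
pose s := nnsfun_approx measurableT mgE.
have s0 n y : (0 <= s n y)%R by [].
have ms n : measurable_fun [set: T] (fun w => s n (X w)) by exact: measurableT_comp.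
have simple n : \int[P]_w (s n (X w) * Z w)%:E =
    \int[P]_w (s n (X w))%:E * \int[P]_w (Z w)%:E.
  have mBr r : measurable (s n @^-1` [set r]) by exact: measurable_funPTI.
  (* Here [r] ranges over all reals; a negative value has empty preimage, so every summand stays
     non-negative. *)
  have rI r y : (0 <= r * \1_(s n @^-1` [set r]) y)%R.
    have [r_ge|r_lt] := leP 0%R r; first by rewrite mulr_ge0.
    by rewrite preimage_nnfun0 // indic0 mulr0.
  have mI r : measurable_fun [set: T] (fun w => \1_(s n @^-1` [set r]) (X w) : R).
    by apply: measurableT_comp => //; exact: measurable_indic.
  have rP r : r%:E * P (X @^-1` (s n @^-1` [set r])) = \int[P]_w (r * \1_(s n @^-1` [set r]) (X w))%:E.
    have [r_ge|r_lt] := leP 0%R r; last first.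
      rewrite preimage_nnfun0 // preimage_set0 measure0 mule0.
      by under eq_integral do rewrite indic0 mulr0; rewrite integral0.
    under eq_integral do rewrite EFinM.
    rewrite [RHS](ge0_integralZl_EFin _ measurableT) //; last exact/measurable_EFinP.
    rewrite (eq_integral (fun w => (\1_(X @^-1` (s n @^-1` [set r])) w)%:E)) //.
    by rewrite integral_indic ?setIT //; exact: mXB.
  have e1 : \int[P]_w (s n (X w))%:E =
      \sum_(r \in range (s n)) (r%:E * P (X @^-1` (s n @^-1` [set r]))).
    under eq_integral do rewrite fimfunE -fsumEFin//.
    rewrite ge0_integral_fsum//; last 2 first.
    - by move=> r; apply/measurable_EFinP; exact: measurable_funM.
    - by move=> r w _; rewrite lee_fin.
    by apply: eq_fsbigr => r _; rewrite rP.
  rewrite e1 ge0_mule_fsuml; last first.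
    by move=> r; rewrite rP integral_ge0 // => w _; rewrite lee_fin.
  transitivity (\int[P]_w (\sum_(r \in range (s n)) (r * \1_(s n @^-1` [set r]) (X w) * Z w)%:E)).
    apply: eq_integral => w _; rewrite fsumEFin // fimfunE; congr EFin.
    by rewrite mulr_fsuml.
  rewrite ge0_integral_fsum//; last 2 first.
  - by move=> r; apply/measurable_EFinP; do 2 apply: measurable_funM => //.
  - by move=> r w _; rewrite lee_fin mulr_ge0.
  apply: eq_fsbigr => r _; have [r_ge|r_lt] := leP 0%R r; last first.
    rewrite preimage_nnfun0 // preimage_set0 measure0 mule0 mul0e.
    by under eq_integral do rewrite indic0 mulr0 mul0r; rewrite integral0.
  under eq_integral do rewrite -mulrA EFinM.
  rewrite (ge0_integralZl_EFin _ measurableT) //; last 2 first.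
  - by move=> w _; rewrite lee_fin mulr_ge0.
  - by apply/measurable_EFinP; exact: measurable_funM.
  by rewrite hB // muleA.
have scvg y : (s n y)%:E @[n --> \oo] --> (g y)%:E.
  by apply: (@cvg_nnsfun_approx _ _ _ _ measurableT _ mgE) => // x _; rewrite lee_fin.
have snd y : {homo (fun n => s n y) : m n / (m <= n)%N >-> (m <= n)%R}.
  by move=> m n mn; exact/lefP/nd_nnsfun_approx.
have c1 : \int[P]_w (s n (X w) * Z w)%:E @[n --> \oo] --> \int[P]_w (g (X w) * Z w)%:E.
  rewrite [X in _ --> X](_ : _ = \int[P]_w limn (fun n => (s n (X w) * Z w)%:E)).
    apply: cvg_monotone_convergence => //.
    - by move=> n; apply/measurable_EFinP; exact: measurable_funM.
    - by move=> n w _; rewrite lee_fin mulr_ge0.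
    - by move=> w _ m n mn; rewrite lee_fin ler_wpM2r // snd.
  apply: eq_integral => w _; apply/esym/cvg_lim => //.
  under eq_fun do rewrite EFinM; rewrite EFinM; exact: cvgeZr.
have c2 : \int[P]_w (s n (X w))%:E @[n --> \oo] --> \int[P]_w (g (X w))%:E.
  rewrite [X in _ --> X](_ : _ = \int[P]_w limn (fun n => (s n (X w))%:E)).
    apply: cvg_monotone_convergence => //.
    - by move=> n; exact/measurable_EFinP.
    - by move=> n w _; rewrite lee_fin.
    - by move=> w _ m n mn; rewrite lee_fin snd.
  by apply: eq_integral => w _; apply/esym/cvg_lim.
have c3 := cvgeZr Zfin c2.
have -> : \int[P]_w (g (X w) * Z w)%:E = limn (fun n => \int[P]_w (s n (X w) * Z w)%:E).
  by apply/esym/cvg_lim.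
under eq_fun do rewrite simple.
by apply/cvg_lim.
Qed.

End ProductExpectation.

Section IndependentProducts.
Context (d : measure_display) (T : measurableType d) (R : realType) (P : probability T R).
Variables (K : choiceType) (X : K -> {RV P >-> R}).
Local Open Scope ereal_scope.

Hypothesis indepX : forall (s : seq K) (B : K -> set R), uniq s -> (forall k, measurable (B k)) ->
  P (\bigcap_(k in [set` s]) (X k @^-1` B k)) = \prod_(k <- s) P (X k @^-1` B k).

Lemma prod_indic_bigcap (s : seq K) (B : K -> set R) w :
  (\prod_(k <- s) \1_(B k) (X k w))%R = \1_(\bigcap_(k in [set` s]) (X k @^-1` B k)) w :> R.
Proof.
rewrite [RHS]indicE; elim: s => [|k s IH].
  rewrite big_nil; suff -> : w \in \bigcap_(k in [set` [::]]) (X k @^-1` B k) by [].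
  by apply/mem_set => k.
rewrite big_cons IH indicE -natrM mulnb; congr (_%:R)%R; congr nat_of_bool.
apply/andP/idP => [[/set_mem h1 /set_mem h2]|/set_mem h].
  by apply/mem_set => j /=; rewrite inE => /orP[/eqP->//|]; exact: h2.
split; apply/mem_set; first by apply: h; rewrite /= mem_head.
by move=> j /= js; apply: h; rewrite /= inE js orbT.
Qed.

Lemma measurable_bigcap_seq (s : seq K) (B : K -> set R) : (forall k, measurable (B k)) ->
  measurable (\bigcap_(k in [set` s]) (X k @^-1` B k)).
Proof.
move=> mB; rewrite bigcap_seq; apply: bigsetI_measurable => k _.
by rewrite -[X in measurable X]setTI; exact: measurable_funP.
Qed.

(** Indicators are traded for general factors one at a time: testing the first factor of [s1]
    against the indicator of a set [B0] is the induction hypothesis with [k] moved into [s2]. *)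
Lemma ge0_indep_prod_indic (g : K -> R -> R) (m : K -> R) (s1 s2 : seq K) (B : K -> set R) :
    uniq (s1 ++ s2) -> (forall k, measurable_fun setT (g k)) -> (forall k y, (0 <= g k y)%R) ->
    (forall k, \int[P]_w (g k (X k w))%:E = (m k)%:E) -> (forall k, measurable (B k)) ->
  \int[P]_w ((\prod_(k <- s1) g k (X k w)) * \prod_(k <- s2) \1_(B k) (X k w))%:E =
  ((\prod_(k <- s1) m k) * \prod_(k <- s2) fine (P (X k @^-1` B k)))%:E.
Proof.
move=> us mg g0 hm.
have mXB k (C : set R) : measurable C -> measurable (X k @^-1` C).
  by move=> mC; rewrite -[X in measurable X]setTI; exact: measurable_funP.
elim: s1 s2 B us => [|k s1 IH] s2 B us mB.
  under eq_integral do rewrite big_nil mul1r prod_indic_bigcap.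
  transitivity (P (\bigcap_(k in [set` s2]) (X k @^-1` B k))).
    by rewrite integral_indic ?setIT //; exact: measurable_bigcap_seq.
  rewrite indepX // big_nil mul1r; elim: {us} s2 => [|k s IHs]; first by rewrite !big_nil.
  by rewrite !big_cons IHs EFinM fineK // fin_num_measure //; exact: mXB.
move: us; rewrite /= mem_cat negb_or => /andP[/andP[ks1 ks2] us].
pose Z w := ((\prod_(j <- s1) g j (X j w)) * \prod_(j <- s2) \1_(B j) (X j w))%R.
have ZE : \int[P]_w (Z w)%:E = ((\prod_(k <- s1) m k) * \prod_(k <- s2) fine (P (X k @^-1` B k)))%:E.
  exact: IH.
have mZ : measurable_fun setT Z.
  apply: measurable_funM; apply: measurable_prod => j _; apply: measurableT_comp => //.
have Z0 w : (0 <= Z w)%R by rewrite mulr_ge0 // prodr_ge0.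
under eq_integral => w _.
  rewrite big_cons -mulrA -/(Z w); over.
rewrite (ge0_integral_mul_of_indic (X := X k) _ mZ Z0) //.
- by rewrite ZE hm -EFinM big_cons mulrA.
- by rewrite ZE.
move=> B0 mB0; rewrite ZE.
pose B' j := if j == k then B0 else B j.
have mB' j : measurable (B' j) by rewrite /B'; case: ifP.
have us' : uniq (s1 ++ k :: s2).
  by rewrite -[k :: s2]cat1s uniq_catCA /= mem_cat negb_or ks1 ks2 us.
have B'k : B' k = B0 by rewrite /B' eqxx.
have B's j : j \in s2 -> B' j = B j.
  by move=> js; rewrite /B'; case: eqP => // jk; rewrite -jk js in ks2.
have := IH (k :: s2) B' us' mB'; rewrite big_cons B'k => IHk.
have -> : P (X k @^-1` B0) = (fine (P (X k @^-1` B0)))%:E.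
  by rewrite fineK // fin_num_measure //; exact: mXB.
rewrite -EFinM.
transitivity (\int[P]_w ((\prod_(j <- s1) g j (X j w)) *
    \prod_(j <- k :: s2) \1_(B' j) (X j w))%:E).
  apply: eq_integral => w _; congr EFin; rewrite big_cons B'k /Z mulrCA.
  by congr (_ * (_ * _))%R; apply: eq_big_seq => j js; rewrite B's.
rewrite IHk; congr EFin; rewrite mulrCA; congr (_ * (_ * _))%R.
by apply: eq_big_seq => j js; rewrite B's.
Qed.

Lemma ge0_indep_prod (g : K -> R -> R) (m : K -> R) (s : seq K) :
    uniq s -> (forall k, measurable_fun setT (g k)) -> (forall k y, (0 <= g k y)%R) ->
    (forall k, \int[P]_w (g k (X k w))%:E = (m k)%:E) ->
  \int[P]_w (\prod_(k <- s) g k (X k w))%:E = (\prod_(k <- s) m k)%:E.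
Proof.
move=> us mg g0 hm.
have := @ge0_indep_prod_indic g m s [::] (fun=> setT); rewrite cats0 big_nil mulr1 => <- //.
by apply: eq_integral => w _; rewrite big_nil mulr1.
Qed.

Lemma integrable_indep_prod (f : K -> R -> R) (s : seq K) :
    uniq s -> (forall k, measurable_fun setT (f k)) ->
    (forall k, P.-integrable setT (EFin \o (f k \o X k))) ->
  P.-integrable setT (fun w => (\prod_(k <- s) f k (X k w))%:E).
Proof.
move=> us mf intf; apply/integrableP; split.
  apply/measurable_EFinP; apply: measurable_prod => k _; exact: measurableT_comp.
pose m k := fine (\int[P]_w (`|f k (X k w)|%R)%:E).
have hm k : \int[P]_w (`|f k (X k w)|%R)%:E = (m k)%:E.
  rewrite fineK //; have /integrable_abse /integrable_fin_num := intf k.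
  by move=> /(_ measurableT).
rewrite [ltLHS](_ : _ = (\prod_(k <- s) m k)%:E) ?ltry //.
rewrite -(@ge0_indep_prod (fun k y => `|f k y|%R)) //.
  by apply: eq_integral => w _; rewrite abse_EFin normr_prod.
by move=> k; exact: measurableT_comp.
Qed.

Lemma indep_prod (f : K -> R -> R) (m : K -> R) (s : seq K) :
    uniq s -> (forall k, measurable_fun setT (f k)) ->
    (forall k, P.-integrable setT (EFin \o (f k \o X k))) ->
    (forall k, \int[P]_w (f k (X k w))%:E = (m k)%:E) ->
  \int[P]_w (\prod_(k <- s) f k (X k w))%:E = (\prod_(k <- s) m k)%:E.
Proof.
move=> us mf intf hm.
(* Induction on a list [s1] outside which all factors are non-negative; each step splits one factor
   into its positive and negative parts. *)
suff H : forall (s1 : seq K) (f : K -> R -> R) (m : K -> R),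
    (forall k, measurable_fun setT (f k)) ->
    (forall k, P.-integrable setT (EFin \o (f k \o X k))) ->
    (forall k, \int[P]_w (f k (X k w))%:E = (m k)%:E) ->
    (forall k, k \notin s1 -> forall y, (0 <= f k y)%R) ->
  \int[P]_w (\prod_(k <- s) f k (X k w))%:E = (\prod_(k <- s) m k)%:E.
  (* Factors outside [s] are replaced by zero, which meets the sign condition with [s1 = s]. *)
  pose f' k y := if k \in s then f k y else 0%R.
  pose m' k := if k \in s then m k else 0%R.
  transitivity (\int[P]_w (\prod_(k <- s) f' k (X k w))%:E).
    by apply: eq_integral => w _; congr EFin; apply: eq_big_seq => k ks; rewrite /f' ks.
  rewrite (H s f' m'); first by congr EFin; apply: eq_big_seq => k ks; rewrite /m' ks.
  - by move=> k; rewrite /f'; case: (k \in s).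
  - move=> k; rewrite /f' /comp; case: (k \in s); first exact: intf.
    exact: integrable0.
  - move=> k; rewrite /f' /m'; case: (k \in s); first exact: hm.
    by rewrite integral0.
  - by move=> k ks y; rewrite /f' (negbTE ks).
elim=> [|j s1 IH] {mf intf hm m f} f m mf intf hm f0.
  by apply: ge0_indep_prod => // k y; exact: f0.
pose fp k y := if k == j then Num.max (f k y) 0%R else f k y.
pose fn k y := if k == j then Num.max (- f k y)%R 0%R else f k y.
have mfp k : measurable_fun setT (fp k).
  by rewrite /fp; case: (k == j) => //; exact: measurable_maxr.
have mfn k : measurable_fun setT (fn k).
  rewrite /fn; case: (k == j) => //; apply: measurable_maxr => //; exact: measurableT_comp.
have le_p k y : (`|fp k y| <= `|f k y|)%R.
  by rewrite /fp; case: ifP => // _; case: (leP (f k y) 0%R) => h; rewrite ?normr0.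
have le_n k y : (`|fn k y| <= `|f k y|)%R.
  by rewrite /fn; case: ifP => // _; case: (leP (- f k y)%R 0%R) => h; rewrite ?normr0 ?normrN.
have ip k : P.-integrable setT (EFin \o (fp k \o X k)).
  apply: le_integrable (intf k) => //.
    by apply/measurable_EFinP; exact: measurableT_comp.
  by move=> w _; rewrite !abse_EFin lee_fin le_p.
have in_ k : P.-integrable setT (EFin \o (fn k \o X k)).
  apply: le_integrable (intf k) => //.
    by apply/measurable_EFinP; exact: measurableT_comp.
  by move=> w _; rewrite !abse_EFin lee_fin le_n.
pose mp k := fine (\int[P]_w (fp k (X k w))%:E).
pose mn k := fine (\int[P]_w (fn k (X k w))%:E).
have hmp k : \int[P]_w (fp k (X k w))%:E = (mp k)%:E.
  by rewrite fineK //; have := integrable_fin_num measurableT (ip k).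
have hmn k : \int[P]_w (fn k (X k w))%:E = (mn k)%:E.
  by rewrite fineK //; have := integrable_fin_num measurableT (in_ k).
have fp0 k : k \notin s1 -> forall y, (0 <= fp k y)%R.
  move=> ks y; rewrite /fp; case: eqP => [->|/eqP kj]; first by rewrite le_max lexx orbT.
  by apply: f0; rewrite inE negb_or kj.
have fn0 k : k \notin s1 -> forall y, (0 <= fn k y)%R.
  move=> ks y; rewrite /fn; case: eqP => [->|/eqP kj]; first by rewrite le_max lexx orbT.
  by apply: f0; rewrite inE negb_or kj.
have IHp := IH fp mp mfp ip hmp fp0.
have IHn := IH fn mn mfn in_ hmn fn0.
have other k : k != j -> mp k = m k /\ mn k = m k.
  move=> /negbTE kj; have := hm k; rewrite /mp /mn /fp /fn kj => -> //.
have fE y : (f j y = fp j y - fn j y)%R.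
  rewrite /fp /fn eqxx; case: (leP (f j y) 0%R) => h; case: (leP (- f j y)%R 0%R) => h'; rewrite ?subr0 ?sub0r ?opprK //.
  - by apply/eqP; rewrite eq_le h -oppr_le0.
  - by have := lt_trans h; rewrite oppr_gt0 in h'; have := lt_asym (f j y) 0%R; rewrite h h'.
have mE : m j = (mp j - mn j)%R.
  apply: EFin_inj; rewrite EFinB -hm -hmp -hmn -(integralB_EFin measurableT (ip j) (in_ j)).
  by apply: eq_integral => w _; rewrite fE EFinB.
have [js|js] := boolP (j \in s); last first.
  transitivity (\int[P]_w (\prod_(k <- s) fp k (X k w))%:E).
    apply: eq_integral => w _; congr EFin; apply: eq_big_seq => k ks; rewrite /fp.
    by case: eqP => // kj; rewrite -kj ks in js.
  rewrite IHp; congr EFin; apply: eq_big_seq => k ks.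
  have kj : k != j by apply: contraNneq js => <-.
  by have [] := other k kj.
have split_prod (h : K -> R) : (\prod_(k <- s) h k = h j * \prod_(k <- rem j s) h k)%R.
  by rewrite (big_rem j js).
have rem_neq k : k \in rem j s -> k != j.
  by rewrite mem_rem_uniq // inE => /andP[].
have pE w : (\prod_(k <- s) f k (X k w) =
    \prod_(k <- s) fp k (X k w) - \prod_(k <- s) fn k (X k w))%R.
  rewrite !(split_prod (fun k => _ k (X k w))) fE mulrBl; congr (_ * _ - _ * _)%R;
  by apply: eq_big_seq => k /rem_neq/negbTE kj; rewrite /fp /fn kj.
transitivity (\int[P]_w ((\prod_(k <- s) fp k (X k w))%:E - (\prod_(k <- s) fn k (X k w))%:E)).
  by apply: eq_integral => w _; rewrite -EFinB pE.
rewrite integralB_EFin //; [|exact: integrable_indep_prod|exact: integrable_indep_prod].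
rewrite IHp IHn -EFinB; congr EFin; rewrite !split_prod mE mulrBl; congr (_ * _ - _ * _)%R;
by apply: eq_big_seq => k /rem_neq/other[].
Qed.

End IndependentProducts.

(** * Covariances of traces *)

Section TraceCovariance.
Context (d : measure_display) (T : measurableType d) (R : realType) (P : probability T R).
Variables (Y : nat -> nat -> {RV P >-> R}).
Hypotheses (indepY : mutually_independent Y) (idY : identically_distributed Y).
Local Notation X := (fun k : nat * nat => Y k.1 k.2).

Variable l : nat.
Hypothesis momY : ('E_P[(fun w => Y 0%N 0%N w ^+ (2 * l))%R] < +oo)%E.

Definition mom (k : nat) : R := fine 'E_P[(fun w => Y 0%N 0%N w ^+ k)%R].

Lemma measurable_pow (k : nat) : measurable_fun setT (fun y : R => y ^+ k).
Proof. exact: measurable_funX. Qed.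

Lemma integrable_pow0 k : (k <= 2 * l)%N ->
  P.-integrable setT (EFin \o ((fun y : R => y ^+ k) \o Y 0%N 0%N)).
Proof.
move=> kl; have mYk i : measurable_fun setT (fun w => Y 0%N 0%N w ^+ i) by exact: measurable_funX.
have ev (y : R) : 0 <= y ^+ (2 * l) by rewrite exprM exprn_ge0 // sqr_ge0.
have int2l : P.-integrable setT (fun w => (Y 0%N 0%N w ^+ (2 * l))%:E).
  apply/integrableP; split; first exact/measurable_EFinP.
  have := momY; rewrite unlock; apply: le_lt_trans.
  rewrite le_eqVlt; apply/orP; left; apply/eqP.
  by apply: eq_integral => w _; rewrite abse_EFin ger0_norm.
have int1 : P.-integrable setT (fun _ : T => (1 : R)%:E).
  by apply: finite_measure_integrable_cst.
(* Domination by [|y| ^ k <= 1 + y ^ (2 * l)]. *)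
apply: le_integrable (integrableD measurableT int1 int2l) => //.
  by apply/measurable_EFinP; exact: mYk.
move=> w _ /=; rewrite lee_fin normrX [leRHS]ger0_norm ?addr_ge0 //.
set y := Y 0%N 0%N w; have -> : y ^+ (2 * l) = `|y| ^+ (2 * l).
  by rewrite !exprM real_normK ?num_real.
have [y1|y1] := leP `|y| 1.
  by apply: le_trans (exprn_ile1 _ _ _) _; rewrite // lerDl exprn_ge0.
by rewrite ler_wpDl // ler_weXn2l // ltW.
Qed.

Lemma pushforwardX k (A : set R) : measurable A ->
  pushforward P (X k) A = pushforward P (Y 0%N 0%N) A.
Proof. exact: idY. Qed.

Lemma integrable_pow k i : (i <= 2 * l)%N ->
  P.-integrable setT (EFin \o ((fun y : R => y ^+ i) \o X k)).
Proof.
move=> il; have mE : measurable_fun setT (fun y : R => (`|y ^+ i|%R)%:E).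
  by apply/measurable_EFinP; apply: measurableT_comp => //; exact: measurable_pow.
have /integrableP[_ h] := integrable_pow0 il; apply/integrableP; split.
  by apply/measurable_EFinP; apply: measurableT_comp => //; exact: measurable_pow.
apply: le_lt_trans h; rewrite le_eqVlt; apply/orP; left; apply/eqP.
have pf (Z : {RV P >-> R}) : (\int[P]_w `|(EFin \o ((fun y : R => (y ^+ i)%R) \o Z)) w| =
    \int[pushforward P Z]_y (`|y ^+ i|%R)%:E)%E.
  by rewrite ge0_integral_pushforward.
rewrite !pf; apply: eq_measure_integral => A mA _; exact: pushforwardX.
Qed.

Lemma expectation_pow k i : (i <= 2 * l)%N -> (\int[P]_w (X k w ^+ i)%:E = (mom i)%:E)%E.
Proof.
move=> il; have mE : measurable_fun setT (fun y : R => (y ^+ i)%:E).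
  by apply/measurable_EFinP; exact: measurable_pow.
have -> : (\int[P]_w (X k w ^+ i)%:E = \int[P]_w (Y 0%N 0%N w ^+ i)%:E)%E.
  have pf (Z : {RV P >-> R}) : P.-integrable setT (EFin \o ((fun y : R => y ^+ i) \o Z)) ->
     (\int[P]_w (Z w ^+ i)%:E = \int[pushforward P Z]_y (y ^+ i)%:E)%E.
    by move=> iZ; rewrite (integral_pushforward _ mE).
  rewrite !pf; [|exact: integrable_pow0|exact: integrable_pow].
  apply: eq_measure_integral => A mA _; exact: pushforwardX.
rewrite /mom unlock fineK //.
by have := integrable_fin_num measurableT (integrable_pow0 il).
Qed.

(** Integrability travels with the value, since linearity of the integral requires it. *)
Definition has_expectation (f : T -> R) (m : R) :=
  P.-integrable setT (EFin \o f) /\ (\int[P]_w (f w)%:E = m%:E)%E.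

Lemma has_expectation_sum (I : finType) (f : I -> T -> R) (m : I -> R) :
  (forall i, has_expectation (f i) (m i)) ->
  has_expectation (fun w => \sum_i f i w) (\sum_i m i).
Proof.
move=> h; have E : EFin \o (fun w => \sum_i f i w) = fun w => (\sum_i (f i w)%:E)%E.
  by apply/funext => w /=; rewrite sumEFin.
have hi i : P.-integrable setT (fun w => (f i w)%:E) by case: (h i).
split; first by rewrite E; apply: integrable_sum => // i _; exact: hi.
under eq_integral do rewrite -sumEFin.
rewrite (integral_sum measurableT) // -sumEFin; apply: eq_bigr => i _.
by case: (h i).
Qed.

Lemma has_expectationM (c : R) (f : T -> R) m :
  has_expectation f m -> has_expectation (fun w => c * f w) (c * m).
Proof.
move=> [hi hE]; split.
  by have := integrableZl measurableT c hi; apply: eq_integrable => // w _.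
under eq_integral do rewrite EFinM.
by rewrite (integralZl measurableT) // hE.
Qed.

(** Entries are grouped by multiplicity and the product runs over the whole grid, absent entries
    having exponent 0. A word of length at most [2 * l] needs no moment beyond the assumed one. *)
Lemma has_expectation_word p n (w : seq ('I_p * 'I_n)) : (size w <= 2 * l)%N ->
  has_expectation (fun o => wprod (Xmat Y p n o) w) (wmom mom w).
Proof.
move=> sw; pose h (e : 'I_p * 'I_n) := (val e.1, val e.2).
have hinj : injective h by move=> [i j] [i' j'] [/val_inj-> /val_inj->].
pose s := map h (enum {: 'I_p * 'I_n}).
pose f (k : nat * nat) (y : R) := y ^+ count_mem k (map h w).
have us : uniq s by rewrite map_inj_uniq // enum_uniq.
have cl k : (count_mem k (map h w) <= 2 * l)%N.
  by apply: leq_trans (count_size _ _) _; rewrite size_map.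
have mf k : measurable_fun setT (f k) by exact: measurable_pow.
have fi k : P.-integrable setT (EFin \o (f k \o X k)) by exact: integrable_pow.
have fE k : (\int[P]_o (f k (X k o))%:E = (mom (count_mem k (map h w)))%:E)%E.
  exact: expectation_pow.
have ch e : count_mem (h e) (map h w) = count_mem e w.
  by rewrite count_map; apply: eq_count => e' /=; rewrite (inj_eq hinj).
have E o : wprod (Xmat Y p n o) w = \prod_(k <- s) f k (X k o).
  rewrite /wprod prod_count /s big_map big_enum /=; apply: eq_bigr => e _.
  by rewrite /f ch mxE.
split.
  have -> : EFin \o (fun o => wprod (Xmat Y p n o) w) = EFin \o (fun o => \prod_(k <- s) f k (X k o)).
    by apply/funext => o /=; rewrite E.
  exact: (integrable_indep_prod (X := X)).
under eq_integral do rewrite E.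
rewrite (indep_prod (X := X) indepY us mf fi fE); congr EFin.
rewrite /s big_map big_enum /wmom /=; apply: eq_bigr => e _.
by rewrite ch.
Qed.

End TraceCovariance.

Lemma scale_mx_exp (R : comPzRingType) p (c : R) (A : 'M[R]_p) k :
  (c *: A) ^+ k = c ^+ k *: A ^+ k.
Proof.
elim: k => [|k IH]; first by rewrite !expr0 scale1r.
by rewrite !exprS IH -!mulmxE -scalemxAl -scalemxAr scalerA.
Qed.

Section CovarianceFormula.
Context (d : measure_display) (T : measurableType d) (R : realType) (P : probability T R).
Variables (Y : nat -> nat -> {RV P >-> R}).
Hypotheses (indepY : mutually_independent Y) (idY : identically_distributed Y).
Variables a b : nat.
Hypothesis momY : ('E_P[(fun w => Y 0%N 0%N w ^+ (2 * (a.+1 + b.+1)))%R] < +oo)%E.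
Local Notation nu := (mom Y).

Lemma trSpow_walks p n m o : trSpow Y p n m.+1 o =
  n%:R^-1 ^+ m.+1 * \sum_(f : {ffun 'I_m.+1 -> 'I_p * 'I_n}) wprod (Xmat Y p n o) (ew fst snd pair f).
Proof. by rewrite /trSpow /Smat scale_mx_exp mxtraceZ trace_walks. Qed.

Lemma has_expectation_trSpow p n m : (m.+1 <= a.+1 + b.+1)%N ->
  has_expectation P (trSpow Y p n m.+1) (n%:R^-1 ^+ m.+1 *
    \sum_(f : {ffun 'I_m.+1 -> 'I_p * 'I_n}) wmom nu (ew fst snd pair f)).
Proof.
move=> mab; rewrite (_ : trSpow Y p n m.+1 = fun o => n%:R^-1 ^+ m.+1 *
  \sum_(f : {ffun 'I_m.+1 -> 'I_p * 'I_n}) wprod (Xmat Y p n o) (ew fst snd pair f)); last first.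
  by apply/funext => o; exact: trSpow_walks.
apply: has_expectationM; apply: has_expectation_sum => f.
by apply: (has_expectation_word indepY idY momY); rewrite size_ew -mul2n leq_mul2l.
Qed.

Lemma has_expectation_trSpowM p n :
  has_expectation P (trSpow Y p n a.+1 * trSpow Y p n b.+1) (n%:R^-1 ^+ (a.+1 + b.+1) *
    \sum_(f : {ffun 'I_a.+1 -> 'I_p * 'I_n}) \sum_(g : {ffun 'I_b.+1 -> 'I_p * 'I_n})
      wmom nu (ew fst snd pair f ++ ew fst snd pair g)).
Proof.
rewrite (_ : (_ * _)%R = fun o => n%:R^-1 ^+ (a.+1 + b.+1) *
  \sum_(f : {ffun 'I_a.+1 -> 'I_p * 'I_n}) \sum_(g : {ffun 'I_b.+1 -> 'I_p * 'I_n})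
    wprod (Xmat Y p n o) (ew fst snd pair f ++ ew fst snd pair g)); last first.
  apply/funext => o; rewrite [LHS](_ : _ = trSpow Y p n a.+1 o * trSpow Y p n b.+1 o) // !trSpow_walks mulrACA -exprD; congr (_ * _).
  rewrite mulr_suml; apply: eq_bigr => f _; rewrite mulr_sumr; apply: eq_bigr => g _.
  by rewrite /wprod big_cat.
apply: has_expectationM; apply: has_expectation_sum => f; apply: has_expectation_sum => g.
by apply: (has_expectation_word indepY idY momY); rewrite size_ew_cat mul2n.
Qed.

Lemma covariance_trSpow p n : covariance P (trSpow Y p n a.+1) (trSpow Y p n b.+1) =
  (n%:R^-1 ^+ (a.+1 + b.+1) * wcovsum nu a b p n)%:E.
Proof.
have [i1 E1] := @has_expectation_trSpow p n a (leq_addr _ _).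
have [i2 E2] := @has_expectation_trSpow p n b (leq_addl _ _).
have [i12 E12] := has_expectation_trSpowM p n.
rewrite covarianceE; [|exact/Lfun1_integrable..].
rewrite !expectation.unlock E1 E2 E12 -EFinM -EFinB; congr EFin.
rewrite mulrACA -exprD -mulrBr; congr (_ * _); rewrite /wcovsum mulr_suml -sumrB.
by apply: eq_bigr => f _; rewrite mulr_sumr -sumrB.
Qed.

End CovarianceFormula.

Lemma main_termE (R : realType) l1 l2 p n B (kappa : R) :
  main_term l1 l2 p n B kappa = n%:R^-1 ^+ (l1 + l2) *
   ((p ^_ B * (n - B) ^_ (l1 + l2 - B))%:R *
      ((2 * csum l1 l2 B)%:R + kappa * (dsum l1 l2 B)%:R)).
Proof.
rewrite /main_term -!bin_ffact.
have -> : Ccoef l1 l2 B = (B`! * (l1 + l2 - B)`! * (2 * csum l1 l2 B))%N.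
  by rewrite /Ccoef -/(csum l1 l2 B); lia.
have -> : Dcoef l1 l2 B = (B`! * (l1 + l2 - B)`! * dsum l1 l2 B)%N by [].
by rewrite !natrM exprVn; ring.
Qed.

Theorem theorem2 (d : measure_display) (T : measurableType d) (R : realType)
  (P : probability T R) (Y : nat -> nat -> {RV P >-> R}) (l1 l2 : nat) :
  (0 < l1)%N -> (0 < l2)%N ->
  mutually_independent Y ->
  identically_distributed Y ->
  ('E_P[Y 0%N 0%N] = 0%:E)%E ->
  ('E_P[(fun w => Y 0%N 0%N w ^+ 2)%R] = 1%:E)%E ->
  ('E_P[(fun w => Y 0%N 0%N w ^+ (2 * l1 + 2 * l2))%R] < +oo)%E ->
  exists C : R, forall p n : nat, (p <= n)%N ->
    exists e : nat -> R,
      (forall b : nat, (1 <= b <= minn (l1 + l2) p)%N ->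
         `|e b| <= C * (p%:R ^+ b / n%:R ^+ b.+1)) /\
      covariance P (trSpow Y p n l1) (trSpow Y p n l2)
      = (\sum_(1 <= b < (minn (l1 + l2) p).+1)
           (main_term l1 l2 p n b
              (fine 'E_P[(fun w => Y 0%N 0%N w ^+ 4)%R] - 3) + e b))%:E.
Proof.
case: l1 l2 => [|a] [|b] // _ _ indepY idY EY EY2; rewrite -mulnDr => momY.
have m0 : mom Y 0 = 1.
  by rewrite /mom (_ : (fun w => Y 0%N 0%N w ^+ 0) = cst 1) ?expectation_cst.
have m1 : mom Y 1 = 0.
  by rewrite /mom [X in fine X]EY.
have m2 : mom Y 2 = 1 by rewrite /mom EY2.
have [C C0 hC] := main_asymp a b m0 m1 m2.
exists C => p n pn.
set kappa := fine _ - 3.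
pose l := (a.+1 + b.+1)%N.
pose D := n%:R^-1 ^+ l * wcovsum (mom Y) a b p n -
  \sum_(1 <= B < (minn l p).+1) main_term a.+1 b.+1 p n B kappa.
exists (fun B => if B == 1%N then D else 0); split.
  move=> B /andP[B1]; rewrite leq_min => /andP[_ Bp].
  have p0 : (0 < p)%N by exact: leq_trans Bp.
  have n0 : (0 < n)%N by exact: leq_trans pn.
  case: eqP => [->|_]; last by rewrite normr0 mulr_ge0 // divr_ge0 // exprn_ge0.
  rewrite /D (eq_bigr _ (fun B _ => main_termE a.+1 b.+1 p n B kappa)) -mulr_sumr -mulrBr.
  rewrite normrM ger0_norm ?exprn_ge0 ?invr_ge0 //.
  apply: le_trans (ler_wpM2l _ (hC p n p0 pn)) _; first by rewrite exprn_ge0 ?invr_ge0.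
  have n0' : n%:R != 0 :> R by rewrite pnatr_eq0 -lt0n.
  rewrite le_eqVlt; apply/orP; left; apply/eqP.
  (* The weight [p * n ^ (a + b)] divided by [n ^ (a + b + 2)] is exactly [p / n ^ 2]. *)
  rewrite /wP (_ : l = (a + b).+2) ?exprVn; last by rewrite /l; lia.
  by rewrite !exprS; move: (expf_neq0 (a + b) n0') => h; field; rewrite n0' h.
rewrite covariance_trSpow //; congr EFin; rewrite big_split /=.
(* For [p = 0] no term [b = 1] is available to carry the error, but then the grid is empty and there
   are no walks. *)
case: p pn @D => [|p] pn D.
  rewrite minn0 !big_geq // /wcovsum big1 ?mulr0 ?addr0 // => f _.
  by case: (f ord0) => -[].
rewrite [X in _ + X]big_ltn ?ltnS ?leq_min // eqxx [X in _ + (_ + X)]big1_seq; last first.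
  by move=> B /andP[_]; rewrite mem_index_iota => /andP[]; case: B => [|[]].
by rewrite addr0 /D addrC subrK.
Qed.
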